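(* Let $\operatorname{char}\mathbb{K}=p>0$, let $n\ge 2$ with $p\mid n$, and suppose $\mathcal{E}_{gh}\ne 0$ in $\overline{\mathcal{T}}_n$. Then the Hopf algebras $\overline{\mathcal{T}}_n'(p)$, $\overline{\mathcal{T}}_n(p)$ and $\overline{\mathcal{T}}_n(p;d_j,d_{j-1},\ldots,d_1)$, for all integers $1\le j\le p-2$ and $d_j\ge d_{j-1}\ge\cdots\ge d_1\ge 1$, are AS-Gorenstein.
   Context: $\mathbb{K}$ is a field and $[a,b]=ab-ba$. On words in the letters $g,h$ use the lexicographic order with $g\prec h$ (a proper prefix of a word is smaller than the word). A Lyndon word is a nonempty word $\alpha$ which is a single letter or satisfies $\alpha\prec\gamma\beta$ for every factorization $\alpha=\beta\gamma$ into nonempty words. $\alpha(g)$ is the number of occurrences of $g$ in $\alpha$. The standard factorization of a Lyndon word $\alpha$ of length at least $2$ is $\alpha=\beta\gamma$ with $\beta,\gamma$ Lyndon and $\gamma$ of maximal length. Define $E_g=g$, $E_h=h$ and $E_\alpha=[E_\beta,E_\gamma]$ for the standard factorization $\alpha=\beta\gamma$. $\mathcal{T}=\mathbb{K}\langle g,h\rangle$ is the free algebra with bialgebra structure $\Delta(g)=g\otimes g$, $\Delta(h)=1\otimes h+h\otimes g$, $\epsilon(g)=1$, $\epsilon(h)=0$. $\overline{\mathcal{T}}=\mathcal{T}/\mathcal{I}$ is the quotient bialgebra by the ideal generated by all $E_\alpha$ with $\alpha$ Lyndon and $\alpha(g)\ge 2$. For $k\ge 0$, $\omega_k=gh^k$,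 so $E_{\omega_0}=g$, $E_{\omega_1}=E_{gh}=[g,h]$, $E_{\omega_k}=[E_{\omega_{k-1}},h]$; $\mathcal{E}_{\omega_k}$ is the image of $E_{\omega_k}$ in a quotient, $\mathcal{E}_{gh}=\mathcal{E}_{\omega_1}$. Define the quotient Hopf algebras $\overline{\mathcal{T}}_n=\overline{\mathcal{T}}/(g^n-1)$, $\overline{\mathcal{T}}_n'(p)=\overline{\mathcal{T}}_n/(\mathcal{E}_{\omega_{p-1}})$, $\overline{\mathcal{T}}_n(p)=\overline{\mathcal{T}}_n'(p)/(h^p)$, $\overline{\mathcal{T}}_n(p;d_j,\ldots,d_1)=\overline{\mathcal{T}}_n(p)/(\mathcal{E}_{\omega_k}^{p^{d_k}}\mid 1\le k\le j)$. An augmented Noetherian algebra $(A,\epsilon)$ over $\mathbb{K}$ is AS-Gorenstein (Artin–Schelter Gorenstein) if (a) the injective dimension of ${}_AA$ is $d<\infty$; (b) $\dim_{\mathbb{K}}\operatorname{Ext}_A^d({}_A\mathbb{K},{}_AA)=1$ and $\operatorname{Ext}_A^i({}_A\mathbb{K},{}_AA)=0$ for all $i\ne d$; (c) the right-module versions of (a) and (b) hold. Here the augmentation is the counit. *)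

(* Defs.v *)
From HB Require Import structures.
From mathcomp Require Import all_boot all_order all_algebra.
From mathcomp Require Import boolp.
From mathcomp Require Import finmap.
From mathcomp.multinomials Require Import monalg.

Set Implicit Arguments.
Unset Strict Implicit.
Unset Printing Implicit Defensive.

Import Order.TTheory GRing.Theory.
Local Open Scope ring_scope.
Local Open Scope quotient_scope.

(* [lmodType R]: modules are left modules. *)

Section Modules.
Variable R : nzRingType.

Definition projective_module (P : lmodType R) : Prop :=
  forall (M N : lmodType R) (f : {linear M -> N}) (u : {linear P -> N}),
    (forall y, exists x, f x = y) ->
    exists v : {linear P -> M}, forall x, f (v x) = u x.

Definition injective_module (I : lmodType R) : Prop :=
  forall (M N : lmodType R) (f : {linear M -> N}) (u : {linear M -> I}),
    injective f ->
    exists v : {linear N -> I}, forall x, v (f x) = u x.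

Record projective_resolution (M : lmodType R) := ProjectiveResolution {
  pr_obj :> nat -> lmodType R;
  pr_diff : forall i, {linear pr_obj i.+1 -> pr_obj i};
  pr_aug : {linear pr_obj 0%N -> M};
  pr_projective : forall i, projective_module (pr_obj i);
  pr_aug_surj : forall y, exists x, pr_aug x = y;
  pr_exact0 : forall x, pr_aug x = 0 <-> exists y, pr_diff 0%N y = x;
  pr_exactS : forall i x, pr_diff i x = 0 <-> exists y, pr_diff i.+1 y = x
}.

(* [M] has an injective resolution concentrated in degrees [0..d]. *)
Definition injdim_le (M : lmodType R) (d : nat) : Prop :=
  exists (I : nat -> lmodType R) (delta : forall i, {linear I i -> I i.+1})
         (eta : {linear M -> I 0%N}),
    [/\ forall i, injective_module (I i),
        injective eta,
        forall x, delta 0%N x = 0 <-> exists y, eta y = x,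
        forall i x, delta i.+1 x = 0 <-> exists y, delta i y = x
      & forall i, (d < i)%N -> forall x : I i, x = 0].

Definition injdim (M : lmodType R) (d : nat) : Prop :=
  injdim_le M d /\ forall m, (m < d)%N -> ~ injdim_le M m.

Definition left_ideal (J : R -> Prop) : Prop :=
  [/\ J 0, forall x y, J x -> J y -> J (x + y) & forall a x, J x -> J (a * x)].

Definition left_noetherian : Prop :=
  forall J, left_ideal J ->
  exists s : seq R,
    forall x, J x <->
      exists c : 'I_(size s) -> R, x = \sum_(i < size s) c i * s`_i.

End Modules.

Section Ext.
Variables (K : fieldType) (A : algType K).

(* The cochain complex [Hom_A(P, N)]. *)
Definition cocycle (M N : lmodType A) (P : projective_resolution M) i
    (f : {linear P i -> N}) : Prop :=
  forall x, f (pr_diff P i x) = 0.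

Definition coboundary (M N : lmodType A) (P : projective_resolution M) i :
    (P i -> N) -> Prop :=
  match i with
  | 0 => fun f => forall x, f x = 0
  | i'.+1 => fun f =>
      exists u : {linear P i' -> N}, forall x, f x = u (pr_diff P i' x)
  end.

(* [dim_K Ext_A^i(M, N) = m]: there are [m] cocycles whose classes are a
   [K]-basis of cocycles modulo coboundaries, [K] acting through [K -> A]
   (which is central).  By the comparison theorem the choice of the projective
   resolution does not matter. *)
Definition ext_dim (M N : lmodType A) (i m : nat) : Prop :=
  exists (P : projective_resolution M) (b : 'I_m -> {linear P i -> N}),
    (forall k, cocycle (b k)) /\
    forall f : {linear P i -> N}, cocycle f ->
      exists! c : 'rV[K]_m,
        coboundary (fun x => f x - \sum_k (c 0 k)%:A *: b k x).

End Ext.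

Record augAlg (K : fieldType) := AugAlg {
  aug_alg :> algType K;
  aug : {lrmorphism aug_alg -> K | *%R}
}.

(* [K] as a left module through the augmentation. *)
Definition trivial_module (K : fieldType) (A : augAlg K) : Type := K.

Section TrivialModule.
Variables (K : fieldType) (A : augAlg K).
Local Notation V := (trivial_module A).

HB.instance Definition _ := GRing.Zmodule.on V.

Definition trivial_scale (a : A) (v : V) : V := aug A a * (v : K).

Fact trivial_scaleA a b v :
  trivial_scale a (trivial_scale b v) = trivial_scale (a * b) v.
Proof. by rewrite /trivial_scale rmorphM mulrA. Qed.
Fact trivial_scale1 : left_id 1 trivial_scale.
Proof. by move=> v; rewrite /trivial_scale rmorph1 mul1r. Qed.
Fact trivial_scaleDr : right_distributive trivial_scale +%R.
Proof. by move=> a u v; apply: mulrDr. Qed.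
Fact trivial_scaleDl v : {morph trivial_scale^~ v : a b / a + b}.
Proof. by move=> a b; rewrite /trivial_scale rmorphD mulrDl. Qed.

HB.instance Definition _ := GRing.Zmodule_isLmodule.Build A V
  trivial_scaleA trivial_scale1 trivial_scaleDr trivial_scaleDl.

End TrivialModule.

(* Right [A]-modules are left modules over the opposite algebra [A^c].  The
   library only provides the ring structure of [A^c]; as [A^c] is convertible
   to [A], these instances must exist before [A^c] is used as an algebra. *)
Section Converse.
Variables (K : fieldType) (A : algType K).

HB.instance Definition _ := GRing.Zmodule_isLmodule.Build K A^c
  (@scalerA K A) (@scale1r K A) (@scalerDr K A) (@scalerDl K A).

Fact converse_scalerAl (c : K) (x y : A^c) : c *: (x * y) = (c *: x) * y.
Proof. exact: (@scalerAr K A c y x). Qed.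
HB.instance Definition _ :=
  GRing.Lmodule_isLalgebra.Build K A^c converse_scalerAl.

Fact converse_scalerAr (c : K) (x y : A^c) : c *: (x * y) = x * (c *: y).
Proof. exact: (@scalerAl K A c y x). Qed.
HB.instance Definition _ :=
  GRing.Lalgebra_isAlgebra.Build K A^c converse_scalerAr.

End Converse.

Section ConverseAug.
Variables (K : fieldType) (A : augAlg K).

Definition converse_aug_fun (x : A^c) : K := aug A x.

Fact converse_aug_zmod : zmod_morphism converse_aug_fun.
Proof. by move=> x y; apply: (raddfB (aug A)). Qed.
HB.instance Definition _ :=
  GRing.isZmodMorphism.Build A^c K converse_aug_fun converse_aug_zmod.
Fact converse_aug_monoid : monoid_morphism converse_aug_fun.
Proof.
split=> [|x y]; first exact: (rmorph1 (aug A)).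
by rewrite mulrC; apply: (rmorphM (aug A)).
Qed.
HB.instance Definition _ :=
  GRing.isMonoidMorphism.Build A^c K converse_aug_fun converse_aug_monoid.
Fact converse_aug_scale : scalable_for *%R converse_aug_fun.
Proof. by move=> c x; apply: (linearZ_LR (aug A)). Qed.
HB.instance Definition _ :=
  GRing.isScalable.Build K A^c K *%R converse_aug_fun converse_aug_scale.

Definition converse_augAlg : augAlg K := @AugAlg K A^c converse_aug_fun.

Lemma converse_mulE (x y : A) :
  (x : converse_augAlg) * (y : converse_augAlg) = y * x.
Proof. by []. Qed.

End ConverseAug.

Definition regular_module (K : fieldType) (A : augAlg K) : lmodType A :=
  (A : nzRingType)^o.

Definition left_AS_condition (K : fieldType) (A : augAlg K) (d : nat) : Prop :=
  [/\ injdim (regular_module A) d,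
      ext_dim (trivial_module A) (regular_module A) d 1
    & forall i, i != d -> ext_dim (trivial_module A) (regular_module A) i 0].

Definition AS_Gorenstein (K : fieldType) (A : augAlg K) : Prop :=
  [/\ left_noetherian A, left_noetherian (converse_augAlg A)
    & exists d : nat,
        left_AS_condition A d /\ left_AS_condition (converse_augAlg A) d].

Section TwoSidedIdeal.
Variables (K : fieldType) (A : algType K) (S : A -> Prop).

Inductive ideal_gen : A -> Prop :=
| IdealGen0 : ideal_gen 0
| IdealGenD x y : ideal_gen x -> ideal_gen y -> ideal_gen (x + y)
| IdealGenM a s b : S s -> ideal_gen (a * s * b).

Lemma ideal_genMl a x : ideal_gen x -> ideal_gen (a * x).
Proof.
elim=> [|u v _ Iu _ Iv|b s c Ss]; rewrite ?mulr0 ?mulrDr ?mulrA.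
- exact: IdealGen0.
- exact: IdealGenD.
- exact: IdealGenM.
Qed.

Lemma ideal_genMr a x : ideal_gen x -> ideal_gen (x * a).
Proof.
elim=> [|u v _ Iu _ Iv|b s c Ss]; rewrite ?mul0r ?mulrDl.
- exact: IdealGen0.
- exact: IdealGenD.
- by rewrite -!mulrA mulrA; apply: IdealGenM.
Qed.

Definition ideal_pred : {pred A} := fun x => `[< ideal_gen x >].

Lemma ideal_predP x : reflect (ideal_gen x) (x \in ideal_pred).
Proof. exact: asboolP. Qed.

Fact ideal_pred_closed : zmod_closed ideal_pred.
Proof.
split=> [|x y /ideal_predP Ix /ideal_predP Iy]; apply/ideal_predP.
  exact: IdealGen0.
by apply: IdealGenD => //; rewrite -mulN1r; apply: ideal_genMl.
Qed.
HB.instance Definition _ :=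
  GRing.isZmodClosed.Build A ideal_pred ideal_pred_closed.

End TwoSidedIdeal.

(* [A/(S)]; that the augmentation kills [S] makes the quotient nonzero, as the
   library requires of algebras, and gives it an augmentation. *)
Section AugQuotient.
Variables (K : fieldType) (A : augAlg K) (S : A -> Prop).
Hypothesis augS : forall x, S x -> aug A x = 0.

Local Notation I := (ideal_pred S : zmodClosed A).

Definition quotient_sort of (forall x, S x -> aug A x = 0) : Type :=
  Quotient.quot I.
Local Notation Q := (quotient_sort augS).

HB.instance Definition _ := Choice.on Q.
HB.instance Definition _ := EqQuotient.on Q.
HB.instance Definition _ := GRing.Zmodule.on Q.
HB.instance Definition _ := ZmodQuotient.on Q.

Lemma quotient_eqP (x y : A) : \pi_Q x = \pi_Q y <-> ideal_gen S (x - y).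
Proof.
have e : (x - y \in ideal_pred S) = (\pi_Q x == \pi_Q y).
  exact: (Quotient.idealrBE I x y).
by split=> [/eqP|/ideal_predP]; [rewrite -e => /ideal_predP|rewrite e => /eqP].
Qed.

Definition quotient_one : Q := \pi_Q 1.
Definition quotient_mul (x y : Q) : Q := \pi_Q (repr x * repr y).
Definition quotient_scale (c : K) (x : Q) : Q := \pi_Q (c *: repr x).

Lemma quotient_ind (P : Q -> Prop) : (forall x, P (\pi_Q x)) -> forall q, P q.
Proof. by move=> Ppi q; rewrite -[q]reprK; apply: Ppi. Qed.

Lemma quotient_repr (x : A) : ideal_gen S (repr (\pi_Q x) - x).
Proof. by apply/quotient_eqP; rewrite reprK. Qed.

Lemma quotient_piM x y : \pi_Q (x * y) = quotient_mul (\pi_Q x) (\pi_Q y).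
Proof.
apply/esym/quotient_eqP.
set x' := repr _; set y' := repr _.
have -> : x' * y' - x * y = (x' - x) * y' + x * (y' - y).
  by rewrite mulrBl mulrBr addrA subrK.
by apply: IdealGenD; [apply: ideal_genMr|apply: ideal_genMl];
   apply: quotient_repr.
Qed.

Lemma quotient_piZ c x : \pi_Q (c *: x) = quotient_scale c (\pi_Q x).
Proof.
apply/esym/quotient_eqP; rewrite -scalerBr -mulr_algl.
exact/ideal_genMl/quotient_repr.
Qed.

Lemma quotient_piD x y : \pi_Q (x + y) = \pi_Q x + \pi_Q y :> Q.
Proof. by rewrite (raddfD (\pi_Q : A -> Q)). Qed.

Fact quotient_mulA : associative quotient_mul.
Proof.
by move=> x y z; elim/quotient_ind: x => x; elim/quotient_ind: y => y;
  elim/quotient_ind: z => z; rewrite -!quotient_piM mulrA.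
Qed.
Fact quotient_mul1 : left_id quotient_one quotient_mul.
Proof. by move=> x; elim/quotient_ind: x => x; rewrite -quotient_piM mul1r. Qed.
Fact quotient_mulr1 : right_id quotient_one quotient_mul.
Proof. by move=> x; elim/quotient_ind: x => x; rewrite -quotient_piM mulr1. Qed.
Fact quotient_mulDl : left_distributive quotient_mul +%R.
Proof.
move=> x y z; elim/quotient_ind: x => x; elim/quotient_ind: y => y;
  elim/quotient_ind: z => z.
by rewrite -quotient_piD -!quotient_piM mulrDl quotient_piD.
Qed.
Fact quotient_mulDr : right_distributive quotient_mul +%R.
Proof.
move=> x y z; elim/quotient_ind: x => x; elim/quotient_ind: y => y;
  elim/quotient_ind: z => z.
by rewrite -quotient_piD -!quotient_piM mulrDr quotient_piD.
Qed.

Lemma aug_ideal x : ideal_gen S x -> aug A x = 0.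
Proof.
elim=> [|u v _ Iu _ Iv|a s b Ss]; first exact: rmorph0.
  by rewrite rmorphD /= Iu Iv addr0.
by rewrite 2!rmorphM /= (augS Ss) mulr0 mul0r.
Qed.

Fact quotient_one_neq0 : quotient_one != 0.
Proof.
apply/eqP=> e; have /aug_ideal : ideal_gen S 1.
  by rewrite -[1]subr0; apply/quotient_eqP; rewrite -/quotient_one e raddf0.
by rewrite rmorph1 => /eqP; rewrite oner_eq0.
Qed.

HB.instance Definition _ := GRing.Zmodule_isNzRing.Build Q
  quotient_mulA quotient_mul1 quotient_mulr1 quotient_mulDl quotient_mulDr
  quotient_one_neq0.

Fact quotient_scaleA a b (v : Q) :
  quotient_scale a (quotient_scale b v) = quotient_scale (a * b) v.
Proof. by elim/quotient_ind: v => v; rewrite -!quotient_piZ scalerA. Qed.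
Fact quotient_scale1 : left_id 1 quotient_scale.
Proof. by move=> v; elim/quotient_ind: v => v;
  rewrite -quotient_piZ scale1r. Qed.
Fact quotient_scaleDr : right_distributive quotient_scale +%R.
Proof.
move=> a u v; elim/quotient_ind: u => u; elim/quotient_ind: v => v.
by rewrite -quotient_piD -!quotient_piZ scalerDr quotient_piD.
Qed.
Fact quotient_scaleDl v : {morph quotient_scale^~ v : a b / a + b}.
Proof.
by move=> a b; elim/quotient_ind: v => v;
  rewrite -!quotient_piZ scalerDl quotient_piD.
Qed.
HB.instance Definition _ := GRing.Zmodule_isLmodule.Build K Q
  quotient_scaleA quotient_scale1 quotient_scaleDr quotient_scaleDl.

Fact quotient_scaleAl c (x y : Q) : c *: (x * y) = (c *: x) * y.
Proof.
elim/quotient_ind: x => x; elim/quotient_ind: y => y;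
  rewrite /GRing.mul /GRing.scale /=.
by rewrite -quotient_piM -!quotient_piZ -quotient_piM scalerAl.
Qed.
HB.instance Definition _ :=
  GRing.Lmodule_isLalgebra.Build K Q quotient_scaleAl.

Fact quotient_scaleAr c (x y : Q) : c *: (x * y) = x * (c *: y).
Proof.
elim/quotient_ind: x => x; elim/quotient_ind: y => y;
  rewrite /GRing.mul /GRing.scale /=.
by rewrite -quotient_piM -!quotient_piZ -quotient_piM scalerAr.
Qed.
HB.instance Definition _ :=
  GRing.Lalgebra_isAlgebra.Build K Q quotient_scaleAr.

Definition quotient_aug (x : Q) : K := aug A (repr x).

Lemma quotient_augE x : quotient_aug (\pi_Q x) = aug A x.
Proof.
apply/eqP; rewrite -subr_eq0 -raddfB.
exact/eqP/aug_ideal/quotient_repr.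
Qed.

Fact quotient_aug_zmod : zmod_morphism quotient_aug.
Proof.
move=> x y; elim/quotient_ind: x => x; elim/quotient_ind: y => y.
by rewrite -(raddfB (\pi_Q : A -> Q)) !quotient_augE raddfB.
Qed.
HB.instance Definition _ :=
  GRing.isZmodMorphism.Build Q K quotient_aug quotient_aug_zmod.
Fact quotient_aug_monoid : monoid_morphism quotient_aug.
Proof.
split=> [|x y]; first by rewrite quotient_augE rmorph1.
elim/quotient_ind: x => x; elim/quotient_ind: y => y;
  rewrite [_ * _ in LHS]/GRing.mul /= -quotient_piM.
by rewrite !quotient_augE rmorphM.
Qed.
HB.instance Definition _ :=
  GRing.isMonoidMorphism.Build Q K quotient_aug quotient_aug_monoid.
Fact quotient_aug_scale : scalable_for *%R quotient_aug.
Proof.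
move=> c x; elim/quotient_ind: x => x;
  rewrite [_ *: _ in LHS]/GRing.scale /= -quotient_piZ.
by rewrite !quotient_augE linearZ.
Qed.
HB.instance Definition _ :=
  GRing.isScalable.Build K Q K *%R quotient_aug quotient_aug_scale.

Definition quotient : augAlg K := @AugAlg K Q quotient_aug.

Definition quotient_map (x : A) : quotient := \pi_Q x.

End AugQuotient.

Definition word := seq bool.
Definition lg : bool := false.
Definition lh : bool := true.

(* The order of [seqlexi bool] is the lexicographic one with [lg < lh], where
   a proper prefix is smaller; [rot i w] is [drop i w ++ take i w]. *)
Definition lyndon (w : word) : bool :=
  (w != [::]) &&
  all (fun i => w < rot i w :> seqlexi bool)%O (iota 1 (size w).-1).

(* The length of the left factor of the standard factorization: the right
   factor is longest when the left one is shortest. *)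
Definition std_cut (w : word) : nat :=
  head 1%N [seq i <- iota 1 (size w).-1
           | lyndon (take i w) && lyndon (drop i w)].

Definition omega (k : nat) : word := lg :: nseq k lh.

(* Standard bracketing [E_w], with the letters interpreted by [x]; only
   meaningful on Lyndon words.  [k] bounds the length of the word. *)
Section Bracket.
Variables (R : nzRingType) (x : bool -> R).

Definition commutator (a b : R) : R := a * b - b * a.

Fixpoint bracket_rec (k : nat) (w : word) : R :=
  match k, w with
  | 0, _ | _, [::] => 0
  | _, [:: c] => x c
  | k'.+1, _ => commutator (bracket_rec k' (take (std_cut w) w))
                           (bracket_rec k' (drop (std_cut w) w))
  end.

Definition bracket (w : word) : R := bracket_rec (size w) w.

Lemma std_cut_bounds w : (1 < size w)%N -> (0 < std_cut w < size w)%N.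
Proof.
rewrite /std_cut => w2; set s := filter _ _.
have : forall i, i \in s -> (0 < i < size w)%N.
  move=> i; rewrite mem_filter mem_iota => /andP[_].
  by rewrite add1n prednK // (ltn_trans _ w2).
by case: s => [|i s] //= /(_ i); apply; rewrite mem_head.
Qed.

Lemma bracket_letter c : bracket [:: c] = x c.
Proof. by []. Qed.

Lemma bracket_standard w : (1 < size w)%N ->
  bracket w = commutator (bracket (take (std_cut w) w))
                         (bracket (drop (std_cut w) w)).
Proof.
have szP (u : word) m : (1 < size u)%N -> (size u <= m.+1)%N ->
    (size (take (std_cut u) u) <= m)%N /\ (size (drop (std_cut u) u) <= m)%N.
  move=> /std_cut_bounds/andP[c0 c1] um.
  split; first by rewrite size_takel ?(ltnW c1) // -ltnS (leq_trans c1).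
  by rewrite size_drop leq_subLR (leq_trans um) // -add1n leq_add2r.
have indep k l (u : word) : (size u <= k)%N -> (size u <= l)%N ->
    bracket_rec k u = bracket_rec l u.
  elim: k l u => [|k IH] [|l] [|a [|b u]] // uk ul.
  have [tk dk] := szP [:: a, b & u] k isT uk.
  have [tl dl] := szP [:: a, b & u] l isT ul.
  move: tk dk tl dl; rewrite [LHS]/= [RHS]/=; move: (std_cut _) => c.
  by move=> tk dk tl dl; congr commutator; apply: IH.
case: w => [|a [|b u]] // w2; have [tk dk] := szP _ _ w2 (leqnn _).
by rewrite /bracket -(indep _ _ _ tk (leqnn _)) -(indep _ _ _ dk (leqnn _)).
Qed.

End Bracket.

Lemma aug_bracket (K : fieldType) (A : augAlg K) (x : bool -> A) w :
  (1 < size w)%N -> aug A (bracket x w) = 0.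
Proof.
by move=> /bracket_standard ->; rewrite rmorphB !rmorphM /= mulrC subrr.
Qed.

Fact malg_scalerAr (M : monomType) (R : comNzRingType)
    (c : R) (x y : {malg R[M]}) :
  c *: (x * y) = x * (c *: y).
Proof.
rewrite -!mul_malgC !mulrA; congr (_ * _).
rewrite (malgMEw (msuppC_le _) (fsubset_refl _)).
rewrite (malgMEw (fsubset_refl _) (msuppC_le _)).
rewrite exchange_big /=; apply: eq_bigr => k _.
by rewrite !big_seq_fset1 mul1m mulm1 mulrC.
Qed.

Section FreeAlgebra.
Variable K : fieldType.

(* An alias of the monoid algebra: the library gives it an [algType] structure
   for commutative monoids only. *)
Definition free_alg : Type := {malg K[{fmonom bool}]}.

HB.instance Definition _ := GRing.Lalgebra.on free_alg.
HB.instance Definition _ :=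
  GRing.Lalgebra_isAlgebra.Build K free_alg
    (@malg_scalerAr {fmonom bool} K).

(* The counit: [g |-> 1], [h |-> 0]. *)
Definition counit_word (m : {fmonom bool}) : K :=
  \prod_(c <- (m : seq bool)) (c == lg)%:R.

Fact counit_word_mmorphism : mmorphism counit_word.
Proof.
by split=> [x y|]; rewrite /counit_word ?fmM ?fm1 ?big_cat ?big_nil.
Qed.
HB.instance Definition _ :=
  isMultiplicative.Build {fmonom bool} K counit_word counit_word_mmorphism.

Definition counit : free_alg -> K := mmap idfun counit_word.
HB.instance Definition _ := GRing.LRMorphism.copy counit (mmap idfun counit_word).

Definition free_augAlg : augAlg K := @AugAlg K free_alg counit.

Definition letter (c : bool) : free_augAlg := << FMonom [:: c] >>.

Lemma counit_letter c : aug free_augAlg (letter c) = (c == lg)%:R.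
Proof.
apply: (etrans (mmapU (f := idfun) (h := counit_word) 1 (FMonom [:: c]))).
by rewrite mul1r /counit_word big_seq1.
Qed.

Definition E : word -> free_augAlg := bracket letter.

Lemma aug_E w : (1 < size w)%N -> aug free_augAlg (E w) = 0.
Proof. exact: aug_bracket. Qed.

Definition Tbar_rel (x : free_augAlg) : Prop :=
  exists w : word, [/\ lyndon w, (2 <= count_mem lg w)%N & x = E w].

Fact Tbar_rel_aug x : Tbar_rel x -> aug free_augAlg x = 0.
Proof.
case=> w [_ gw ->]; apply: aug_E.
exact: leq_trans gw (count_size _ _).
Qed.

Definition Tbar : augAlg K := quotient Tbar_rel_aug.
Definition Tbar_map : free_augAlg -> Tbar := @quotient_map _ _ _ Tbar_rel_aug.

Lemma aug_quotient_map (A : augAlg K) (S : A -> Prop)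
    (augS : forall x, S x -> aug A x = 0) x :
  aug (quotient augS) (quotient_map augS x) = aug A x.
Proof. exact: quotient_augE. Qed.

Section Tn.
Variable n : nat.

Definition Tn_rel (x : Tbar) : Prop :=
  x = Tbar_map (letter lg) ^+ n - 1.

Fact Tn_rel_aug x : Tn_rel x -> aug Tbar x = 0.
Proof.
move=> ->; rewrite rmorphB rmorphXn rmorph1 /=.
by rewrite quotient_augE counit_letter expr1n subrr.
Qed.

Definition Tn : augAlg K := quotient Tn_rel_aug.
Definition Tn_map (x : free_augAlg) : Tn :=
  quotient_map Tn_rel_aug (Tbar_map x).

Lemma aug_Tn_map x : aug Tn (Tn_map x) = aug free_augAlg x.
Proof. by rewrite !aug_quotient_map. Qed.

Section Tnp.
Variables (p : nat) (charKp : p \in [pchar K]).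

Lemma char_gt1 : (1 < p)%N.
Proof. exact/prime_gt1/(pcharf_prime charKp). Qed.

Definition Tn'p_rel (x : Tn) : Prop := x = Tn_map (E (omega p.-1)).

Fact Tn'p_rel_aug x : Tn'p_rel x -> aug Tn x = 0.
Proof.
move=> ->; rewrite aug_Tn_map aug_E //= size_nseq.
by rewrite prednK ?char_gt1 // ltnW // char_gt1.
Qed.

Definition Tn'p : augAlg K := quotient Tn'p_rel_aug.
Definition Tn'p_map (x : free_augAlg) : Tn'p :=
  quotient_map Tn'p_rel_aug (Tn_map x).

Lemma aug_Tn'p_map x : aug Tn'p (Tn'p_map x) = aug free_augAlg x.
Proof. by rewrite aug_quotient_map aug_Tn_map. Qed.

Definition Tnp_rel (x : Tn'p) : Prop := x = Tn'p_map (letter lh) ^+ p.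

Fact Tnp_rel_aug x : Tnp_rel x -> aug Tn'p x = 0.
Proof.
move=> ->; rewrite rmorphXn /= aug_Tn'p_map counit_letter.
by rewrite expr0n gtn_eqF // ltnW // char_gt1.
Qed.

Definition Tnp : augAlg K := quotient Tnp_rel_aug.
Definition Tnp_map (x : free_augAlg) : Tnp :=
  quotient_map Tnp_rel_aug (Tn'p_map x).

Lemma aug_Tnp_map x : aug Tnp (Tnp_map x) = aug free_augAlg x.
Proof. by rewrite aug_quotient_map aug_Tn'p_map. Qed.

Variables (j : nat) (d : nat -> nat).

Definition Tnpd_rel (x : Tnp) : Prop :=
  exists k : nat,
    (1 <= k <= j)%N /\ x = Tnp_map (E (omega k)) ^+ (p ^ d k).

Fact Tnpd_rel_aug x : Tnpd_rel x -> aug Tnp x = 0.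
Proof.
case=> k [/andP[k0 _] ->]; rewrite rmorphXn /= aug_Tnp_map aug_E.
  by rewrite expr0n expn_eq0 gtn_eqF // ltnW // char_gt1.
by rewrite /= size_nseq.
Qed.

(* Only the values of [d] on [1..j] matter. *)
Definition Tnpd : augAlg K := quotient Tnpd_rel_aug.

End Tnp.
End Tn.
End FreeAlgebra.

(* Main.v *)
From HB Require Import structures.
Require Import Defs.
From mathcomp Require Import all_boot all_order all_algebra.
From mathcomp Require Import boolp classical_sets finmap.
From mathcomp.multinomials Require Import monalg.
From mathcomp Require Import zify.

Set Implicit Arguments.
Unset Strict Implicit.
Unset Printing Implicit Defensive.
Import GRing.Theory.
Local Open Scope ring_scope.

(** Put [q = p - 1] and [x_k = E_(g h^k)], so that [x_0 = g]. Among the words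
    with two letters [g] are the [g h^i g h^j] with [i < j], whose bracketing is
    the commutator of [x_i] and [x_j]. Hence in each of the algebras the [x_k]
    commute, the commutator of [x_k] and [h] is [x_(k+1)], and [x_q = 0]. In
    addition [g^n = 1], and possibly [h^p = 0] and [x_k^(p^(d_k)) = 0]. In
    characteristic [p], with exponents [N_k] and [N_q] divisible by [p], the powers
    [x_k^(N_k)] and [h^(N_q)] are central. Take [N_0 = n], for the other letters
    the exponent of the relation that bounds them, or [p] if there is none, and
    let [C] be the polynomial ring on the powers of the unbounded letters. Every
    algebra [A] of the statement is then a Frobenius extension of the central
    subring [C]: the words [x^r h^b] with exponents below the [N_i] and the
    words [h^(N_q-1-b) x^(N-1-r)] are dual bases for the [C]-linear form [lam]
    reading off the coefficient of the word with all exponents [N_i - 1]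
    ([normal_form_frobenius]). Straightening words shows that they span. That
    [lam] is well defined comes from a representation on polynomials in
    [x_0, ..., x_(q-1)] and one more letter [t], with powers reduced by the
    bounds on the letters: there [g] multiplies by [x_0] and [h] acts as
    [t - delta], where [delta] is the derivation sending each [x_i] to
    [x_(i+1)], and [x_(q-1)] and [t] to zero. It exists because [p] divides the
    [N_i], so that differentiating is compatible with the reduction. The bracket
    of a word acts up to a scalar as [h], as one of the [x_k], or as zero when
    the word has at least two letters [g] ([acts_by_count_bracket]), so that all
    relations hold in the representation ([kill_bracket], [kill_order_h]).

    It remains to see that a Frobenius extension [A] of a polynomial ring
    [C = K[y_1, ..., y_d]], with an augmentation killing the [y_l], is
    Artin-Schelter Gorenstein ([frobenius_AS_Gorenstein]). The module
    [Hom_K(A, C)] is injective; the operators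
    [theta_l f = f(y_l -) - y_l f] on it commute, each of them maps the common
    kernel of the previous ones onto itself ([theta_onto]), and the common
    kernel of all of them is [Hom_C(A, C)], which [lam] identifies with [A].
    Iterated cones of the [theta_l] give an injective resolution of [A] of
    length [d] ([injdim_common_kernel]). By dimension shifting along the same
    operators, [Ext^i(K, -)] of the common kernel of the first [k] of them is
    [C / (y_1, ..., y_k)] for [i = k] and zero otherwise ([class_factsP]); for
    [k = d] this is the required computation of [Ext^i(K, A)], and it excludes
    shorter resolutions. Left ideals are finitely generated by the argument of
    Hilbert's basis theorem ([hilbert_basis]). Exchanging the two dual bases
    makes the opposite algebra a Frobenius extension too, which gives the
    conditions on right modules. *)

(** * Linear maps and submodules *)

Definition mklin (R : nzRingType) (U V : lmodType R) (f : U -> V)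
    (fL : linear f) : {linear U -> V} :=
  HB.pack f (GRing.isLinear.Build R U V *:%R f fL).

(** Many linear maps below are only given by their graphs. *)
Lemma linear_choice (R : nzRingType) (U V : lmodType R) (G : U -> V -> Prop) :
    (forall x, exists y, G x y) ->
    (forall x, forall y z, G x y -> G x z -> y = z) ->
    (forall a x y u v, G x u -> G y v -> G (a *: x + y) (a *: u + v)) ->
  exists f : {linear U -> V}, forall x, G x (f x).
Proof.
move=> totG funG linG.
have /choice[f Gf] := totG.
have fL : linear f.
  by move=> a x y; apply: (funG _ _ _ (Gf _)); apply: linG.
by exists (mklin fL).
Qed.

Section Submodules.
Variables (R : nzRingType) (M : lmodType R).

(** Membership is a proposition: kernels and images need not be decidable. *)
Record submodule := Submodule {
  in_sub :> M -> Prop;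
  _ : in_sub 0;
  _ : forall a x y, in_sub x -> in_sub y -> in_sub (a *: x + y) }.

Variable S : submodule.

Definition sub_pred : {pred M} := fun x => `[<S x>].

Fact sub_pred_closed : submod_closed sub_pred.
Proof.
rewrite /sub_pred; case: S => P P0 PL; split; first exact/asboolP.
by move=> a x y /asboolP Px /asboolP Py; apply/asboolP/PL.
Qed.
HB.instance Definition _ :=
  GRing.isSubmodClosed.Build R M sub_pred sub_pred_closed.

Definition submod : Type := {x : M | sub_pred x}.
HB.instance Definition _ := [isSub of submod for @sval M sub_pred].
HB.instance Definition _ := [Choice of submod by <:].
HB.instance Definition _ := [SubChoice_isSubLmodule of submod by <:].

Definition sub_incl : {linear submod -> M} := val.

Lemma sub_incl_inj : injective sub_incl.
Proof. exact: val_inj. Qed.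

Lemma sub_inclP (x : submod) : S (sub_incl x).
Proof. exact/asboolP/(valP x). Qed.

Lemma sub_incl_onto x : S x -> exists y : submod, sub_incl y = x.
Proof. by move=> /asboolP Sx; exists (Sub x Sx). Qed.

End Submodules.

Arguments sub_incl {R M S} : simpl never.

Definition full_submodule (R : nzRingType) (M : lmodType R) : submodule M :=
  @Submodule R M (fun _ => True) I (fun _ _ _ _ _ => I).

(** * Lifting and extending linear maps *)

Section Lifting.
Variable R : nzRingType.
Implicit Types M N P I : lmodType R.

(** Projectivity for the submodule of the pairs [(m, x)] with [m] in [S] above
    [u x], which projects onto [P]. *)
Lemma projective_lift P M N (S : submodule M) (f : {linear M -> N})
    (u : {linear P -> N}) : projective_module P ->
    (forall x, exists2 m, S m & f m = u x) ->
  exists v : {linear P -> M}, forall x, S (v x) /\ f (v x) = u x.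
Proof.
move=> projP fu.
pose Q (z : M * P) := S z.1 /\ f z.1 = u z.2.
have Q0 : Q 0 by split; [case: (S) | rewrite !linear0].
have QL a x y : Q x -> Q y -> Q (a *: x + y).
  move=> [Sx fx] [Sy fy]; split; last by rewrite !linearP /= fx fy.
  by case: (S) Sx Sy => T /= _; apply.
pose QS := Submodule Q0 QL.
have pL : linear (fun z : submod QS => (sub_incl z).2) by move=> a x y; rewrite linearP.
have idL : linear (@idfun P) by [].
have [x|v vP] := projP _ _ (mklin pL) (mklin idL).
  by have [m Sm fm] := fu x; have [y yE] := @sub_incl_onto _ _ QS (m, x) (conj Sm fm);
     exists y; exact: (congr1 snd yE).
have wL : linear (fun x => (sub_incl (v x)).1) by move=> a x y; rewrite !linearP.
exists (mklin wL) => x; have [S1 S2] := sub_inclP (v x); split=> //.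
by rewrite S2; congr (u _); apply: vP.
Qed.

(** The map [u] factors through the image of [f], a submodule of [N]. *)
Lemma injective_extend I M N (f : {linear M -> N}) (u : {linear M -> I}) :
    injective_module I -> (forall x, f x = 0 -> u x = 0) ->
  exists v : {linear N -> I}, forall x, v (f x) = u x.
Proof.
move=> injI fu.
have Im0 : exists x, f x = 0 by exists 0; rewrite linear0.
have ImL a y z : (exists x, f x = y) -> (exists x, f x = z) ->
    exists x, f x = a *: y + z.
  by move=> [x <-] [x' <-]; exists (a *: x + x'); rewrite linearP.
pose T := Submodule Im0 ImL.
have [|||w wP] := @linear_choice _ (submod T) I
    (fun t y => exists2 x, f x = sub_incl t & y = u x).
- by move=> t; have [x fx] := sub_inclP t; exists (u x), x.
- move=> t y z [x fx ->] [x' fx' ->]; apply/eqP; rewrite -subr_eq0 -linearB.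
  by apply/eqP/fu; rewrite linearB fx fx' subrr.
- move=> a t t' y y' [x fx ->] [x' fx' ->].
  by exists (a *: x + x'); rewrite ?linearP // fx fx'.
have [v vP] := injI _ _ _ w (@sub_incl_inj _ _ T).
exists v => x; have [t tE] := @sub_incl_onto _ _ T (f x) (ex_intro _ x erefl).
rewrite -tE vP; have [x' fx' ->] := wP t.
apply/eqP; rewrite -subr_eq0 -linearB.
by apply/eqP/fu; rewrite linearB fx' tE subrr.
Qed.

End Lifting.

(** * Free resolutions *)

Section FreeModules.
Variables (R : nzRingType) (X : choiceType).

Definition malg_ext (V : lmodType R) (F : X -> V) (g : {malg R[X]}) : V :=
  \sum_(k <- msupp g) g@_k *: F k.

Lemma malg_extE (V : lmodType R) (F : X -> V) (g : {malg R[X]}) (d : {fset X}) :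
  (msupp g `<=` d)%fset -> malg_ext F g = \sum_(k <- d) g@_k *: F k.
Proof.
move=> le; rewrite [LHS](big_fset_incl _ le) => //= x xd /mcoeff_outdom ->.
by rewrite scale0r.
Qed.

Fact malg_ext_linear (V : lmodType R) (F : X -> V) : linear (malg_ext F).
Proof.
move=> a g h; pose d := (msupp (a *: g + h) `|` (msupp g `|` msupp h))%fset.
rewrite !(@malg_extE _ _ _ d).
- rewrite scaler_sumr -big_split; apply: eq_bigr => k _ /=.
  by rewrite mcoeffD mcoeffZ scalerDl scalerA.
- by rewrite /d fsetUA fsubsetUr.
- by rewrite /d fsetUCA fsubsetUl.
- exact: fsubsetUl.
Qed.
HB.instance Definition _ (V : lmodType R) (F : X -> V) :=
  GRing.isLinear.Build R {malg R[X]} V *:%R (@malg_ext V F)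
    (@malg_ext_linear V F).

Lemma malg_extU (V : lmodType R) (F : X -> V) k : malg_ext F << k >> = F k.
Proof. by rewrite (malg_extE _ msuppU_le) big_seq_fset1 mcoeffUU scale1r. Qed.

Lemma malg_ind (P : {malg R[X]} -> Prop) : P 0 ->
    (forall a g h, P g -> P h -> P (a *: g + h)) -> (forall k, P << k >>) ->
  forall g, P g.
Proof.
move=> P0 PL PU g; rewrite [g]monalgE.
apply: big_ind => // [x y Px Py|k _]; first by rewrite -[x]scale1r; apply: PL.
have -> : << g@_k *g k >> = g@_k *: << k >> + 0 :> {malg R[X]}.
  rewrite addr0; apply/malgP => k'.
  by rewrite mcoeffZ !mcoeffU mulrnAr mulr1.
exact: PL.
Qed.

Lemma malg_linear_eq (V : lmodType R) (f g : {linear {malg R[X]} -> V}) :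
  (forall k, f << k >> = g << k >>) -> f =1 g.
Proof.
move=> fg; apply: malg_ind => [|a x y fx fy|//]; rewrite ?linear0 //.
by rewrite !linearP fx fy.
Qed.

Lemma free_projective : projective_module ({malg R[X]} : lmodType R).
Proof.
move=> M N f u /choice[s sP]; exists (malg_ext (fun k => s (u << k >>))).
have cL : linear (fun x => f (malg_ext (fun k => s (u << k >>)) x)).
  by move=> a x y; rewrite !linearP.
by apply: (@malg_linear_eq _ (mklin cL)) => k /=; rewrite malg_extU.
Qed.

End FreeModules.

Section FreeResolution.
Variable R : nzRingType.

Definition free_cover (M : lmodType R) : lmodType R := {malg R[M]}.
Definition cover_map (M : lmodType R) : {linear free_cover M -> M} :=
  malg_ext (idfun : M -> M).

Section Kernel.
Variables (M N : lmodType R) (f : {linear M -> N}).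
Fact kernel0 : f 0 = 0. Proof. exact: linear0. Qed.
Fact kernelP a x y : f x = 0 -> f y = 0 -> f (a *: x + y) = 0.
Proof. by move=> fx fy; rewrite linearP fx fy scaler0 addr0. Qed.
Definition kernel : submodule M := Submodule kernel0 kernelP.
End Kernel.

Variable M : lmodType R.

(** Each module is covered by the free module on its elements. *)
Fixpoint syzygy (k : nat) : lmodType R :=
  if k is k'.+1 then submod (kernel (@cover_map (syzygy k'))) else M.

Definition free_diff k : {linear free_cover (syzygy k.+1) -> free_cover (syzygy k)} :=
  sub_incl \o @cover_map (syzygy k.+1).

Lemma cover_map_onto (N : lmodType R) (y : N) : exists x, cover_map N x = y.
Proof. by exists << y >>; apply: malg_extU. Qed.

Lemma cover_kernel k (x : free_cover (syzygy k)) :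
  cover_map _ x = 0 <-> exists y, free_diff k y = x.
Proof.
split=> [x0|[y <-]]; last exact: sub_inclP (cover_map (syzygy k.+1) y).
have [z zx] := @sub_incl_onto _ _ (kernel (@cover_map (syzygy k))) x x0.
have [y yz] := @cover_map_onto (syzygy k.+1) z.
by exists y; rewrite -zx -yz.
Qed.

Lemma free_diff_kernel k x : free_diff k x = 0 <-> exists y, free_diff k.+1 y = x.
Proof.
rewrite -cover_kernel; split=> [x0|x0]; last first.
  by rewrite -[free_diff k x]/(sub_incl (cover_map (syzygy k.+1) x)) x0 linear0.
apply: (@sub_incl_inj _ _ (kernel (@cover_map (syzygy k)))).
by rewrite linear0.
Qed.

Definition free_resolution : projective_resolution M :=
  @ProjectiveResolution _ M (fun k => free_cover (syzygy k)) free_diff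
    (@cover_map M) (fun k => @free_projective R (syzygy k)) (@cover_map_onto M)
    (@cover_kernel 0) free_diff_kernel.

End FreeResolution.

(** * Extensions into a module of finite injective dimension *)

Section InjectiveDimension.
Variables (K : fieldType) (A : algType K) (M N : lmodType A).
Variable P : projective_resolution M.

Lemma diff_diff i x : pr_diff P i (pr_diff P i.+1 x) = 0.
Proof. by apply/pr_exactS; exists x. Qed.

Lemma aug_diff x : pr_aug P (pr_diff P 0 x) = 0.
Proof. by apply/pr_exact0; exists x. Qed.

(** A cocycle vanishes on the kernel of the differential, hence factors through
    its image and extends. *)
Lemma cocycle_injective (I : lmodType A) i (f : {linear P i.+1 -> I}) :
    injective_module I -> cocycle f ->
  exists u : {linear P i -> I}, forall x, u (pr_diff P i x) = f x.
Proof.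
move=> injI fP; apply: injective_extend => // x /pr_exactS[y <-]; exact: fP.
Qed.

(** Pushed into the first injective module, [f] has a primitive [u]. The
    differential of [u] is a cocycle one step further in the resolution; a
    primitive of it, lifted along the resolution, corrects [u] so that it takes
    values in [N]. The process ends where the resolution vanishes. *)
Lemma injdim_cocycle d i (f : {linear P i.+1 -> N}) :
  injdim_le N d -> (d <= i)%N -> cocycle f -> coboundary f.
Proof.
case=> I [dl [eta [injI eta_inj exact0 exactS I0]]] di fP.
have dl2 j x : dl j.+1 (dl j x) = 0 by apply/exactS; exists x.
have key : forall m k j (g : {linear P j.+1 -> I k}), (m + k = d.+1)%N ->
    (m <= j.+1)%N -> cocycle g -> (forall x, dl k (g x) = 0) ->
    exists2 u : {linear P j -> I k},
      (forall x, dl k (u x) = 0) & (forall x, u (pr_diff P j x) = g x).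
  (* [m] counts the steps left before the resolution vanishes. *)
  elim=> [|m IH] k j g mk mj gP dg.
    have Ik0 (x : I k) : x = 0 by apply: I0; rewrite -mk.
    have zL : linear (fun _ : P j => 0 : I k) by move=> a x y; rewrite scaler0 addr0.
    by by exists (mklin zL) => x; [exact: linear0|exact: esym (Ik0 _)].
  have [u uP] := cocycle_injective (injI k) gP.
  case: j mj g gP dg u uP => [|j] mj g gP dg u uP.
    exists u => // x; have : (d < k.+1)%N by rewrite -mk ltnS -[X in (_ <= X)%N]add0n leq_add2r; case: (m) mj.
    by move/I0; apply.
  have dul : linear (fun x => dl k (u x)) by move=> a x y; rewrite !linearP.
  have [||||v dv vP] := IH k.+1 j (mklin dul).
  - by rewrite addnS.
  - exact: mj.
  - by move=> x /=; rewrite uP.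
  - by move=> x /=; apply: dl2.
  have [x|w wP] := projective_lift (S := full_submodule (I k)) (f := dl k)
      (u := v) (@pr_projective _ _ P j).
    by have /exactS[y <-] := dv x; exists y.
  have uwL : linear (fun x => u x - w (pr_diff P j x)).
    by move=> a x y; rewrite !linearP scalerDr addrACA.
  exists (mklin uwL) => x /=.
    by rewrite linearB (wP _).2 vP subrr.
  by rewrite diff_diff linear0 subr0 uP.
have efL : linear (fun x => eta (f x)) by move=> a x y; rewrite !linearP.
have [||||u du uP] := key d.+1 0%N i (mklin efL).
- by rewrite addn0.
- by [].
- by move=> x /=; rewrite fP linear0.
- by move=> x /=; apply/exact0; exists (f x).
have [x|x y z <- /eta_inj //|a x y v w ev ew|w wP] := @linear_choice _ _ _ (fun x y => eta y = u x).
- exact/exact0.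
- by rewrite !linearP ev ew.
by exists w => x; apply: eta_inj; rewrite wP uP.
Qed.

End InjectiveDimension.

(** * Injective resolutions from commuting operators *)

Lemma injective_prod (R : nzRingType) (I J : lmodType R) :
  injective_module I -> injective_module J -> injective_module (I * J)%type.
Proof.
move=> injI injJ M N f u fI.
have u1L : linear (fun x => (u x).1) by move=> a x y; rewrite linearP.
have u2L : linear (fun x => (u x).2) by move=> a x y; rewrite linearP.
have [v vP] := injI _ _ f (mklin u1L) fI.
have [w wP] := injJ _ _ f (mklin u2L) fI.
have vwL : linear (fun x => (v x, w x)).
  by move=> a x y; rewrite !linearP.
exists (mklin vwL) => x.
by rewrite /= vP wP /=; case: (u x).
Qed.

Section Operators.
Variables (R : nzRingType) (N : lmodType R) (theta : nat -> {linear N -> N}).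

Definition common_kernel k (x : N) := forall l, (l < k)%N -> theta l x = 0.

(** Complexes with operators lifting the [theta l]. *)
Record opcomplex := OpComplex {
  oc_obj : nat -> lmodType R;
  oc_diff : forall i, {linear oc_obj i -> oc_obj i.+1};
  oc_op : nat -> forall i, {linear oc_obj i -> oc_obj i};
  oc_base : {linear N -> oc_obj 0%N} }.

Section Cone.
Variables (k : nat) (X : opcomplex).

(** The mapping cone of the [k]-th operator, shifted so that its cohomology
    starts with the kernel of that operator. *)
Definition cone_obj i : lmodType R :=
  if i is i'.+1 then (oc_obj X i'.+1 * oc_obj X i')%type else oc_obj X 0.

Definition cone_diff_fun i : cone_obj i -> cone_obj i.+1 :=
  match i with
  | 0 => fun x => (oc_diff X 0 x, oc_op X k 0 x)
  | i'.+1 => fun z =>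
      (oc_diff X i'.+1 z.1, oc_op X k i'.+1 z.1 - oc_diff X i' z.2)
  end.

Fact cone_diff_linear i : linear (@cone_diff_fun i).
Proof.
case: i => [|i] a x y /=; rewrite !linearP //=.
by congr (_, _); rewrite /= scalerDr addrACA.
Qed.

Definition cone_op_fun l i : cone_obj i -> cone_obj i :=
  match i with
  | 0 => oc_op X l 0
  | i'.+1 => fun z => (oc_op X l i'.+1 z.1, oc_op X l i' z.2)
  end.

Fact cone_op_linear l i : linear (@cone_op_fun l i).
Proof. by case: i => [|i] a x y /=; rewrite !linearP. Qed.

Definition cone : opcomplex :=
  @OpComplex cone_obj (fun i => mklin (@cone_diff_linear i))
    (fun l i => mklin (@cone_op_linear l i)) (oc_base X).

End Cone.

(** [X] is an injective resolution of the common kernel of the first [k]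
    operators, to which all operators lift and which vanishes beyond [k]. *)
Record resolves_kernel (k : nat) (X : opcomplex) : Prop := ResolvesKernel {
  rk_inj : forall i, injective_module (oc_obj X i);
  rk_base_inj : injective (oc_base X);
  rk_exact0 : forall x, oc_diff X 0 x = 0 <->
    exists2 y, oc_base X y = x & common_kernel k y;
  rk_exactS : forall i x, oc_diff X i.+1 x = 0 <-> exists y, oc_diff X i y = x;
  rk_zero : forall i, (k < i)%N -> forall x : oc_obj X i, x = 0;
  rk_base : forall l y, oc_base X (theta l y) = oc_op X l 0 (oc_base X y);
  rk_opC : forall l m i x, oc_op X l i (oc_op X m i x) = oc_op X m i (oc_op X l i x);
  rk_chain : forall l i x, oc_op X l i.+1 (oc_diff X i x) = oc_diff X i (oc_op X l i x) }.

Hypothesis thetaC : forall k l x, theta k (theta l x) = theta l (theta k x).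

(** The operator [theta k] maps the common kernel of the previous ones onto
    itself, so that the cone has no cohomology but the kernel of [theta k]. *)
Lemma cone_resolves k X : 
    (forall x, common_kernel k x -> exists2 y, common_kernel k y & theta k y = x) ->
  resolves_kernel k X -> resolves_kernel k.+1 (cone k X).
Proof.
move=> onto rX.
have dd i x : oc_diff X i.+1 (oc_diff X i x) = 0 by apply/(rk_exactS rX); exists x.
split.
- by case=> [|i]; [|apply: injective_prod]; apply: (rk_inj rX).
- exact: (rk_base_inj rX).
- move=> x; split.
    case=> /(rk_exact0 rX)[y <- ky] ty; exists y => // l; rewrite ltnS leq_eqVlt.
    case/orP=> [/eqP->|/ky //]; apply: (rk_base_inj rX).
    by rewrite (rk_base rX) ty linear0.
  case=> y <- ky; congr (_, _).
    by apply/(rk_exact0 rX); exists y => // l lk; apply: ky; apply: ltnW.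
  by rewrite -[LHS](rk_base rX) ky // linear0.
- case=> [|i] [x y]; split.
  + case=> /(rk_exactS rX)[x0 x0x] /eqP; rewrite /= subr_eq0 => /eqP ty.
    have /(rk_exact0 rX)[z zE kz] : oc_diff X 0 (y - oc_op X k 0 x0) = 0.
      by rewrite linearB -ty -x0x (rk_chain rX) subrr.
    have [w kw tw] := onto z kz.
    exists (x0 + oc_base X w).
    have w0 : oc_diff X 0 (oc_base X w) = 0 by apply/(rk_exact0 rX); exists w.
    congr (_, _); rewrite linearD.
      by rewrite x0x w0 addr0.
    by rewrite -(rk_base rX) tw zE addrC subrK.
  + case=> z [<- <-]; congr (_, _); first exact: dd.
    by rewrite /= (rk_chain rX) subrr.
  + case=> /(rk_exactS rX)[x0 x0x] /eqP; rewrite /= subr_eq0 => /eqP ty.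
    have /(rk_exactS rX)[z zE] : oc_diff X i.+1 (oc_op X k i.+1 x0 - y) = 0.
      by rewrite linearB -(rk_chain rX) x0x ty subrr.
    exists (x0, z); congr (_, _) => //=.
    by rewrite zE opprB addrC subrK.
  + case=> [[z w]] [<- <-]; congr (_, _); first exact: dd.
    by rewrite /= (rk_chain rX) linearB dd subr0 subrr.
- case=> [|i] // ki [x y]; congr (_, _); apply: (rk_zero rX) => //.
  exact: ltnW.
- exact: (rk_base rX).
- move=> l m [|i] x; first exact: (rk_opC rX).
  by congr (_, _); apply: (rk_opC rX).
- move=> l [|i] x; congr (_, _); rewrite /= ?(rk_chain rX) //.
    by rewrite (rk_opC rX).
  by rewrite linearB (rk_opC rX) (rk_chain rX).
Qed.

Definition base_obj i : lmodType R := if i is 0 then N else 'rV[R]_0.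

Definition base_complex : opcomplex :=
  @OpComplex base_obj (fun i => \0) (fun l i =>
    match i return {linear base_obj i -> base_obj i} with
    | 0 => theta l
    | _ => \0
    end) idfun.

Lemma base_resolves : injective_module N -> resolves_kernel 0 base_complex.
Proof.
move=> injN; have z0 (x : 'rV[R]_0) : x = 0 by apply: thinmx0.
split=> //=.
- by case=> [|i] // M P f u fI; exists \0 => x; rewrite [RHS]z0.
- by move=> x; split=> // _; exists x.
- by move=> i x; split=> // _; exists 0; rewrite [RHS]z0.
- by case.
- by move=> l m [|i] x //=.
Qed.

(** The resolution is the cone of [theta 0], ..., [theta d.-1] in turn, starting
    from [N] alone. *)
Theorem injdim_common_kernel d (M : lmodType R) (eta : {linear M -> N}) :
    injective_module N ->
    (forall k x, (k < d)%N -> common_kernel k x ->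
      exists2 y, common_kernel k y & theta k y = x) ->
    injective eta -> (forall x, common_kernel d x <-> exists m, eta m = x) ->
  injdim_le M d.
Proof.
move=> injN onto eta_inj etaP.
have [X rX] : exists X, resolves_kernel d X.
  elim: {-2}d (leqnn d) => [|k IH] kd.
    by exists base_complex; apply: base_resolves.
  have [X rX] := IH (ltnW kd).
  by exists (cone k X); apply: cone_resolves => // x; apply: onto.
exists (oc_obj X), (oc_diff X), (oc_base X \o eta); split.
- exact: (rk_inj rX).
- by move=> x y /(rk_base_inj rX)/eta_inj.
- move=> x; split=> [/(rk_exact0 rX)[y <- /etaP[m <-]]|[m <-]]; first by exists m.
  by apply/(rk_exact0 rX); exists (eta m) => //; apply/etaP; exists m.
- exact: (rk_exactS rX).
- exact: (rk_zero rX).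
Qed.

End Operators.

(** * Extensions into a common kernel *)

Section ExtCommonKernel.
Variables (K : fieldType) (A : algType K) (M N : lmodType A).
Variable P : projective_resolution M.
Variables (theta : nat -> {linear N -> N}) (d : nat).
Hypothesis injN : injective_module N.
Hypothesis thetaC : forall k l x, theta k (theta l x) = theta l (theta k x).
Hypothesis theta_onto : forall k x, (k < d)%N -> common_kernel theta k x ->
  exists2 y, common_kernel theta k y & theta k y = x.

Notation kerv k f := (forall x, common_kernel theta k (f x)).

(** The coboundaries of the complex of maps from [P] to the common kernel of the
    first [k] operators; the cocycles are those of [N] with values in it. *)
Definition kcoboundary k i : (P i -> N) -> Prop :=
  match i with
  | 0 => fun f => forall x, f x = 0
  | i'.+1 => fun f => exists u : {linear P i' -> N},
      kerv k u /\ forall x, u (pr_diff P i' x) = f x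
  end.

Lemma kcoboundary_ext k i (f g : P i -> N) :
  f =1 g -> kcoboundary k f -> kcoboundary k g.
Proof.
case: i f g => [|i] f g fg /=; first by move=> f0 x; rewrite -fg.
by case=> u [ku uf]; exists u; split=> // x; rewrite uf.
Qed.

Lemma kcoboundary0 k i (f : P i -> N) : (forall x, f x = 0) -> kcoboundary k f.
Proof.
case: i f => // i f f0; exists \0; split=> [x l _|x]; first exact: linear0.
by rewrite f0.
Qed.

Fact common_kernel0 k : common_kernel theta k 0.
Proof. by move=> l _; rewrite linear0. Qed.
Fact common_kernelP k a x y : common_kernel theta k x ->
  common_kernel theta k y -> common_kernel theta k (a *: x + y).
Proof. by move=> kx ky l lk; rewrite linearP kx ?ky // scaler0 addr0. Qed.
Definition common_submodule k : submodule N :=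
  Submodule (@common_kernel0 k) (@common_kernelP k).

Lemma common_kernelW k x : common_kernel theta k.+1 x -> common_kernel theta k x.
Proof. by move=> kx l /ltnW lk; apply: kx. Qed.

Lemma common_kernelS k x :
  common_kernel theta k x -> theta k x = 0 -> common_kernel theta k.+1 x.
Proof.
by move=> kx tx l; rewrite ltnS leq_eqVlt => /orP[/eqP->|/kx].
Qed.

Lemma common_kernel_theta k l x :
  common_kernel theta k x -> common_kernel theta k (theta l x).
Proof. by move=> kx m mk; rewrite thetaC kx ?linear0. Qed.

Lemma lift_theta k i (w : {linear P i -> N}) : (k < d)%N -> kerv k w ->
  exists2 v : {linear P i -> N}, kerv k v & forall x, theta k (v x) = w x.
Proof.
move=> kd kw; have [x|v vP] := projective_lift (S := common_submodule k)
    (f := theta k) (u := w) (@pr_projective _ _ P i); first exact: theta_onto.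
by exists v => x; have [] := vP x.
Qed.

(** If [theta k] of [u] is the coboundary of [w], lift [w] to [v] along
    [theta k]; subtracting the coboundary of [v] from [u] makes [theta k]
    vanish on it and preserves the coboundary of [u]. *)
Lemma correct_primitive k i (u : {linear P i -> N}) : (k < d)%N -> kerv k u ->
    kcoboundary k (fun x => theta k (u x)) ->
  exists2 v : {linear P i -> N}, kerv k.+1 v &
    forall x, v (pr_diff P i x) = u (pr_diff P i x).
Proof.
case: i u => [|i] u kd ku /=.
  by move=> tu; exists u => // x; apply: common_kernelS.
case=> w [kw wP]; have [v kv vP] := lift_theta kd kw.
have uvL : linear (fun x => u x - v (pr_diff P i x)).
  by move=> a x y; rewrite !linearP scalerDr addrACA.
exists (mklin uvL) => x /=; last by rewrite diff_diff linear0 subr0.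
apply: common_kernelS; last by rewrite linearB vP wP subrr.
by move=> l lk; rewrite linearB ku // kv // subrr.
Qed.

Section Classes.
Variables (C : lmodType K) (Y : nat -> {linear C -> C}).
Variable cl0 : {linear P 0%N -> N} -> C -> Prop.

(** [ext_class f c] says that [c] in [C / (Y_0, ..., Y_(k-1))] is the class in
    [Ext^k] of the cocycle [f], with values in the common kernel of the first
    [k] operators. Degrees drop along the connecting maps: [theta k'] of a
    primitive of [f] is a cocycle in the previous degree. It is a relation
    because the class depends on choices. *)
Fixpoint ext_class k : {linear P k -> N} -> C -> Prop :=
  match k with
  | 0 => cl0
  | k'.+1 => fun f c => exists u : {linear P k' -> N},
      [/\ kerv k' u, forall x, u (pr_diff P k' x) = f x
        & ext_class (theta k' \o u) c]
  end.

(** Membership in [Y_0 C + ... + Y_(k-1) C]. *)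
Fixpoint in_ideal k (c : C) : Prop :=
  if k is k'.+1 then exists c', in_ideal k' (c - Y k' c') else c = 0.

Hypothesis cl0_ext : forall (f g : {linear P 0%N -> N}) c, f =1 g -> cl0 f c -> cl0 g c.
Hypothesis cl0_linear : forall a (f g h : {linear P 0%N -> N}) c c', cl0 f c -> cl0 g c' ->
  (forall x, h x = a%:A *: f x + g x) -> cl0 h (a *: c + c').
Hypothesis cl0_total : forall f : {linear P 0%N -> N}, cocycle f -> exists c, cl0 f c.
Hypothesis cl0_inj : forall (f : {linear P 0%N -> N}) c, cocycle f -> cl0 f c ->
  (c = 0 <-> forall x, f x = 0).
Hypothesis cl0_onto : forall c, exists2 f : {linear P 0%N -> N}, cocycle f & cl0 f c.
Hypothesis cl0_theta : forall (f : {linear P 0%N -> N}) c l, (l < d)%N -> cocycle f -> cl0 f c ->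
  cl0 (theta l \o f) (- Y l c).
Hypothesis Y_regular : forall k c, (k < d)%N -> in_ideal k (Y k c) -> in_ideal k c.

Lemma in_ideal_linear k a c c' : in_ideal k c -> in_ideal k c' ->
  in_ideal k (a *: c + c').
Proof.
elim: k c c' => [|k IH] c c' /=; first by move=> -> ->; rewrite scaler0 addr0.
move=> [u uc] [v vc]; exists (a *: u + v).
by rewrite linearP opprD addrACA -scalerBr; apply: IH.
Qed.

Lemma in_ideal0 k : in_ideal k 0.
Proof. by elim: k => [|k IH] //=; exists 0; rewrite linear0 subr0. Qed.

Lemma in_idealN k c : in_ideal k (- c) -> in_ideal k c.
Proof.
move=> kc; rewrite -[c]opprK -scaleN1r -[X in in_ideal k X]addr0.
exact: in_ideal_linear kc (in_ideal0 k).
Qed.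

Lemma ext_class_ext k (f g : {linear P k -> N}) c :
  f =1 g -> ext_class f c -> ext_class g c.
Proof.
case: k f g => [|k] f g fg /=; first exact: cl0_ext.
by case=> u [ku uf cu]; exists u; split=> // x; rewrite uf.
Qed.

Lemma ext_class_linear k a (f g h : {linear P k -> N}) c c' :
    ext_class f c -> ext_class g c' ->
    (forall x, h x = a%:A *: f x + g x) -> ext_class h (a *: c + c').
Proof.
elim: k f g h c c' => [|k IH] f g h c c' /=; first exact: cl0_linear.
move=> [u [ku uf cu]] [v [kv vg cv]] hE.
have uvL : linear (fun x => a%:A *: u x + v x).
  move=> b x y; rewrite !linearP !scalerDr !scalerA.
  have -> : a%:A * b = b * a%:A :> A by rewrite mulr_algl mulr_algr.
  by rewrite addrACA.
exists (mklin uvL); split.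
- by move=> x; apply: common_kernelP.
- by move=> x; rewrite /= uf vg hE.
- by apply: IH cu cv _ => x /=; rewrite linearP.
Qed.

(** The computation of [Ext^i] into the common kernel of the first [k] operators:
    it is [C / (Y_0, ..., Y_(k-1))] for [i = k] and zero otherwise, and
    [theta l] induces [- Y l] on it. *)
Record class_facts k : Prop := ClassFacts {
  cf_total : forall f : {linear P k -> N}, cocycle f -> kerv k f ->
    exists c, ext_class f c;
  cf_kernel : forall (f : {linear P k -> N}) c, cocycle f -> kerv k f ->
    ext_class f c ->
    (in_ideal k c <-> kcoboundary k f);
  cf_onto : forall c, exists f : {linear P k -> N},
    [/\ cocycle f, kerv k f & ext_class f c];
  cf_theta : forall (f : {linear P k -> N}) c l, (l < d)%N -> cocycle f ->
    kerv k f -> ext_class f c -> ext_class (theta l \o f) (- Y l c);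
  cf_vanish : forall i (f : {linear P i -> N}), i != k -> cocycle f ->
    kerv k f -> kcoboundary k f }.

Lemma class_facts0 : class_facts 0.
Proof.
split=> //.
- by move=> f /cl0_total.
- by move=> f c fP _ /cl0_inj; apply.
- by move=> c; have [f fP fc] := cl0_onto c; exists f.
- by move=> f c l ld fP _; apply: cl0_theta.
- move=> [|i] // f _ fP _; have [u uP] := cocycle_injective injN fP.
  by exists u.
Qed.

Lemma cocycle_theta k i (u : {linear P i -> N}) :
    (forall x, common_kernel theta k.+1 (u (pr_diff P i x))) ->
  cocycle (theta k \o u).
Proof. by move=> ku x; apply: ku. Qed.

Lemma class_unique k (f : {linear P k -> N}) c c' : class_facts k -> cocycle f -> kerv k f ->
  ext_class f c -> ext_class f c' -> in_ideal k (c' - c).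
Proof.
move=> F fP kf fc fc'; rewrite addrC -scaleN1r.
have z : ext_class (\0 : {linear P k -> N}) (-1 *: c + c').
  by apply: ext_class_linear fc fc' _ => x; rewrite scaleN1r scaleNr scale1r addNr.
apply/(cf_kernel F _ _ z); last exact: kcoboundary0.
  by [].
by move=> x l _; rewrite linear0.
Qed.

(** The long exact sequence of the surjection [theta k] between the common
    kernels of the first [k] operators, with kernel that of the first [k + 1].
    On [Ext^k] this surjection induces [- Y k], which is injective modulo the
    previous ones; its cokernel is the new [Ext^(k+1)]. *)
Lemma class_factsS k : (k < d)%N -> class_facts k -> class_facts k.+1.
Proof.
move=> kd F.
have kW i (f : {linear P i -> N}) : kerv k.+1 f -> kerv k f.
  by move=> kf x; apply: common_kernelW.
have theta0 i (f : {linear P i -> N}) x : kerv k.+1 f -> theta k (f x) = 0.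
  by move=> kf; apply: kf.
have kT i (u : {linear P i -> N}) : kerv k u -> kerv k (theta k \o u).
  by move=> ku x; apply: common_kernel_theta.
have primitive (f : {linear P k.+1 -> N}) : cocycle f -> kerv k.+1 f -> exists u : {linear P k -> N},
    kerv k u /\ forall x, u (pr_diff P k x) = f x.
  by move=> fP kf; apply: (cf_vanish F _ fP (kW _ _ kf)); rewrite gtn_eqF.
split.
- move=> f fP kf; have [u [ku uf]] := primitive f fP kf.
  have tuP : cocycle (theta k \o u) by apply: cocycle_theta => x; rewrite uf.
  by have [c tc] := cf_total F tuP (kT _ _ ku); exists c, u.
- move=> f c fP kf [u [ku uf uc]] /=.
  have tuP : cocycle (theta k \o u) by apply: cocycle_theta => x; rewrite uf.
  split=> [[c' kc]|[v [kv vf]]].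
    have [w [wP kw wc]] := cf_onto F c'.
    have tw := cf_theta F kd wP kw wc.
    have uwL : linear (fun x => u x + w x).
      by move=> a x y; rewrite !linearP scalerDr addrACA.
    have kuw : kerv k (mklin uwL).
      by move=> x; rewrite /= -[u x]scale1r; apply: common_kernelP.
    have cuw : ext_class (theta k \o mklin uwL) (c - Y k c').
      rewrite -[c]scale1r; apply: ext_class_linear uc tw _ => x.
      by rewrite /= linearD !scale1r.
    have tuwP : cocycle (theta k \o mklin uwL).
      by apply: cocycle_theta => x; rewrite /= uf wP addr0.
    have [v kv vE] := correct_primitive kd kuw
      ((cf_kernel F tuwP (kT _ _ kuw) cuw).1 kc).
    by exists v; split=> // x; rewrite vE /= uf wP addr0.
  have uvL : linear (fun x => u x - v x).
    by move=> a x y; rewrite !linearP scalerDr addrACA.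
  have kuv : kerv k (mklin uvL).
    by move=> x l lk; rewrite /= linearB ku // (kv x l (ltnW lk)) subrr.
  have uvP : cocycle (mklin uvL) by move=> x; rewrite /= uf vf subrr.
  have [c' cc'] := cf_total F uvP kuv.
  have := cf_theta F kd uvP kuv cc'.
  have tuvE : theta k \o mklin uvL =1 theta k \o u.
    by move=> x; rewrite /= linearB (theta0 _ v) // subr0.
  move=> /(ext_class_ext tuvE) cu; exists (- c').
  apply: in_idealN; rewrite linearN opprK opprD addrC.
  exact: class_unique F tuP (kT _ _ ku) uc cu.
- move=> c; have [e [eP ke ec]] := cf_onto F c.
  have [u ku tu] := lift_theta kd ke.
  have fL : linear (fun x => u (pr_diff P k x)) by move=> a x y; rewrite !linearP.
  exists (mklin fL); split.
  + by move=> x /=; rewrite diff_diff linear0.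
  + by move=> x; apply: common_kernelS => //=; rewrite tu eP.
  + by exists u; split=> //; apply: ext_class_ext ec => x /=; rewrite tu.
- move=> f c l ld fP kf [u [ku uf uc]]; exists (theta l \o u); split.
  + by move=> x; apply: common_kernel_theta.
  + by move=> x /=; rewrite uf.
  + have tuP : cocycle (theta k \o u) by apply: cocycle_theta => x; rewrite uf.
    by apply: ext_class_ext (cf_theta F ld tuP (kT _ _ ku) uc) => x /=.
move=> i f ik fP kf.
have kcob : kcoboundary k f.
  have [ik'|] := eqVneq i k; last by move=> ik'; apply: (cf_vanish F) (kW _ _ kf).
  move: f fP kf; rewrite {ik}ik' => f fP kf.
  have kf' := kW _ _ kf.
  have [c fc] := cf_total F fP kf'.
  have tfP : cocycle (theta k \o f) by move=> x; rewrite /= fP linear0.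
  have tf0 : kcoboundary k (theta k \o f).
    by apply: kcoboundary0 => x; rewrite /= theta0.
  have := (cf_kernel F tfP (kT _ _ kf') (cf_theta F kd fP kf' fc)).2 tf0.
  by move=> /in_idealN /(Y_regular kd) /(cf_kernel F fP kf' fc).
case: i ik f fP kf kcob => [|i] ik f fP kf //= [u [ku uf]].
have tuP : cocycle (theta k \o u) by apply: cocycle_theta => x; rewrite uf.
have [v kv vE] := correct_primitive kd ku (cf_vanish F ik tuP (kT _ _ ku)).
by exists v; split=> // x; rewrite vE uf.
Qed.

Lemma class_factsP : class_facts d.
Proof.
elim: {-2}d (leqnn d) => [|k IH] kd; first exact: class_facts0.
by apply: class_factsS => //; apply: IH; apply: ltnW.
Qed.

(** Transport to a module isomorphic to the common kernel of all operators. *)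
Section Submodule.
Variables (S : lmodType A) (eta : {linear S -> N}).
Hypothesis eta_inj : injective eta.
Hypothesis etaP : forall x, common_kernel theta d x <-> exists s, eta s = x.

Lemma eta_kernel i (f : {linear P i -> S}) : kerv d (eta \o f).
Proof. by move=> x; apply/etaP; exists (f x). Qed.

Lemma eta_factor i (f : {linear P i -> N}) : kerv d f ->
  exists g : {linear P i -> S}, forall x, eta (g x) = f x.
Proof.
move=> kf; apply: (@linear_choice _ _ _ (fun x y => eta y = f x)) => [x|x y z <- /eta_inj //|a x y u v uE vE].
  exact/etaP.
by rewrite !linearP uE vE.
Qed.

Lemma eta_coboundary i (f : P i -> S) :
  kcoboundary d (fun x => eta (f x)) <-> coboundary f.
Proof.
case: i f => [|i] f /=.
  split=> f0 x; last by rewrite f0 linear0.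
  by apply: eta_inj; rewrite f0 linear0.
split=> [[u [ku uf]]|[u uf]].
  have [v vu] := eta_factor ku.
  by exists v => x; apply: eta_inj; rewrite vu uf.
by exists (eta \o u); split=> [|x]; [apply: eta_kernel|rewrite /= uf].
Qed.

Lemma ext_dim_vanish i : i != d -> ext_dim M S i 0.
Proof.
move=> id; exists P, (fun _ => \0); split=> [[]//|f fP].
exists 0; split=> [|c _]; last by apply/rowP=> -[].
apply/eta_coboundary.
apply: (@kcoboundary_ext d i (eta \o f)) => [x|].
  by rewrite /= big_ord0 subr0.
apply: (cf_vanish class_factsP) => //; last exact: eta_kernel.
by move=> x; rewrite /= fP linear0.
Qed.

Lemma ext_dim_top (rho : {linear C -> K^o}) c1 :
    rho c1 = 1 -> (forall c, rho c = 0 <-> in_ideal d c) ->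
  ext_dim M S d 1.
Proof.
move=> rho1 rhoP; have F := class_factsP.
have [e [eP ke ec]] := cf_onto F c1; have [b bE] := eta_factor ke.
have bP : cocycle b by move=> x; apply: eta_inj; rewrite bE eP linear0.
exists P, (fun _ => b); split=> // f fP.
have efP : cocycle (eta \o f) by move=> x; rewrite /= fP linear0.
have [c fc] := cf_total F efP (eta_kernel f).
have diffP (x : K) : coboundary (fun z => f z - x%:A *: b z) <-> rho c = x.
  rewrite -eta_coboundary.
  have gL : linear (fun z => eta (f z) - x%:A *: e z).
    move=> a u v; rewrite !linearP /= !scalerDr !scalerA.
    have -> : x%:A * a = a * x%:A :> A by rewrite mulr_algl mulr_algr.
    by rewrite opprD addrACA -?scalerN -scalerA.
  have gc : ext_class (mklin gL) (c - x *: c1).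
    rewrite addrC -scaleNr; apply: ext_class_linear ec fc _ => z /=.
    by rewrite !scaleNr addrC.
  have gP : cocycle (mklin gL) by move=> z; rewrite /= fP eP linear0 scaler0 subr0.
  have kg : kerv d (mklin gL).
    move=> z; rewrite /= addrC -scaleNr; apply: common_kernelP => //.
    exact: eta_kernel.
  have gE : mklin gL =1 fun z => eta (f z - x%:A *: b z).
    by move=> z; rewrite [RHS]linearB [in RHS]linearZ_LR bE.
  transitivity (in_ideal d (c - x *: c1)).
    rewrite (cf_kernel F gP kg gc).
    by split; apply: kcoboundary_ext => // z; rewrite gE.
  rewrite -rhoP linearB linearZ_LR rho1 (mulr1 x : x *: (1 : K^o) = x).
  by split=> [/eqP|->]; rewrite ?subrr // subr_eq0 => /eqP.
exists (const_mx (rho c)); split=> [|x].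
  move/diffP: (erefl (rho c)).
  by congr coboundary; apply/funext => z; rewrite big_ord1 mxE.
move=> cx; apply/rowP=> i; rewrite mxE ord1; apply/diffP.
by move: cx; congr coboundary; apply/funext => z; rewrite big_ord1.
Qed.

End Submodule.
End Classes.
End ExtCommonKernel.

(** * Coinduced modules *)

Section Retraction.
Variables (K : fieldType) (A : algType K) (M N : lmodType A).
Variable f : {linear M -> N}.
Hypothesis f_inj : injective f.

Let free_of_image (W : set N) :=
  (forall (k : K) x y, W x -> W y -> W (k%:A *: x + y)) /\
  (forall m, W (f m) -> m = 0).

Let scalarA (k a : K) (x : N) : k%:A *: (a%:A *: x) = (k * a)%:A *: x.
Proof. by rewrite scalerA mulr_algl scalerA. Qed.

(** Scalars of [K] act through [A]. Zorn's lemma gives a maximal [K]-subspace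
    meeting the image of [f] trivially. *)
Lemma image_complement : exists W : set N,
  free_of_image W /\ forall n, exists m w, W w /\ n = f m + w.
Proof.
have [F FP Ftot|W [[WL Wf] Wmax]] := @Zorn_bigcup _ free_of_image.
  split=> [k x y [X FX Xx] [Z FZ Zy]|m [X FX Xm]]; last exact: (FP _ FX).2.
  have [XZ|ZX] := Ftot _ _ FX FZ.
    by exists Z => //; apply: (FP _ FZ).1 => //; apply: XZ.
  by exists X => //; apply: (FP _ FX).1 => //; apply: ZX.
have W0 : W 0.
  apply: contrapT => nW0; apply: (Wmax [set 0]%classic).
    split=> [x Wx|/(_ _ erefl)//]; exfalso; apply: nW0.
    by have := WL (-1) x x Wx Wx; rewrite scaleN1r scaleN1r addNr.
  split=> [k x y -> ->|m fm0]; first by rewrite scaler0 addr0.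
  by apply: f_inj; rewrite fm0 linear0.
exists W; split=> // n; apply: contrapT => nn.
apply: (Wmax [set z | exists k w, W w /\ z = (k : K)%:A *: n + w]%classic).
  split=> [w Ww|/(_ n)]; first by exists 0, w; rewrite scale0r scale0r add0r.
  move=> Wn; apply: nn; exists 0, n; rewrite linear0 add0r; split=> //.
  by apply: Wn; exists 1, 0; rewrite addr0 scale1r scale1r.
split=> [k x y [a [v [Wv ->]]] [b [w [Ww ->]]]|m [k [w [Ww fm]]]].
  exists (k * a + b), (k%:A *: v + w); split; first exact: WL.
  by rewrite scalerDr scalarA addrACA -scalerDl -scalerDl.
have [k0|k0] := eqVneq k 0.
  by apply: Wf; rewrite fm k0 scale0r scale0r add0r.
case: nn; exists ((k^-1)%:A *: m), ((- k^-1)%:A *: w + 0); split; first exact: WL.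
rewrite addr0 linearZ_LR fm scalerDr scalarA mulVf //.
by rewrite scale1r scale1r -addrA !scaleNr subrr addr0.
Qed.

Lemma linear_retraction : exists r : N -> M,
  (forall x, r (f x) = x) /\
  (forall (k : K) x y, r (k%:A *: x + y) = k%:A *: r x + r y).
Proof.
have [W [[WL Wf] Wtot]] := image_complement.
have /choice[r rP] : forall n, exists m, exists2 w, W w & n = f m + w.
  by move=> n; have [m [w [Ww nE]]] := Wtot n; exists m, w.
have uniq m m' w w' : W w -> W w' -> f m + w = f m' + w' -> m = m'.
  move=> Ww Ww' E; apply/eqP; rewrite -subr_eq0; apply/eqP/Wf.
  have := WL (-1) w w' Ww Ww'; congr W; rewrite scaleN1r scaleN1r linearB.
  have -> : f m = f m' + w' - w by rewrite -E addrK.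
  by rewrite [RHS]addrC !addrA addNr add0r addrC.
have W0 : W 0.
  have [w Ww _] := rP 0.
  by have := WL (-1) w w Ww Ww; rewrite scaleN1r scaleN1r addNr.
exists r; split=> [x|k x y].
  have [w Ww E] := rP (f x); apply: (uniq _ _ w 0) => //.
  by rewrite addr0 -E.
have [w Ww E] := rP (k%:A *: x + y).
have [u Wu xE] := rP x; have [v Wv yE] := rP y.
apply: (uniq _ _ w (k%:A *: u + v)) => //; first exact: WL.
by rewrite -E {1}xE {1}yE linearP scalerDr addrACA.
Qed.

End Retraction.

Section Coinduced.
Variables (K : fieldType) (A : augAlg K) (C : lmodType K).

(** The left module [Hom_K(A, C)], with [(b f) a = f (a b)]. *)
Definition coind : Type := {f : A -> C | linear f}.
Definition coind_fun (f : coind) : A -> C := sval f.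
Coercion coind_fun : coind >-> Funclass.

HB.instance Definition _ := gen_eqMixin coind.
HB.instance Definition _ := gen_choiceMixin coind.

Lemma coind_eq (f g : coind) : f =1 g -> f = g.
Proof. by move=> fg; apply: eq_sig_hprop => [x ? ?|]; [exact: Prop_irrelevance|exact/funext]. Qed.

Lemma coindP (f : coind) : linear f.
Proof. exact: (svalP f). Qed.

Lemma coindD (f : coind) x y : f (x + y) = f x + f y.
Proof. by rewrite -[x]scale1r coindP !scale1r. Qed.

Lemma coind0 (f : coind) : f 0 = 0.
Proof. by apply/eqP; rewrite -(inj_eq (addrI (f 0))) -coindD !addr0. Qed.

Lemma coindZ (f : coind) k x : f (k *: x) = k *: f x.
Proof. by rewrite -[k *: x]addr0 coindP coind0 addr0. Qed.

Fact coind_zero_linear : linear (fun _ : A => 0 : C).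
Proof. by move=> k x y; rewrite scaler0 addr0. Qed.
Definition coind_zero : coind := exist _ _ coind_zero_linear.

Fact coind_opp_linear (f : coind) : linear (fun a => - f a).
Proof. by move=> k x y; rewrite coindP opprD scalerN. Qed.
Definition coind_opp f : coind := exist _ _ (coind_opp_linear f).

Fact coind_add_linear (f g : coind) : linear (fun a => f a + g a).
Proof. by move=> k x y; rewrite !coindP scalerDr addrACA. Qed.
Definition coind_add f g : coind := exist _ _ (coind_add_linear f g).

Fact coind_addA : associative coind_add.
Proof. by move=> f g h; apply: coind_eq => a; apply: addrA. Qed.
Fact coind_addC : commutative coind_add.
Proof. by move=> f g; apply: coind_eq => a; apply: addrC. Qed.
Fact coind_add0 : left_id coind_zero coind_add.
Proof. by move=> f; apply: coind_eq => a; apply: add0r. Qed.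
Fact coind_addN : left_inverse coind_zero coind_opp coind_add.
Proof. by move=> f; apply: coind_eq => a; apply: addNr. Qed.
HB.instance Definition _ := GRing.isZmodule.Build coind
  coind_addA coind_addC coind_add0 coind_addN.

Fact coind_scale_linear (b : A) (f : coind) : linear (fun a => f (a * b)).
Proof. by move=> k x y; rewrite mulrDl -scalerAl coindP. Qed.
Definition coind_scale b f : coind := exist _ _ (coind_scale_linear b f).

Fact coind_scaleA a b f : coind_scale a (coind_scale b f) = coind_scale (a * b) f.
Proof. by apply: coind_eq => c; rewrite /= mulrA. Qed.
Fact coind_scale1 : left_id 1 coind_scale.
Proof. by move=> f; apply: coind_eq => c; rewrite /= mulr1. Qed.
Fact coind_scaleDr : right_distributive coind_scale +%R.
Proof. by move=> a f g; apply: coind_eq. Qed.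
Fact coind_scaleDl f : {morph coind_scale^~ f : a b / a + b}.
Proof. by move=> a b; apply: coind_eq => c; rewrite /= mulrDr coindD. Qed.
HB.instance Definition _ := GRing.Zmodule_isLmodule.Build A coind
  coind_scaleA coind_scale1 coind_scaleDr coind_scaleDl.

Lemma coind_scaleE (b : A) (f : coind) a : (b *: f : coind) a = f (a * b).
Proof. by []. Qed.
Lemma coind_addE (f g : coind) a : (f + g : coind) a = f a + g a.
Proof. by []. Qed.

(** Over a field the [K]-linear map [m |-> u m 1] extends to the larger module;
    by adjunction so does [u]. *)
Lemma coind_injective : injective_module coind.
Proof.
move=> M N f u f_inj; have [r [rf rL]] := linear_retraction f_inj.
have r0 : r 0 = 0 by rewrite -(linear0 f) rf.
have rZ (k : K) x : r (k%:A *: x) = k%:A *: r x by rewrite -[k%:A *: x]addr0 rL r0 addr0.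
have vL n : linear (fun a : A => (u (r (a *: n)) : coind) 1).
  move=> k a b; rewrite scalerDl -mulr_algl -scalerA rL linearP coind_addE.
  by rewrite coind_scaleE mul1r -coindZ.
pose v n : coind := exist _ _ (vL n).
have vlin : linear v.
  move=> b x y; apply: coind_eq => a; rewrite coind_addE coind_scaleE /= .
  have -> : a *: (b *: x + y) = 1%:A *: ((a * b) *: x) + a *: y.
    by rewrite scale1r scale1r scalerDr scalerA.
  by rewrite rL linearP coind_addE !scale1r.
exists (mklin vlin) => m; apply: coind_eq => a.
by rewrite /= -linearZ_LR rf linearZ_LR coind_scaleE mul1r.
Qed.

Section Theta.
Variables (y : nat -> A) (Y : nat -> {linear C -> C}).
Hypothesis yC : forall k l, y k * y l = y l * y k.
Hypothesis YC : forall k l c, Y k (Y l c) = Y l (Y k c).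

(** [theta l] measures how far [f] is from commuting with [y l]: the common
    kernel of all of them consists of the maps linear over the [y l]. *)
Fact theta_fun_linear l (f : coind) : linear (fun a => f (y l * a) - Y l (f a)).
Proof.
move=> k a b; rewrite mulrDr -scalerAr !coindP linearP scalerBr.
by rewrite opprD addrACA.
Qed.
Definition theta_fun l f : coind := exist _ _ (theta_fun_linear l f).

Fact theta_linear l : linear (theta_fun l).
Proof.
move=> b f g; apply: coind_eq => a; rewrite /=.
by rewrite linearD opprD addrACA mulrA.
Qed.
Definition theta l : {linear coind -> coind} := mklin (theta_linear l).

Lemma thetaE l (f : coind) a : (theta l f : coind) a = f (y l * a) - Y l (f a).
Proof. by []. Qed.

Lemma thetaC k l f : theta k (theta l f) = theta l (theta k f).
Proof.
have swap (p q r s : C) : p - q - (r - s) = p - r - (q - s).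
  by rewrite !opprB addrACA [- q - r]addrC -addrACA.
apply: coind_eq => a; rewrite !thetaE [Y k _]linearB [Y l (_ - _)]linearB.
by rewrite swap !mulrA yC YC.
Qed.

Variables (d : nat) (D : nat -> {linear A -> A}).
Hypothesis Dy : forall k a, (k < d)%N -> D k (y k * a) = a.
Hypothesis DC : forall k l a, (k < d)%N -> (l < k)%N -> D k (y l * a) = y l * D k a.
Hypothesis Dnil : forall k a, (k < d)%N -> exists s, iter s (D k) a = 0.

Lemma iter0 k s : iter s (D k) 0 = 0.
Proof. by elim: s => //= s ->; rewrite linear0. Qed.

(** [D k] divides by [y k], forgetting the remainder. The sum
    [g a = sum_s Y_k^s f (D_k^(s+1) a)], finite as [D k] is locally nilpotent,
    satisfies [g (y_k a) = Y_k g a + f a]. *)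
Lemma theta_onto k (f : coind) : (k < d)%N -> common_kernel theta k f ->
  exists2 g, common_kernel theta k g & theta k g = f.
Proof.
move=> kd kf; pose S s a := \sum_(i < s) iter i (Y k) (f (iter i.+1 (D k) a)).
have YiC i l c : Y l (iter i (Y k) c) = iter i (Y k) (Y l c).
  by elim: i => //= i <-; rewrite YC.
have YiL i : linear (iter i (Y k)).
  by move=> b u v; elim: i => //= i ->; rewrite linearP.
have DiL i : linear (iter i (D k)).
  by move=> b u v; elim: i => //= i ->; rewrite linearP.
have Yi0 i : iter i (Y k) 0 = 0 by elim: i => //= i ->; rewrite linear0.
have Sstab s t a : iter s (D k) a = 0 -> (s <= t)%N -> S t a = S s a.
  move=> Da /subnK <-; elim: (t - s)%N => // m IH.
  rewrite addSn; transitivity (S (m + s)%N a + iter (m + s) (Y k)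
    (f (iter (m + s).+1 (D k) a))); first exact: big_ord_recr.
  rewrite IH /=; suff -> : iter (m + s) (D k) a = 0 by rewrite linear0 coind0 Yi0 addr0.
  by rewrite iterD Da iter0.
have /choice[n nP] : forall a, exists s, iter s (D k) a = 0 by move=> a; apply: Dnil.
have SE s a : iter s (D k) a = 0 -> S (n a) a = S s a.
  move=> sa; have [ns|/ltnW sn] := leqP (n a) s; last exact: Sstab.
  by rewrite (Sstab _ _ _ (nP a) ns).
have SL s : linear (S s).
  move=> b u v; rewrite /S scaler_sumr -big_split; apply: eq_bigr => i _ /=.
  by rewrite DiL linearP coindP YiL.
have gL : linear (fun a => S (n a) a).
  move=> b u v; pose m := (n u + n v)%N.
  have um : iter m (D k) u = 0 by rewrite /m addnC iterD nP iter0.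
  have vm : iter m (D k) v = 0 by rewrite /m iterD nP iter0.
  by rewrite !(SE m) ?SL // DiL um vm scaler0 addr0.
exists (exist _ _ gL : coind) => [l lk|]; last first.
  apply: coind_eq => a; rewrite thetaE /=.
  have yn : iter (n a).+1 (D k) (y k * a) = 0 by rewrite iterSr Dy // nP.
  have -> : S (n (y k * a)) (y k * a) = f a + Y k (S (n a) a).
    rewrite (SE _ _ yn) /S big_ord_recl linear_sum /= Dy //; congr (_ + _).
    apply: eq_bigr => i _; congr (Y k (iter _ _ (f _))).
    by rewrite -[LHS]/(iter i.+2 (D k) (y k * a)) iterSr Dy.
  by rewrite addrK.
apply: coind_eq => a; rewrite thetaE /=.
have Dya s : iter s (D k) (y l * a) = y l * iter s (D k) a.
  by elim: s => //= s ->; rewrite DC.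
have yn : iter (n a) (D k) (y l * a) = 0 by rewrite Dya nP mulr0.
apply/eqP; rewrite subr_eq0 (SE _ _ yn) /S linear_sum; apply/eqP.
apply: eq_bigr => i _; rewrite Dya YiC; congr (iter _ _ _).
by have /eqP := congr1 (fun h : coind => h (iter i.+1 (D k) a)) (kf l lk);
   rewrite thetaE subr_eq0 => /eqP.
Qed.

End Theta.
End Coinduced.

(** * The Artin-Schelter condition from a perfect pairing *)

Section PairingAS.
Variables (K : fieldType) (A : augAlg K) (C : lmodType K) (d : nat).
Variables (y : nat -> A) (Y : nat -> {linear C -> C}) (D : nat -> {linear A -> A}).
Variables (lam : {linear A -> C}) (rho : {linear C -> K^o}) (c1 : C).
Hypothesis yC : forall k l, y k * y l = y l * y k.
Hypothesis YC : forall k l c, Y k (Y l c) = Y l (Y k c).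
Hypothesis aug_y : forall l, (l < d)%N -> aug A (y l) = 0.
Hypothesis Dy : forall k a, (k < d)%N -> D k (y k * a) = a.
Hypothesis DC : forall k l a, (k < d)%N -> (l < k)%N -> D k (y l * a) = y l * D k a.
Hypothesis Dnil : forall k a, (k < d)%N -> exists s, iter s (D k) a = 0.
Hypothesis lam_inj : forall b, (forall a, lam (a * b) = 0) -> b = 0.
Hypothesis lamP : forall f : coind A C,
  (forall l a, (l < d)%N -> f (y l * a) = Y l (f a)) <->
  exists b, forall a, f a = lam (a * b).
Hypothesis Y_regular : forall k c, (k < d)%N -> in_ideal Y k (Y k c) -> in_ideal Y k c.
Hypothesis rho1 : rho c1 = 1.
Hypothesis rhoP : forall c, rho c = 0 <-> in_ideal Y d c.

Fact pairing_linear b : linear (fun a => lam (a * b)).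
Proof. by move=> k u v; rewrite mulrDl -scalerAl linearP. Qed.
Definition pairing_fun (b : regular_module A) : coind A C :=
  exist _ _ (pairing_linear b).
Fact pairing_fun_linear : linear pairing_fun.
Proof.
move=> b u v; apply: coind_eq => a; rewrite /= mulrDr linearD.
by rewrite -mulrA.
Qed.
Definition pairing : {linear regular_module A -> coind A C} :=
  mklin pairing_fun_linear.

Lemma pairing_inj : injective pairing.
Proof.
move=> b c bc; apply/eqP; rewrite -subr_eq0; apply/eqP/lam_inj => a.
have := congr1 (fun f : coind A C => f a) bc; rewrite /= => E.
by rewrite mulrBr linearB E subrr.
Qed.

Lemma pairing_image f :
  common_kernel (theta y Y) d f <-> exists b, pairing b = f.
Proof.
transitivity (forall l a, (l < d)%N -> (f : coind A C) (y l * a) = Y l ((f : coind A C) a)).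
  split=> [kf l a ld|fP l ld].
    have := congr1 (fun f : coind A C => f a) (kf l ld).
    by rewrite /= => /eqP; rewrite subr_eq0 => /eqP.
  by apply: coind_eq => a; rewrite thetaE fP // subrr.
rewrite lamP; split=> [[b bP]|[b <-]]; last by exists b.
by exists b; apply: coind_eq => a; rewrite bP.
Qed.

Let aug_scalar (k : K) : aug A k%:A = k.
Proof. by rewrite linearZ rmorph1 /= mulr1. Qed.

Let P := free_resolution (trivial_module A).
Let N : lmodType A := coind A C.

Let x1 : P 0%N := << (1 : trivial_module A) >>.
Let aug_x1 : pr_aug P x1 = 1.
Proof. exact: malg_extU. Qed.

(** A cocycle of degree zero is a map from the trivial module to [Hom_K(A, C)];
    it sends [1] to a map of the form [a |-> aug(a) c]. *)
Definition eval_class (f : {linear P 0%N -> N}) (c : C) :=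
  forall x a, (f x : coind A C) a = (aug A a * (pr_aug P x : K)) *: c.

Lemma eval_class_unit f c : eval_class f c -> (f x1 : coind A C) 1 = c.
Proof. by move=> ->; rewrite aug_x1 rmorph1 mul1r scale1r. Qed.

Lemma eval_class_total (f : {linear P 0%N -> N}) :
  cocycle f -> exists c, eval_class f c.
Proof.
move=> fP; exists ((f x1 : coind A C) 1) => x a.
have f_aug z : pr_aug P z = 0 -> f z = 0 by case/pr_exact0 => z' <-; apply: fP.
have -> : (f x : coind A C) a = (f (a *: x) : coind A C) 1.
  by rewrite linearZ_LR coind_scaleE mul1r.
pose k : K := aug A a * (pr_aug P x : K).
have /f_aug/eqP : pr_aug P (a *: x - k%:A *: x1) = 0.
  have trivE (b : A) (v : trivial_module A) : b *: v = aug A b * (v : K) by [].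
  rewrite linearB 2!linearZ_LR aug_x1 !trivE aug_scalar mulr1.
  exact: subrr.
rewrite linearB subr_eq0 => /eqP ->.
by rewrite linearZ_LR coind_scaleE mul1r coindZ.
Qed.

Lemma eval_class_inj (f : {linear P 0%N -> N}) c : cocycle f -> eval_class f c ->
  (c = 0 <-> forall x, f x = 0).
Proof.
move=> _ fc; split=> [c0 x|f0]; last by rewrite -(eval_class_unit fc) f0.
by apply: coind_eq => a; rewrite fc c0 scaler0.
Qed.

Lemma eval_class_onto c : exists2 f, cocycle f & eval_class f c.
Proof.
have hL x : linear (fun a => (aug A a * (pr_aug P x : K)) *: c).
  by move=> k a b; rewrite linearP mulrDl scalerDl -mulrA scalerA.
pose h x : coind A C := exist _ _ (hL x).
have fL : linear (h : P 0%N -> N).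
  move=> b u v; apply: coind_eq => a; rewrite /= linearP rmorphM.
  by rewrite mulrDr scalerDl mulrA.
exists (mklin fL) => // x; apply: coind_eq => a.
rewrite -[LHS]/((aug A a * (pr_aug P (pr_diff P 0 x) : K)) *: c) aug_diff.
by rewrite mulr0 scale0r.
Qed.

(** The pairing identifies the regular module with the common kernel of the
    operators [theta l]. The injective dimension is not less than [d], as [Ext^d]
    does not vanish. *)
Theorem pairing_left_AS : left_AS_condition A d.
Proof.
have injN : injective_module N by apply: coind_injective.
have tC := thetaC yC YC.
have ton k f := @theta_onto _ _ _ y Y YC d D Dy DC Dnil k f.
have cl_ext (f g : {linear P 0%N -> N}) c : f =1 g -> eval_class f c -> eval_class g c.
  by move=> fg fc x a; rewrite -fg.
have cl_lin a (f g h : {linear P 0%N -> N}) c c' : eval_class f c ->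
    eval_class g c' -> (forall x, h x = a%:A *: f x + g x) ->
    eval_class h (a *: c + c').
  move=> fc gc hE x b; rewrite hE coind_addE coind_scaleE fc gc.
  have -> : aug A (b * a%:A) = aug A b * a.
    by rewrite rmorphM /= aug_scalar.
  by rewrite scalerDr !scalerA; congr (_ *: _ + _); rewrite mulrAC.
have cl_theta (f : {linear P 0%N -> N}) c l : (l < d)%N -> cocycle f ->
    eval_class f c -> eval_class (theta y Y l \o f) (- Y l c).
  move=> ld _ fc x a; transitivity ((f x : coind A C) (y l * a) - Y l ((f x : coind A C) a)).
    by [].
  have yl0 : aug A (y l * a) = 0 by rewrite rmorphM /= aug_y // mul0r.
  by rewrite !fc yl0 mul0r scale0r sub0r linearZ_LR scalerN.
have vanish i : i != d -> ext_dim (trivial_module A) (regular_module A) i 0.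
  exact: (ext_dim_vanish injN tC ton cl_ext cl_lin eval_class_total
    eval_class_inj eval_class_onto cl_theta Y_regular pairing_inj pairing_image).
have top : ext_dim (trivial_module A) (regular_module A) d 1.
  exact: (ext_dim_top injN tC ton cl_ext cl_lin eval_class_total
    eval_class_inj eval_class_onto cl_theta Y_regular pairing_inj pairing_image rho1 rhoP).
split=> //; split; first exact: (injdim_common_kernel tC injN ton pairing_inj pairing_image).
move=> m md idm.
case: d md top => // d' md [Q [b [bP uniq]]].
have b_cob : coboundary (b 0) by apply: injdim_cocycle idm _ _ => //.
have [c [_ cuniq]] := uniq (b 0) (bP 0).
have e0 : c = 0.
  apply: cuniq; move: b_cob; congr coboundary; apply/funext => x.
  by rewrite big_ord1 mxE scale0r scale0r subr0.
have /rowP/(_ 0)/eqP : c = const_mx 1.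
  apply: cuniq; exists \0 => x; rewrite big_ord1 mxE scale1r scale1r subrr.
  by [].
by rewrite e0 !mxE eq_sym oner_eq0.
Qed.

End PairingAS.

(** * Hilbert's basis theorem for spaces with shift operators *)

Section Hilbert.
Variables (K : fieldType) (V : lmodType K) (d : nat).
Variables Y D : nat -> {linear V -> V}.
Hypothesis DY : forall l x, (l < d)%N -> D l (Y l x) = x.
Hypothesis DYC : forall k l x, (k < d)%N -> (l < d)%N -> k != l ->
  D k (Y l x) = Y l (D k x).
Hypothesis DDC : forall k l x, D k (D l x) = D l (D k x).
Hypothesis Dnil : forall l x, (l < d)%N -> exists s, iter s (D l) x = 0.

Definition stable k (L : V -> Prop) := [/\ L 0,
  forall a x y, L x -> L y -> L (a *: x + y)
  & forall l x, (l < k)%N -> L x -> L (Y l x)].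

(** [L] lies in the stable subspace generated by [s], that is in every stable
    subspace containing [s]. *)
Definition generates k (s : seq V) (L : V -> Prop) := forall x, L x ->
  forall W, stable k W -> (forall z, z \in s -> W z) -> W x.

Definition fin_generated k L := exists2 s : seq V,
  (forall z, z \in s -> L z) & generates k s L.

(** No [D l] with [l >= k] acts: polynomials in the first [k] variables. *)
Definition low k (x : V) := forall l, (k <= l < d)%N -> D l x = 0.

Definition noeth k := forall L, stable k L -> (forall x, L x -> low k x) ->
  fin_generated k L.

(** Finite dimension, by elimination of one coordinate at a time. *)
Lemma fin_span_generated (I : Type) (r : seq I) (u : I -> V) (L : V -> Prop) :
    stable 0 L ->
    (forall x, L x -> exists c : I -> K, x = \sum_(i <- r) c i *: u i) ->
  fin_generated 0 L.
Proof.
elim: r L => [|j r IH] L stL Lspan.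
  exists [::] => // x /Lspan[c ->] W [W0 _ _] _; by rewrite big_nil.
have [L0 LL _] := stL.
pose L' x := L x /\ exists c : I -> K, x = \sum_(i <- r) c i *: u i.
have stL' : stable 0 L'.
  split=> [|a x y [Lx [c xE]] [Ly [c' yE]]|//].
    by split=> //; exists (fun _ => 0); rewrite big1 // => i _; rewrite scale0r.
  split; first exact: LL; exists (fun i => a * c i + c' i).
  rewrite xE yE scaler_sumr -big_split; apply: eq_bigr => i _ /=.
  by rewrite scalerDl scalerA.
have [x []//|t tL tG] := IH L' stL'.
have [[w [Lw [c [wE c0]]]]|none] := pselect (exists w, L w /\ exists c : I -> K,
    w = \sum_(i <- j :: r) c i *: u i /\ c j != 0).
  exists (w :: t) => [z|x Lx W [W0 WL Wst] Wt].
    by rewrite inE => /orP[/eqP->|/tL[]].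
  have [c' xE] := Lspan x Lx.
  rewrite -[x](subrK ((c' j / c j) *: w)) addrC.
  apply: (WL); first by apply: Wt; rewrite mem_head.
  apply: (tG _ _ W (And3 W0 WL Wst)) => [|z zt]; last by apply: Wt; rewrite inE zt orbT.
  split; first by rewrite addrC -scaleNr; apply: LL.
  exists (fun i => c' i - (c' j / c j) * c i).
  rewrite xE wE !big_cons scalerDr scalerA divfK // opprD addrACA subrr add0r.
  rewrite scaler_sumr -sumrB; apply: eq_bigr => i _ /=.
  by rewrite scalerA -scalerBl.
exists t => [z /tL[]//|x Lx W stW Wt]; apply: (tG x _ W stW Wt); split=> //.
have [c xE] := Lspan x Lx; exists c.
have [c0|c0] := eqVneq (c j) 0; last by case: none; exists x; split=> //; exists c.
by rewrite xE big_cons c0 scale0r add0r.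
Qed.

Section Step.
Variables (k : nat) (L : V -> Prop).
Hypothesis kd : (k < d)%N.
Hypothesis noeth_k : noeth k.
Hypothesis stL : stable k.+1 L.
Hypothesis lowL : forall x, L x -> low k.+1 x.

Lemma iterD_linear t : linear (iter t (D k)).
Proof. by move=> a x y; elim: t => //= t ->; rewrite linearP. Qed.
Lemma iterD0 t : iter t (D k) 0 = 0.
Proof. by elim: t => //= t ->; rewrite linear0. Qed.
Lemma iterDC t l x : D l (iter t (D k) x) = iter t (D k) (D l x).
Proof. by elim: t => //= t <-; rewrite DDC. Qed.
Lemma iterDYC t l x : (l < k)%N -> iter t (D k) (Y l x) = Y l (iter t (D k) x).
Proof.
by move=> lk; elim: t => //= t ->; rewrite DYC ?(ltn_trans lk) // gtn_eqF.
Qed.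
Lemma iterDY t m x : iter (m + t) (D k) (iter m (Y k) x) = iter t (D k) x.
Proof.
elim: m => // m IH.
by rewrite addSn iterSr /= DY // IH.
Qed.

(** [v] is the coefficient of [Y_k^t] in an element of degree at most [t] in
    the [k]-th variable. *)
Definition leading (W : V -> Prop) t v :=
  exists a, [/\ W a, iter t.+1 (D k) a = 0 & iter t (D k) a = v].

Lemma leading_stable W t : stable k.+1 W -> stable k (leading W t).
Proof.
case=> W0 WL WY; split.
- by exists 0; rewrite !iterD0.
- move=> a x y [x' [Wx dx xE]] [y' [Wy dy yE]]; exists (a *: x' + y').
  by rewrite !iterD_linear dx dy xE yE scaler0 addr0; split=> //; apply: WL.
- move=> l x lk [x' [Wx dx xE]]; exists (Y l x').
  rewrite !iterDYC // dx xE linear0; split=> //; apply: WY => //.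
  exact: ltnW.
Qed.

Lemma leading_shift W t m v : stable k.+1 W -> leading W t v -> leading W (m + t) v.
Proof.
case=> _ _ WY [a [Wa da aE]]; exists (iter m (Y k) a); split.
- by elim: m => //= m IH; apply: WY.
- by rewrite -addnS iterDY.
- by rewrite iterDY.
Qed.

Lemma leading_low t v : leading L t v -> low k v.
Proof.
case=> a [La da <-] l /andP[]; rewrite leq_eqVlt => /orP[/eqP <- _|kl ld].
  exact: da.
by rewrite iterDC (lowL La) ?kl // iterD0.
Qed.

(** Generators of a space of leading coefficients lift to elements of [L] that
    produce all these coefficients, in every larger degree too. *)
Lemma lift_generators t (s : seq V) : (forall z, z \in s -> leading L t z) ->
  exists2 s' : seq V, (forall z, z \in s' -> L z) &
    forall W, stable k.+1 W -> (forall z, z \in s' -> W z) ->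
    forall z, z \in s -> leading W t z.
Proof.
elim: s => [|v s IH] Ls; first by exists [::].
have [z zs|s' s'L s'P] := IH; first by apply: Ls; rewrite inE zs orbT.
have [a [La da av]] := Ls v (mem_head _ _).
exists (a :: s') => [z|W stW Ws z]; first by rewrite inE => /orP[/eqP->|/s'L].
rewrite inE => /orP[/eqP->|zs]; first by exists a; split=> //; apply: Ws; rewrite mem_head.
by apply: s'P zs => // b bs; apply: Ws; rewrite inE bs orbT.
Qed.

(** Finitely many degrees have finitely many generators in all. *)
Lemma low_degrees T : exists2 s : seq V, (forall z, z \in s -> L z) &
  forall W, stable k.+1 W -> (forall z, z \in s -> W z) ->
  forall t v, (t < T)%N -> leading L t v -> leading W t v.
Proof.
elim: T => [|T [s sL sP]]; first by exists [::].
have [r rL rG] := noeth_k (leading_stable T stL) (@leading_low T).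
have [s' s'L s'P] := lift_generators rL.
exists (s' ++ s) => [z|W stW Ws t v]; first by rewrite mem_cat => /orP[/s'L|/sL].
rewrite ltnS leq_eqVlt => /orP[/eqP-> /rG|tT]; last first.
  by apply: sP => // z zs; apply: Ws; rewrite mem_cat zs orbT.
apply; first exact: leading_stable.
by apply: s'P => // z zs; apply: Ws; rewrite mem_cat zs.
Qed.

(** The leading coefficients in all degrees form a stable subspace in fewer
    variables; shifting its generators brings them to a common degree. *)
Lemma high_degrees : exists T, exists2 s : seq V, (forall z, z \in s -> L z) &
  forall W, stable k.+1 W -> (forall z, z \in s -> W z) ->
  forall t v, (T <= t)%N -> leading L t v -> leading W t v.
Proof.
pose M v := exists t, leading L t v.
have stM : stable k M.
  split.
  - by exists 0%N; case: (leading_stable 0 stL).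
  - move=> a x y [t xt] [t' yt]; exists (t' + t)%N.
    case: (leading_stable (t' + t) stL) => _ lin _; apply: lin.
      exact: leading_shift.
    by rewrite addnC; apply: leading_shift.
  - move=> l x lk [t xt]; exists t.
    by case: (leading_stable t stL) => _ _; apply.
have [v [t /leading_low]//|s sM sG] := noeth_k stM.
have [T sT] : exists T, forall z, z \in s -> leading L T z.
  elim: s sM {sG} => [|v s IH] sM; first by exists 0%N.
  have [z zs|T TP] := IH; first by apply: sM; rewrite inE zs orbT.
  have [t vt] := sM v (mem_head _ _); exists (t + T)%N => z.
  rewrite inE => /orP[/eqP->|/TP]; last exact: leading_shift.
  by rewrite addnC; apply: leading_shift.
have [s' s'L s'P] := lift_generators sT.
exists T, s' => // W stW Ws t v Tt vt; apply: (sG v (ex_intro _ t vt)).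
  exact: leading_stable.
by move=> z /(s'P W stW Ws); rewrite -(subnK Tt); apply: leading_shift.
Qed.

(** An element of [L] is reduced by one in degree by subtracting an element of
    the generated subspace with the same leading coefficient. *)
Lemma hilbert_step : fin_generated k.+1 L.
Proof.
have [T [s sL sP]] := high_degrees; have [r rL rP] := low_degrees T.
exists (s ++ r) => [z|x Lx W stW Wsr]; first by rewrite mem_cat => /orP[/sL|/rL].
have stWL : stable k.+1 (fun z => W z /\ L z).
  case: stW stL => W0 WL WY [L0 LL LY]; split=> //.
    by move=> a z z' [? ?] [? ?]; split; auto.
  by move=> l z lk [? ?]; split; auto.
have Wlead t v : leading L t v -> leading (fun z => W z /\ L z) t v.
  have [Tt|tT] := leqP T t.
    apply: sP => // z zs; split; last exact: sL.
    by apply: Wsr; rewrite mem_cat zs.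
  apply: rP => // z zs; split; last exact: rL.
  by apply: Wsr; rewrite mem_cat zs orbT.
have [W0 WL _] := stW; have [L0 LL _] := stL.
have [t tx] := Dnil x kd; elim: t x Lx tx => [|t IH] x Lx tx; first by rewrite [x]tx.
have [|b [[Wb Lb] db bx]] := Wlead t (iter t (D k) x); first by exists x.
rewrite -[x](subrK b) -[x - b]scale1r; apply: WL => //; apply: IH.
  by rewrite addrC -scaleN1r; apply: LL.
by rewrite -[x - b]addrC -scaleN1r iterD_linear bx scaleN1r addNr.
Qed.

End Step.

Theorem hilbert_basis : noeth 0 -> noeth d.
Proof.
move=> n0; elim: {1 3}d (leqnn d) => // k IH kd L stL lowL.
exact: hilbert_step kd (IH (ltnW kd)) stL lowL.
Qed.

End Hilbert.

(** * Polynomials as a space with shift operators *)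

(** A free module on exponents, seen as a space with operators: [ps_var l] is
    multiplication by the [l]-th variable and [ps_div l] is the quotient by it,
    forgetting the remainder. The product of polynomials itself does not occur:
    linearity over the variables is enough. *)
Record polynomial_space (K : fieldType) (d : nat) := PolynomialSpace {
  ps_carrier :> lmodType K;
  ps_one : ps_carrier;
  ps_var : nat -> {linear ps_carrier -> ps_carrier};
  ps_div : nat -> {linear ps_carrier -> ps_carrier};
  ps_const : {linear ps_carrier -> K^o};
  ps_varC : forall k l c, ps_var k (ps_var l c) = ps_var l (ps_var k c);
  ps_varK : forall l c, ps_div l (ps_var l c) = c;
  ps_div_var : forall k l c, k != l -> ps_div k (ps_var l c) = ps_var l (ps_div k c);
  ps_divC : forall k l c, ps_div k (ps_div l c) = ps_div l (ps_div k c);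
  ps_div_nil : forall l c, (l < d)%N -> exists s, iter s (ps_div l) c = 0;
  ps_div_one : forall l, (l < d)%N -> ps_div l ps_one = 0;
  ps_const_one : ps_const ps_one = 1;
  ps_const_var : forall l c, (l < d)%N -> ps_const (ps_var l c) = 0;
  ps_ind : forall P : ps_carrier -> Prop, P 0 ->
    (forall a g h, P g -> P h -> P (a *: g + h)) -> P ps_one ->
    (forall l c, (l < d)%N -> P c -> P (ps_var l c)) -> forall c, P c }.

Section PolynomialSpace.
Variables (K : fieldType) (d : nat) (C : polynomial_space K d).

(** [drop_var l] sets the [l]-th variable to zero. *)
Definition drop_var l (c : C) : C := c - ps_var C l (ps_div C l c).
Fixpoint drop_vars k (c : C) : C :=
  if k is k'.+1 then drop_var k' (drop_vars k' c) else c.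

Lemma drop_varP l a c c' : drop_var l (a *: c + c') = a *: drop_var l c + drop_var l c'.
Proof. by rewrite /drop_var !linearP scalerDr addrACA. Qed.

Lemma drop_vars_linear k : linear (drop_vars k).
Proof. by elim: k => //= k IH a c c'; rewrite IH drop_varP. Qed.

Lemma drop_varsY k l c : (k <= l)%N ->
  drop_vars k (ps_var C l c) = ps_var C l (drop_vars k c).
Proof.
elim: k => //= k IH kl; rewrite IH 1?ltnW // /drop_var.
by rewrite ps_div_var ?ltn_eqF // ps_varC -linearB.
Qed.

Lemma drop_varsD k l c : (k <= l)%N ->
  drop_vars k (ps_div C l c) = ps_div C l (drop_vars k c).
Proof.
elim: k => //= k IH kl; rewrite IH 1?ltnW // /drop_var.
by rewrite ps_divC linearB ps_div_var // gtn_eqF.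
Qed.

Lemma drop_var_killY l c : drop_var l (ps_var C l c) = 0.
Proof. by rewrite /drop_var ps_varK subrr. Qed.

Lemma drop_vars_killY k l c : (l < k)%N -> drop_vars k (ps_var C l c) = 0.
Proof.
elim: k => //= k IH; rewrite ltnS leq_eqVlt => /orP[/eqP->|/IH->].
  by rewrite drop_varsY // drop_var_killY.
by rewrite /drop_var 2!linear0 subr0.
Qed.

Lemma in_ideal_drop k c : in_ideal (ps_var C) k c <-> drop_vars k c = 0.
Proof.
have dB j z w : drop_vars j (z - w) = drop_vars j z - drop_vars j w.
  by rewrite addrC -scaleN1r drop_vars_linear scaleN1r addrC.
elim: k c => //= k IH c; split=> [[c' /IH]|c0].
  rewrite dB drop_varsY // => /eqP; rewrite subr_eq0 => /eqP->.
  exact: drop_var_killY.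
exists (ps_div C k c); apply/IH.
by rewrite dB drop_varsY // drop_varsD.
Qed.

Lemma ps_var_regular k c :
  in_ideal (ps_var C) k (ps_var C k c) -> in_ideal (ps_var C) k c.
Proof.
move/in_ideal_drop; rewrite drop_varsY // => E; apply/in_ideal_drop.
by rewrite -[drop_vars k c](ps_varK k) E linear0.
Qed.

Lemma drop_vars_all c : drop_vars d c = ps_const C c *: ps_one C.
Proof.
elim/ps_ind: c => [|a g h gE hE||l c ld _].
- have := drop_vars_linear d (-1) 0 0.
  by rewrite scaler0 addr0 scaleN1r addNr linear0 scale0r.
- by rewrite drop_vars_linear gE hE linearP scalerDl scalerA.
- suff one k : (k <= d)%N -> drop_vars k (ps_one C) = ps_one C.
    by rewrite ps_const_one scale1r one.
  elim: k => //= k IH kd.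
  by rewrite IH 1?ltnW // /drop_var ps_div_one // linear0 subr0.
- by rewrite drop_vars_killY // ps_const_var // scale0r.
Qed.

Lemma ps_constP c : ps_const C c = 0 <-> in_ideal (ps_var C) d c.
Proof.
rewrite in_ideal_drop drop_vars_all; split=> [->|/(congr1 (ps_const C))].
  by rewrite scale0r.
by rewrite linearZ_LR ps_const_one (mulr1 _ : _ *: (1 : K^o) = _) linear0.
Qed.

Lemma ps_constant c : (forall l, (l < d)%N -> ps_div C l c = 0) ->
  c = ps_const C c *: ps_one C.
Proof.
move=> c0; suff fixc k : (k <= d)%N -> drop_vars k c = c.
  by rewrite -drop_vars_all fixc.
elim: k => //= k IH kd.
by rewrite IH 1?ltnW // /drop_var c0 // linear0 subr0.
Qed.

End PolynomialSpace.

(** * Frobenius extensions of polynomial rings *)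

Section FrobeniusExtension.
Variables (K : fieldType) (A : augAlg K) (d : nat) (C : polynomial_space K d).

(** [phi] embeds the polynomial ring centrally, the form [lam] is linear over it,
    and [u], [v] are bases over it, dual for [lam]. Multiplicativity of [phi] is
    stated on the variables only, as [C] is but a space. *)
Record frobenius_extension (J : finType) (phi : {linear C -> A})
    (lam : {linear A -> C}) (u v : J -> A) : Prop := FrobeniusExtension {
  fe_one : phi (ps_one C) = 1;
  fe_var : forall l c, phi (ps_var C l c) = phi (ps_var C l (ps_one C)) * phi c;
  fe_central : forall c a, phi c * a = a * phi c;
  fe_aug : forall l, (l < d)%N -> aug A (phi (ps_var C l (ps_one C))) = 0;
  fe_lam_var : forall l a, lam (phi (ps_var C l (ps_one C)) * a) = ps_var C l (lam a);
  fe_dual : forall i j, lam (u i * v j) = if i == j then ps_one C else 0;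
  fe_u_span : forall a, exists c : J -> C, a = \sum_j phi (c j) * u j;
  fe_v_span : forall a, exists c : J -> C, a = \sum_j phi (c j) * v j }.

Variables (J : finType) (phi : {linear C -> A}) (lam : {linear A -> C}).
Variables (u v : J -> A).
Hypothesis F : frobenius_extension phi lam u v.

Let y l := phi (ps_var C l (ps_one C)).

Lemma fe_yC k l : y k * y l = y l * y k.
Proof. exact: (fe_central F). Qed.

Lemma fe_phi_var l c : phi (ps_var C l c) = y l * phi c.
Proof. exact: (fe_var F). Qed.

Lemma fe_lam_one c a : lam a = ps_one C -> lam (phi c * a) = c.
Proof.
move=> a1; elim/ps_ind: c => [|k c c' cE c'E||l c ld cE].
- by rewrite linear0 mul0r linear0.
- by rewrite linearP mulrDl -scalerAl linearP cE c'E.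
- by rewrite (fe_one F) mul1r.
- by rewrite fe_phi_var -mulrA (fe_lam_var F) cE.
Qed.

Lemma fe_lam_zero c a : lam a = 0 -> lam (phi c * a) = 0.
Proof.
move=> a0; elim/ps_ind: c => [|k c c' cE c'E||l c ld cE].
- by rewrite linear0 mul0r linear0.
- by rewrite linearP mulrDl -scalerAl linearP cE c'E scaler0 addr0.
- by rewrite (fe_one F) mul1r.
- by rewrite fe_phi_var -mulrA (fe_lam_var F) cE linear0.
Qed.

(** Coordinates in one basis are read off with the dual one. *)
Lemma fe_u_coef a : a = \sum_j phi (lam (a * v j)) * u j.
Proof.
have [c aE] := fe_u_span F a; rewrite {1}aE; apply: eq_bigr => j _.
congr (phi _ * _); rewrite aE mulr_suml linear_sum (bigD1 j) //= big1 => [|i ij].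
  by rewrite addr0 -mulrA fe_lam_one // (fe_dual F) eqxx.
by rewrite -mulrA fe_lam_zero // (fe_dual F) (negPf ij).
Qed.

Lemma fe_v_coef a : a = \sum_j phi (lam (u j * a)) * v j.
Proof.
have [c aE] := fe_v_span F a; rewrite {1}aE; apply: eq_bigr => j _.
congr (phi _ * _); rewrite aE mulr_sumr linear_sum (bigD1 j) //= big1 => [|i ij].
  by rewrite addr0 mulrA -(fe_central F) -mulrA fe_lam_one // (fe_dual F) eqxx.
by rewrite mulrA -(fe_central F) -mulrA fe_lam_zero // (fe_dual F) eq_sym (negPf ij).
Qed.

Lemma fe_lam_u (c : J -> C) j : lam ((\sum_i phi (c i) * u i) * v j) = c j.
Proof.
rewrite mulr_suml linear_sum (bigD1 j) //= big1 => [|i ij].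
  by rewrite addr0 -mulrA fe_lam_one // (fe_dual F) eqxx.
by rewrite -mulrA fe_lam_zero // (fe_dual F) (negPf ij).
Qed.

(** Division by the [l]-th variable of the coordinates in the basis [u]. *)
Fact fe_div_linear l :
  linear (fun a => \sum_j phi (ps_div C l (lam (a * v j))) * u j : A).
Proof.
move=> k a b; rewrite scaler_sumr -big_split; apply: eq_bigr => j _ /=.
by rewrite mulrDl -scalerAl !linearP mulrDl -scalerAl.
Qed.
Definition fe_div l : {linear A -> A} := mklin (fe_div_linear l).

Lemma fe_divE l a : fe_div l a = \sum_j phi (ps_div C l (lam (a * v j))) * u j.
Proof. by []. Qed.

Lemma fe_lam_div l a j : lam (fe_div l a * v j) = ps_div C l (lam (a * v j)).
Proof. by rewrite fe_divE fe_lam_u. Qed.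

Lemma fe_divK l a : fe_div l (y l * a) = a.
Proof.
rewrite fe_divE [RHS]fe_u_coef; apply: eq_bigr => j _.
by rewrite -mulrA (fe_lam_var F) ps_varK.
Qed.

Lemma fe_div_var k l a : k != l -> fe_div k (y l * a) = y l * fe_div k a.
Proof.
move=> kl; rewrite !fe_divE mulr_sumr; apply: eq_bigr => j _.
by rewrite -mulrA (fe_lam_var F) ps_div_var // fe_phi_var mulrA.
Qed.

Lemma fe_divC k l a : fe_div k (fe_div l a) = fe_div l (fe_div k a).
Proof.
by rewrite [LHS]fe_divE [RHS]fe_divE; apply: eq_bigr => j _; rewrite !fe_lam_div ps_divC.
Qed.

Lemma fe_div_nil l a : (l < d)%N -> exists s, iter s (fe_div l) a = 0.
Proof.
move=> ld; have /choice[s sP] : forall j, exists s, iter s (ps_div C l) (lam (a * v j)) = 0.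
  by move=> j; apply: ps_div_nil.
have iterE t j : lam (iter t (fe_div l) a * v j) = iter t (ps_div C l) (lam (a * v j)).
  by elim: t => //= t IH; rewrite fe_lam_div IH.
have iter0 t : iter t (ps_div C l) 0 = 0 by elim: t => //= t ->; rewrite linear0.
exists (\sum_j s j)%N; rewrite [LHS]fe_u_coef big1 // => j _.
by rewrite iterE (bigD1 j) //= addnC iterD sP iter0 linear0 mul0r.
Qed.

Lemma fe_equivariant (f g : A -> C) : linear f -> linear g ->
    (forall l a, (l < d)%N -> f (y l * a) = ps_var C l (f a)) ->
    (forall l a, (l < d)%N -> g (y l * a) = ps_var C l (g a)) ->
    (forall j, f (u j) = g (u j)) -> f =1 g.
Proof.
move=> fL gL fY gY fg a; have [c ->] := fe_u_span F a.
pose f' : {linear A -> C} := mklin fL; pose g' : {linear A -> C} := mklin gL.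
rewrite -[f _]/(f' _) -[g _]/(g' _) !linear_sum; apply: eq_bigr => j _.
elim/ps_ind: (c j) => [|k b b' bE b'E||l b ld bE].
- by rewrite linear0 mul0r !linear0.
- by rewrite linearP mulrDl -scalerAl !linearP bE b'E.
- by rewrite (fe_one F) mul1r; apply: fg.
- by rewrite fe_phi_var -mulrA [LHS]fY // [RHS]gY //; congr (ps_var C l _).
Qed.

(** A map [f] from [A] to [C] linear over the variables is [lam (- * b)] for
    [b = sum_j f(u_j) v_j]. *)
Theorem frobenius_left_AS : left_AS_condition A d.
Proof.
apply: (@pairing_left_AS _ A C d y (ps_var C) fe_div lam (ps_const C) (ps_one C)).
- exact: fe_yC.
- exact: ps_varC.
- exact: (fe_aug F).
- by move=> k a _; apply: fe_divK.
- by move=> k l a _ lk; apply: fe_div_var; rewrite gtn_eqF.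
- by move=> k a; apply: fe_div_nil.
- move=> b b0; rewrite [b]fe_v_coef big1 // => j _.
  by rewrite b0 linear0 mul0r.
- move=> f; split=> [fY|[b bE] l a ld]; last by rewrite !bE -mulrA (fe_lam_var F).
  exists (\sum_j phi (f (u j)) * v j).
  apply: fe_equivariant => //; first exact: coindP.
  + by move=> k a a'; rewrite mulrDl -scalerAl linearP.
  + by move=> l a ld; rewrite -mulrA (fe_lam_var F).
  + move=> j; rewrite mulr_sumr linear_sum (bigD1 j) //= big1 => [|i ij].
      by rewrite addr0 mulrA -(fe_central F) -mulrA fe_lam_one // (fe_dual F) eqxx.
    by rewrite mulrA -(fe_central F) -mulrA fe_lam_zero // (fe_dual F) eq_sym (negPf ij).
- by move=> k c _; apply: ps_var_regular.
- exact: ps_const_one.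
- exact: ps_constP.
Qed.

(** Left ideals are stable under the variables, and the elements on which all
    divisions vanish are the [K]-combinations of the basis [u]. *)
Theorem frobenius_left_noetherian : left_noetherian A.
Proof.
move=> L [L0 LD LM].
have LZ (k : K) x : L x -> L (k *: x) by rewrite -mulr_algl; apply: LM.
have yL l : linear (fun a : A => y l * a).
  by move=> k a b; rewrite mulrDr scalerAr.
pose Y l : {linear A -> A} := mklin (yL l).
have stW W : left_ideal W -> stable Y d W.
  case=> W0 WD WM; split=> // [k a b Wa Wb|l a _ /WM]; last exact.
  by apply: WD => //; rewrite -mulr_algl; apply: WM.
have /(_ L)[|x _ l|s sL sG] : noeth d Y fe_div d.
- apply: hilbert_basis.
  + by move=> l x _; apply: fe_divK.
  + by move=> k l x _ _; apply: fe_div_var.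
  + exact: fe_divC.
  + by move=> l x; apply: fe_div_nil.
  move=> M stM lowM; apply: (fin_span_generated (r := index_enum J) (u := u)) => //.
  move=> x Mx; exists (fun j => ps_const C (lam (x * v j))).
  rewrite {1}[x]fe_u_coef; apply: eq_bigr => j _.
  rewrite {1}[lam _]ps_constant => [|l ld]; last first.
    by rewrite -fe_lam_div (lowM x Mx) // mul0r linear0.
  by rewrite linearZ_LR (fe_one F) mulr_algl.
- exact: stW.
- by rewrite ltnNge andbN.
exists s => x; split=> [Lx|[c ->]]; last first.
  apply: big_ind => // i _; apply: LM; apply: sL; exact: mem_nth.
apply: (sG x Lx (fun z => exists c : 'I_(size s) -> A, z = \sum_(i < size s) c i * s`_i)).
  apply: stW; split.
  - by exists (fun _ => 0); rewrite big1 // => i _; rewrite mul0r.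
  - move=> _ _ [c ->] [c' ->]; exists (fun i => c i + c' i).
    by rewrite -big_split; apply: eq_bigr => i _; rewrite mulrDl.
  - move=> a _ [c ->]; exists (fun i => a * c i).
    by rewrite mulr_sumr; apply: eq_bigr => i _; rewrite mulrA.
move=> z /(nthP 0)[i iss <-]; exists (fun j => (j == Ordinal iss)%:R).
rewrite (bigD1 (Ordinal iss)) //= eqxx mul1r big1 ?addr0 // => j /negPf ->.
by rewrite mul0r.
Qed.

End FrobeniusExtension.

Section Converse.
Variables (K : fieldType) (A : augAlg K) (d : nat) (C : polynomial_space K d).
Variables (J : finType) (phi : {linear C -> A}) (lam : {linear A -> C}).
Variables (u v : J -> A).
Hypothesis F : frobenius_extension phi lam u v.

Fact converse_phi_linear : linear (phi : C -> converse_augAlg A).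
Proof. by move=> k c c'; apply: (linearP phi). Qed.
Fact converse_lam_linear : linear (lam : converse_augAlg A -> C).
Proof. by move=> k a b; apply: (linearP lam). Qed.

(** The definition is symmetric in the two bases, [phi] being central. *)
Lemma frobenius_converse : frobenius_extension
  (mklin converse_phi_linear) (mklin converse_lam_linear)
  (v : J -> converse_augAlg A) (u : J -> converse_augAlg A).
Proof.
case: F => one var central aug_y lam_var dual u_span v_span.
have sumC (w : J -> A) (c : J -> C) :
    \sum_j phi (c j) * w j = \sum_j (w j : A) * phi (c j).
  by apply: eq_bigr => j _; rewrite central.
split.
- exact: one.
- move=> l c; rewrite converse_mulE -central; exact: var.
- by move=> c a; rewrite !converse_mulE; apply/esym/central.
- exact: aug_y.
- move=> l a; rewrite converse_mulE -central; exact: lam_var.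
- by move=> i j; rewrite converse_mulE eq_sym; apply: dual.
- by move=> a; have [c] := v_span a; rewrite sumC; exists c.
- by move=> a; have [c] := u_span a; rewrite sumC; exists c.
Qed.

Theorem frobenius_AS_Gorenstein : AS_Gorenstein A.
Proof.
split; first exact: frobenius_left_noetherian F.
  exact: frobenius_left_noetherian frobenius_converse.
exists d; split; first exact: frobenius_left_AS F.
exact: frobenius_left_AS frobenius_converse.
Qed.

End Converse.

(** * Operators acting on one exponent of a monomial *)

Section Exponents.
Variable d : nat.
Definition expo : Type := {ffun 'I_d -> nat}.
HB.instance Definition _ := Choice.on expo.
Implicit Type e : expo.

Definition expo0 : expo := [ffun=> 0%N].
(** Indices are natural numbers, the exponent being zero out of range. *)
Definition expo_at e (l : nat) : nat := if insub l is Some i then e i else 0%N.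
Definition set_coord (l m : nat) e : expo :=
  [ffun i : 'I_d => if i == l :> nat then m else e i].
Definition raise l e := set_coord l (expo_at e l).+1 e.

Lemma expo_atE e (i : 'I_d) : expo_at e i = e i.
Proof. by rewrite /expo_at valK. Qed.

Lemma expo_at0 l : expo_at expo0 l = 0%N.
Proof. by rewrite /expo_at; case: insubP => // i _ _; rewrite ffunE. Qed.

Lemma expo_at_set e l m k : (l < d)%N ->
  expo_at (set_coord l m e) k = if k == l then m else expo_at e k.
Proof.
move=> ld; rewrite /expo_at; case: insubP => [i _ <-|]; first by rewrite ffunE.
by case: eqP => // ->; rewrite ld.
Qed.

Lemma set_coordK e l : set_coord l (expo_at e l) e = e.
Proof. by apply/ffunP=> i; rewrite ffunE; case: eqP => // <-; rewrite expo_atE. Qed.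

Lemma set_set e l m m' : set_coord l m (set_coord l m' e) = set_coord l m e.
Proof. by apply/ffunP=> i; rewrite !ffunE; case: eqP. Qed.

Lemma set_setC e k l m m' : k != l ->
  set_coord k m (set_coord l m' e) = set_coord l m' (set_coord k m e).
Proof.
move=> kl; apply/ffunP=> i; rewrite !ffunE.
by have [->|//] := eqVneq (nat_of_ord i) k; rewrite (negPf kl).
Qed.

Lemma expo_eq e e' : (forall l, (l < d)%N -> expo_at e l = expo_at e' l) -> e = e'.
Proof. by move=> E; apply/ffunP=> i; rewrite -!expo_atE E. Qed.

Lemma expo_at_raise e l k : (l < d)%N -> expo_at (raise l e) k = (expo_at e k + (k == l))%N.
Proof. by move=> ld; rewrite expo_at_set //; case: eqP => [->|]; rewrite ?addn1 ?addn0. Qed.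

Lemma expo_ind (P : expo -> Prop) : P expo0 ->
  (forall l e, (l < d)%N -> P e -> P (raise l e)) -> forall e, P e.
Proof.
move=> P0 PS e; have [n] := ubnP (\sum_i e i); elim: n e => // n IH e le.
have [i ei|e0] := pickP (fun i => 0 < e i)%N; last first.
  suff -> : e = expo0 by [].
  by apply/ffunP=> i; have := e0 i; rewrite ffunE lt0n => /negbFE/eqP.
pose e' := set_coord i (e i).-1 e.
have -> : e = raise i e'.
  by rewrite /raise expo_at_set // eqxx set_set prednK // -expo_atE set_coordK.
apply: PS => //; apply: IH; rewrite -ltnS; apply: leq_trans le; rewrite ltnS.
rewrite (bigD1 i) //= [X in (_ < X)%N](bigD1 i) //= ffunE eqxx.
rewrite -[in X in (_ < X)%N](prednK ei) addSn ltnS leq_add2l.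
by apply: leq_sum => j ji; rewrite ffunE (inj_eq val_inj) (negPf ji).
Qed.

End Exponents.

Arguments expo0 {d}.

Section WeightedShifts.
Variables (K : fieldType) (T : choiceType).

(** Operators sending a basis element to a multiple of a basis element: their
    identities reduce to identities between functions on the basis. *)
Definition wshift (f : T -> K * T) : {linear {malg K[T]} -> {malg K[T]}} :=
  malg_ext (fun e => (f e).1 *: << (f e).2 >>).

Lemma wshiftU f e : wshift f << e >> = (f e).1 *: << (f e).2 >>.
Proof. exact: malg_extU. Qed.

Definition wcomp (f g : T -> K * T) e := ((g e).1 * (f (g e).2).1, (f (g e).2).2).

Lemma wshift_comp f g v : wshift f (wshift g v) = wshift (wcomp f g) v.
Proof.
apply: (@malg_linear_eq _ _ _ (wshift f \o wshift g)) => e.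
rewrite -[LHS]/(wshift f (wshift g << e >>)) (wshiftU g) linearZ_LR.
by rewrite (wshiftU f) (wshiftU (wcomp f g)) scalerA.
Qed.

Lemma wshift_eq f g v : (forall e, f e = g e \/ ((f e).1 = 0 /\ (g e).1 = 0)) ->
  wshift f v = wshift g v.
Proof.
move=> fg; apply: malg_linear_eq => e; rewrite (wshiftU f) (wshiftU g).
by case: (fg e) => [->//|[-> ->]]; rewrite !scale0r.
Qed.

Lemma wshift_id v : wshift (fun e => (1, e)) v = v.
Proof.
apply: (@malg_linear_eq _ _ _ (wshift _) idfun) => e.
by rewrite wshiftU scale1r.
Qed.

End WeightedShifts.

Section CoordinateOperators.
Variables (K : fieldType) (d : nat).
Local Notation V := {malg K[expo d]}.
Implicit Types (f g : nat -> K * nat) (v : V).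

(** The action of [f] on the [l]-th exponent alone. *)
Definition lift_coord l f (e : expo d) : K * expo d :=
  if (l < d)%N then ((f (expo_at e l)).1, set_coord l (f (expo_at e l)).2 e) else (1, e).

Definition cop l f : {linear V -> V} := wshift (lift_coord l f).

Definition ccomp f g m := ((g m).1 * (f (g m).2).1, (f (g m).2).2).

Lemma copU l f e : (l < d)%N ->
  cop l f << e >> = (f (expo_at e l)).1 *: << set_coord l (f (expo_at e l)).2 e >>.
Proof. by move=> ld; rewrite /cop wshiftU /lift_coord ld. Qed.

Lemma cop_comp l f g v : cop l f (cop l g v) = cop l (ccomp f g) v.
Proof.
apply: (etrans (wshift_comp _ _ _)); apply: wshift_eq => e; left.
rewrite /wcomp /lift_coord; case: ifP => ld; rewrite /= ?ld ?mulr1 //.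
by rewrite !expo_at_set // eqxx set_set.
Qed.

Lemma cop_swap k l f g v : k != l -> cop k f (cop l g v) = cop l g (cop k f v).
Proof.
move=> kl; have lk : l != k by rewrite eq_sym.
apply: (etrans (wshift_comp _ _ _)); apply: (etrans _ (esym (wshift_comp _ _ _))).
apply: wshift_eq => e; left.
rewrite /wcomp /lift_coord; do 2!case: ifP => ?; rewrite /= ?mulr1 ?mul1r ?expo_at_set //.
by rewrite (negPf kl) (negPf lk) mulrC set_setC.
Qed.

Lemma cop_eq l f g v : (forall m, f m = g m \/ ((f m).1 = 0 /\ (g m).1 = 0)) ->
  cop l f v = cop l g v.
Proof.
move=> fg; apply: wshift_eq => e; rewrite /lift_coord; case: ifP => _; last by left.
by case: (fg (expo_at e l)) => [->|]; [left|right].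
Qed.

Lemma cop_id l v : cop l (fun m => (1, m)) v = v.
Proof.
rewrite -[RHS]wshift_id; apply: wshift_eq => e; left.
by rewrite /lift_coord; case: ifP => //= _; rewrite set_coordK.
Qed.

End CoordinateOperators.

Arguments cop {K d} l f.

Section ConcretePolynomials.
Variables (K : fieldType) (d : nat).
Local Notation V := ({malg K[expo d]} : lmodType K).

Definition mulX (m : nat) : K * nat := (1, m.+1).
Definition divX (m : nat) : K * nat := ((0 < m)%:R, m.-1).

Fact cop_nil l (v : V) : (l < d)%N -> exists s, iter s (cop l divX) v = 0.
Proof.
move=> ld; have iter0 s : iter s (cop l divX) (0 : V) = 0.
  by elim: s => //= s ->; rewrite linear0.
elim/malg_ind: v => [|a g h [s gs] [t ht]|e]; first by exists 0%N.
  exists (s + t)%N; have iterL n : iter n (cop l divX) (a *: g + h) =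
    a *: iter n (cop l divX) g + iter n (cop l divX) h.
    by elim: n => //= n ->; rewrite linearP.
  by rewrite iterL {1}addnC !iterD gs ht !iter0 scaler0 addr0.
move E: (expo_at e l) => n; elim: n e E => [|n IH] e E.
  by exists 1%N; rewrite /= copU // E scale0r.
have [|s sP] := IH (set_coord l n e); first by rewrite expo_at_set // eqxx.
by exists s.+1; rewrite iterSr copU // E scale1r.
Qed.

Fact const_linear : linear (fun v : V => v@_expo0 : K^o).
Proof. by move=> a v w; rewrite mcoeffD mcoeffZ. Qed.
Definition const : {linear V -> K^o} := mklin const_linear.

Fact const_cop l (v : V) : (l < d)%N -> const (cop l mulX v) = 0.
Proof.
move=> ld; apply: (@malg_linear_eq _ _ _ (const \o cop l mulX) \0) => e.
rewrite -[LHS]/(const (cop l mulX << e >>)) copU // scale1r.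
have -> (e' : expo d) : const << e' >> = (<< e' >> : {malg K[expo d]})@_expo0 by [].
rewrite mcoeffU; case: eqP => // /(congr1 (fun e => expo_at e l)).
by rewrite expo_at_set // eqxx expo_at0.
Qed.

Fact monomials_ind (P : V -> Prop) : P 0 ->
    (forall a g h, P g -> P h -> P (a *: g + h)) -> P << expo0 >> ->
    (forall l c, (l < d)%N -> P c -> P (cop l mulX c)) -> forall c, P c.
Proof.
move=> P0 PL P1 PX; apply: malg_ind => //; apply: expo_ind => // l e ld Pe.
by have := PX l _ ld Pe; rewrite copU // scale1r.
Qed.

Fact cop_mulXC k l (v : V) : cop k mulX (cop l mulX v) = cop l mulX (cop k mulX v).
Proof. by have [->|kl] := eqVneq k l; [|exact: cop_swap]. Qed.

Fact cop_divX_mulX l (v : V) : cop l divX (cop l mulX v) = v.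
Proof.
rewrite cop_comp -[RHS](cop_id l); apply: cop_eq => m; left.
by rewrite /ccomp /= mulr1.
Qed.

Fact cop_divX_swap k l (v : V) : k != l ->
  cop k divX (cop l mulX v) = cop l mulX (cop k divX v).
Proof. exact: cop_swap. Qed.

Fact cop_divXC k l (v : V) : cop k divX (cop l divX v) = cop l divX (cop k divX v).
Proof. by have [->|kl] := eqVneq k l; [|exact: cop_swap]. Qed.

Fact cop_divX_one l : (l < d)%N -> cop l divX (<< expo0 >> : V) = 0.
Proof. by move=> ld; rewrite copU // expo_at0 scale0r. Qed.

Fact const_one : const (<< expo0 >> : V) = 1.
Proof. exact: mcoeffUU. Qed.

Definition polynomials : polynomial_space K d :=
  @PolynomialSpace K d V << expo0 >> (fun l => cop l mulX) (fun l => cop l divX)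
    const cop_mulXC cop_divX_mulX cop_divX_swap cop_divXC cop_nil cop_divX_one
    const_one const_cop monomials_ind.

End ConcretePolynomials.

(** * Weyl operators and the representation of the letters *)

Section WeylOperators.
Variables (K : fieldType) (V : lmodType K) (q : nat) (one : V).
Variables mop dop : nat -> {linear V -> V}.
Implicit Types v w : V.
Hypothesis dop_mop : forall i v, (i < q.+1)%N -> dop i (mop i v) = mop i (dop i v) + v.
Hypothesis mopC : forall i j v, mop i (mop j v) = mop j (mop i v).
Hypothesis dop_mopC : forall i j v, i != j -> dop i (mop j v) = mop j (dop i v).
Hypothesis dop_one : forall i, (i < q.+1)%N -> dop i one = 0.

(** The derivation sending the [i]-th letter to the next one for [i < q - 1], and
    the letters of index [q - 1] and [q] to zero. *)
Fact delta_linear : linear (fun v => \sum_(i < q.-1) mop i.+1 (dop i v)).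
Proof.
move=> a v w; rewrite scaler_sumr -big_split; apply: eq_bigr => i _ /=.
by rewrite !linearP.
Qed.
Definition delta : {linear V -> V} := mklin delta_linear.

(** The operators by which the iterated commutators of the two letters act. *)
Definition xop k : {linear V -> V} := if (k < q)%N then mop k else \0.

Lemma xopE k v : xop k v = if (k < q)%N then mop k v else 0.
Proof. by rewrite /xop; case: ifP. Qed.

(** [delta] is a derivation, and commutation with [mop i] picks its value on the
    [i]-th letter. *)
Lemma delta_mop i v : (i < q.+1)%N -> delta (mop i v) = mop i (delta v) + xop i.+1 v.
Proof.
move=> id; rewrite /delta /= linear_sum /=.
have term (j : 'I_q.-1) : mop j.+1 (dop j (mop i v)) =
    mop i (mop j.+1 (dop j v)) + (if (j : nat) == i then mop i.+1 v else 0).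
  case: eqP => [ji|/eqP ji].
    by rewrite ji dop_mop // linearD mopC.
  by rewrite dop_mopC // mopC addr0.
rewrite (eq_bigr _ (fun j _ => term j)) big_split /=; congr (_ + _).
rewrite -big_mkcond xopE; case: ifP => iq.
  have iq' : (i < q.-1)%N by rewrite ltn_predRL.
  by rewrite (big_pred1 (Ordinal iq')).
rewrite big_pred0 // => j; apply: contraFF iq => /eqP <-.
by rewrite -ltn_predRL.
Qed.

Definition hop_fun v : V := (mop q v : V) - (delta v : V).
Fact hop_linear : linear hop_fun.
Proof. by move=> a v w; rewrite /hop_fun !linearP scalerDr addrACA. Qed.
Definition hop : {linear V -> V} := mklin hop_linear.

Lemma hopE v : hop v = (mop q v : V) - (delta v : V).
Proof. by []. Qed.

Let mopB i v w : mop i (v - w) = mop i v - mop i w.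
Proof. exact: linearB. Qed.

Lemma xop_mopC k i v : xop k (mop i v) = mop i (xop k v).
Proof. by rewrite !xopE; case: ifP => _; [apply: mopC|rewrite linear0]. Qed.

Lemma xop_hop k v : xop k (hop v) - hop (xop k v) = xop k.+1 v.
Proof.
rewrite (xopE k (hop v)) (xopE k v); case: ifP => kq; last first.
  rewrite linear0 subr0 xopE; case: ifP => // kq'.
  by rewrite (ltnW kq') in kq.
rewrite !hopE (delta_mop _ (leqW kq)).
have cancel (a b x : V) : a - b - (a - (b + x)) = x.
  by rewrite opprB !addrA subrK addrAC subrr add0r.
rewrite -[RHS](cancel (mop k (mop q v)) (mop k (delta v))).
by congr (_ - (_ - _)); [exact: mopB|exact: mopC].
Qed.

Lemma xopC k l v : xop k (xop l v) = xop l (xop k v).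
Proof.
rewrite (xopE k (xop l v)) (xopE k v); case: ifP => _; first by rewrite xop_mopC.
by rewrite linear0.
Qed.

Lemma hop_mopq v : hop (mop q v) = mop q (hop v).
Proof.
rewrite !hopE delta_mop // xopE ltnNge leqnSn addr0.
exact/esym/mopB.
Qed.

Lemma delta_one : delta one = 0.
Proof.
rewrite /delta /= big1 // => i _; rewrite dop_one ?linear0 //.
by apply: leq_trans (ltn_ord i) _; rewrite (leq_trans (leq_pred q)).
Qed.

(** The span of the words in the multiplication operators applied to [one]: an
    operator commuting with them is determined there by its value at [one]. *)
Inductive reach : V -> Prop :=
| Reach0 : reach 0
| Reach1 : reach one
| ReachL a v w : reach v -> reach w -> reach (a *: v + w)
| ReachX i v : (i < q.+1)%N -> reach v -> reach (mop i v).

Lemma reach_delta v : reach v -> reach (delta v).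
Proof.
elim=> [||a x y _ dx _ dy|i x id rx dx].
- by rewrite linear0; apply: Reach0.
- by rewrite delta_one; apply: Reach0.
- by rewrite linearP; apply: ReachL.
- rewrite delta_mop // -[mop i _]scale1r; apply: ReachL; first exact: ReachX.
  rewrite xopE; case: ifP => iq; last exact: Reach0.
  by apply: ReachX => //; apply: ltnW.
Qed.

Lemma reach_hop v : reach v -> reach (hop v).
Proof.
move=> rv; rewrite hopE addrC -scaleN1r; apply: ReachL; first exact: reach_delta.
exact: ReachX.
Qed.

Lemma iter_linear m (f : {linear V -> V}) a v w :
  iter m f (a *: v + w) = a *: iter m f v + iter m f w.
Proof. by elim: m => //= m ->; rewrite linearP. Qed.

Lemma iter_mop_mop m i j v : iter m (mop i) (mop j v) = mop j (iter m (mop i) v).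
Proof. by elim: m => //= m ->; rewrite mopC. Qed.

Lemma reach_order m i (b : K) v : iter m (mop i) one = b *: one -> reach v ->
  iter m (mop i) v = b *: v.
Proof.
move=> m1; elim=> [||a x y _ xE _ yE|j x jd _ xE] //.
- by rewrite scaler0; elim: (m) => //= n ->; rewrite linear0.
- by rewrite iter_linear xE yE scalerDr !scalerA mulrC.
- by rewrite iter_mop_mop xE linearZ_LR.
Qed.

End WeylOperators.

Section MonomialOperators.
Variables (K : fieldType) (d : nat) (N : nat -> nat) (I : pred nat) (c : nat -> K).
Hypothesis N_gt1 : forall i, (1 < N i)%N.
Hypothesis N_char : forall i, (N i)%:R = 0 :> K.

Local Notation V := ({malg K[expo d]} : lmodType K).
Implicit Types v w : V.

(** Multiplication by the [i]-th letter, reduced by the rule that its [N i]-th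
    power is [c i] if [I i] holds. *)
Definition redX i (m : nat) : K * nat :=
  if I i && (N i %| m.+1)%N then (c i, m.+1 - N i)%N else (1, m.+1).
Definition derX (m : nat) : K * nat := (m%:R, m.-1).

Definition monX i : {linear V -> V} := cop i (redX i).
Definition monD i : {linear V -> V} := cop i derX.

Lemma dvdN_char i m : (N i %| m)%N -> m%:R = 0 :> K.
Proof. by move=> /dvdnP[k ->]; rewrite natrM N_char mulr0. Qed.

Lemma malg_add_id (f g : {linear V -> V}) : (forall e, f << e >> = g << e >> + << e >>) ->
  forall v, f v = g v + v.
Proof.
move=> fg; apply: malg_ind => [|a x y xE yE|//]; first by rewrite !linear0 addr0.
by rewrite !linearP xE yE scalerDr addrACA.
Qed.

(** At the reduction step the derivative of the [N i]-th power vanishes, since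
    [N i] is zero in [K]. *)
Lemma monD_monX i v : (i < d)%N -> monD i (monX i v) = monX i (monD i v) + v.
Proof.
move=> id; apply: (@malg_add_id (monD i \o monX i) (monX i \o monD i)) => e.
apply: (etrans (cop_comp i derX (redX i) << e >>)).
apply: (etrans _ (congr1 (fun w => w + << e >>)
  (esym (cop_comp i (redX i) derX << e >>)))).
apply: (etrans (copU (ccomp derX (redX i)) e id)).
apply: (etrans _ (congr1 (fun w => w + << e >>)
  (esym (copU (ccomp (redX i) derX) e id)))).
rewrite /ccomp /redX /derX.
set m := expo_at e i; case: ifP => /= [/andP[Ii Nm]|nN].
  have mN : (N i <= m.+1)%N by apply: dvdn_leq.
  have -> : (m.+1 - N i)%:R = 0 :> K by rewrite natrB // N_char (dvdN_char Nm) subr0.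
  have m0 : (0 < m)%N by rewrite -ltnS (leq_trans (N_gt1 i)).
  rewrite mulr0 scale0r prednK //.
  have /negPf -> : ~~ (N i %| m)%N.
    apply/negP => Nm'; move: Nm; rewrite -addn1 dvdn_addr // dvdn1.
    by rewrite gtn_eqF.
  rewrite andbF /= mulr1 set_coordK -[X in _ + X]scale1r -scalerDl.
  by rewrite natr1 (dvdN_char Nm) scale0r.
rewrite mul1r set_coordK; case: (posnP m) => [->|m0].
  by rewrite mul0r scale0r add0r scale1r.
rewrite prednK //; case: ifP => [/andP[_ /dvdN_char Nm]|_] /=.
  by rewrite -natr1 Nm mul0r scale0r !add0r scale1r.
by rewrite mulr1 set_coordK -natr1 scalerDl scale1r.
Qed.

Lemma monXC i j v : monX i (monX j v) = monX j (monX i v).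
Proof. by have [->|ij] := eqVneq i j; [|apply: cop_swap]. Qed.

Lemma monD_monXC i j v : i != j -> monD i (monX j v) = monX j (monD i v).
Proof. exact: cop_swap. Qed.

Lemma monD_one i : (i < d)%N -> monD i << expo0 >> = 0.
Proof. by move=> id; rewrite /monD (copU _ _ id) expo_at0 scale0r. Qed.

Lemma monX_mono i e : (i < d)%N -> ((expo_at e i).+1 < N i)%N -> monX i << e >> = << raise i e >>.
Proof.
move=> id eN; rewrite /monX (copU _ _ id) /redX gtnNdvd // andbF.
exact: scale1r.
Qed.

Lemma iter_monX_one i m : (i < d)%N -> (m < N i)%N ->
  iter m (monX i) << expo0 >> = << set_coord i m expo0 >>.
Proof.
move=> id; elim: m => [|m IH] mN.
  by rewrite /= -[in RHS](expo_at0 d i) set_coordK.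
rewrite iterS IH 1?ltnW // monX_mono // ?expo_at_set // ?eqxx //.
by rewrite /raise set_set expo_at_set // eqxx.
Qed.

Lemma monX_order i : (i < d)%N -> I i -> iter (N i) (monX i) << expo0 >> = c i *: << expo0 >>.
Proof.
move=> id Ii; have N0 : (0 < N i)%N by apply: ltnW.
rewrite -{1}(prednK N0) iterS iter_monX_one // ?prednK // /monX (copU _ _ id).
have -> : redX i (expo_at (set_coord i (N i).-1 (expo0 : expo d)) i) = (c i, 0%N).
  by rewrite expo_at_set // eqxx /redX prednK // Ii dvdnn subnn.
by rewrite /= set_set -{2}[expo0](set_coordK _ i) expo_at0.
Qed.

End MonomialOperators.

Arguments monX {K d} N I c i.
Arguments monD {K d} i.

(** * Iterated commutators *)

Section IteratedCommutators.
Variables (R : nzRingType) (z : nat -> R) (h : R).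
Hypothesis zh : forall k, z k * h - h * z k = z k.+1.

Lemma commute_letter k : z k * h = h * z k + z k.+1.
Proof. by rewrite -zh addrC subrK. Qed.

Lemma commute_expr k m :
  z k * h ^+ m = \sum_(j < m.+1) (h ^+ (m - j) * z (k + j)%N) *+ 'C(m, j).
Proof.
elim: m k => [|m IH] k.
  by rewrite big_ord1 /= subn0 addn0 bin0 expr0 mulr1 mul1r.
rewrite exprS mulrA commute_letter mulrDl -mulrA !IH.
rewrite [RHS]big_ord_recl /= bin0 subn0 addn0 mulr1n.
under [in RHS]eq_bigr => j _ do
  rewrite /bump /= add1n binS mulrnDr subSS addnS -addSn.
rewrite big_split /= addrA; congr (_ + _).
rewrite [X in _ + X]big_ord_recr /= bin_small // mulr0n addr0.
rewrite mulr_sumr big_ord_recl /= bin0 subn0 addn0 mulr1n mulrA -exprS.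
congr (_ + _); apply: eq_bigr => j _.
by rewrite /bump /= add1n mulrnAr mulrA -exprS -subSn // subSS addSnnS.
Qed.

(** The inner binomial coefficients vanish. *)
Lemma commute_expr_prime p k : prime p -> (forall x : R, x *+ p = 0) ->
  z k * h ^+ p = h ^+ p * z k + z (k + p)%N.
Proof.
case: p => // p p_pr p0; rewrite commute_expr big_ord_recl big_ord_recr /=.
rewrite bin0 subn0 addn0 mulr1n /bump /= !add1n binn subnn expr0 mul1r mulr1n.
rewrite big1 ?add0r // => j _; rewrite add1n.
have /dvdnP[t ->] : (p.+1 %| 'C(p.+1, j.+1))%N by rewrite prime_dvd_bin //= ltnS.
by rewrite mulrnA p0.
Qed.

Lemma commute_expr_dvd p k m : prime p -> (forall x : R, x *+ p = 0) ->
  (forall k, z (k + p)%N = 0) -> (p %| m)%N -> z k * h ^+ m = h ^+ m * z k.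
Proof.
move=> p_pr p0 zp /dvdnP[t ->]; rewrite mulnC exprM.
elim: t => [|t IH]; first by rewrite !expr0 mulr1 mul1r.
rewrite exprS mulrA (commute_expr_prime _ p_pr p0) zp addr0.
by rewrite -mulrA IH mulrA.
Qed.

Lemma expr_commute_letter k m : (forall i j, z i * z j = z j * z i) ->
  z k ^+ m * h = h * z k ^+ m + (z k ^+ m.-1 * z k.+1) *+ m.
Proof.
move=> zC; elim: m => [|m IH]; first by rewrite !expr0 mulr0n addr0 mulr1 mul1r.
rewrite exprS -mulrA IH mulrDr mulrA commute_letter mulrDl -mulrA -addrA.
congr (_ + _); have zmC : z k.+1 * z k ^+ m = z k ^+ m * z k.+1.
  by apply: commrX; apply: zC.
rewrite zmC mulrSr addrC; congr (_ + _); case: m {IH zmC} => [|m]; first by rewrite !mulr0n mulr0.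
by rewrite /= mulrnAr mulrA -exprS.
Qed.

End IteratedCommutators.

(** * Commuting monomials *)

Section Monomials.
Variables (R : nzRingType) (d : nat) (z : nat -> R).
Hypothesis zC : forall i j, z i * z j = z j * z i.

Definition mon (e : expo d) : R := \prod_(i < d) z i ^+ e i.

Lemma mon0 : mon expo0 = 1.
Proof. by rewrite /mon big1 // => i _; rewrite ffunE expr0. Qed.

Lemma commute_mon a (e : expo d) : (forall i, (i < d)%N -> a * z i = z i * a) ->
  a * mon e = mon e * a.
Proof.
move=> az; apply: (big_ind (fun b => a * b = b * a)).
- by rewrite mulr1 mul1r.
- by move=> b b' ab ab'; rewrite mulrA ab -mulrA ab' mulrA.
- by move=> i _; apply: commrX; apply: az.
Qed.

Lemma mon_raise i (e : expo d) : (i < d)%N -> mon (raise i e) = z i * mon e.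
Proof.
move=> id; pose E (f : nat -> nat) m := \prod_(j < m) z j ^+ f j.
have ES f m : E f m.+1 = E f m * z m ^+ f m by rewrite /E big_ord_recr.
have EC k f m : z k * E f m = E f m * z k.
  elim: m => [|m IH]; first by rewrite /E !big_ord0 mulr1 mul1r.
  rewrite ES mulrA IH -!mulrA; congr (_ * _).
  by apply: commrX; apply: zC.
have key m : E (fun j => expo_at e j + (j == i))%N m = (if (i < m)%N then z i else 1) * E (expo_at e) m.
  elim: m => [|m IH]; first by rewrite /E !big_ord0 mul1r.
  rewrite !ES IH.
  have [->|im] := eqVneq i m.
    by rewrite ltnn ltnSn mul1r addn1 exprS mulrA -EC mulrA.
  by rewrite [in RHS]ltnS [in RHS]leq_eqVlt (negPf im) addn0 mulrA.
transitivity (E (expo_at (raise i e)) d).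
  by apply: eq_bigr => j _; rewrite expo_atE.
transitivity (E (fun j => expo_at e j + (j == i))%N d).
  by apply: eq_bigr => j _; rewrite expo_at_raise.
by rewrite key id; congr (_ * _); apply: eq_bigr => j _; rewrite expo_atE.
Qed.

End Monomials.

(** * Normal forms *)

Section NormalForms.
Variables (K : fieldType) (p q : nat) (N : nat -> nat) (I : pred nat) (c : nat -> K).
Variables (A : augAlg K) (x : nat -> A) (h : A).
Hypothesis charKp : p \in [pchar K].
Hypothesis pq : p = q.+1.
Hypothesis N_gt0 : forall i, (0 < N i)%N.
Hypothesis p_dvd_N : forall i, (p %| N i)%N.
Hypothesis xC : forall k l, x k * x l = x l * x k.
Hypothesis xh : forall k, x k * h - h * x k = x k.+1.
Hypothesis x0 : forall k, (q <= k)%N -> x k = 0.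
Hypothesis gen : forall P : A -> Prop, P 0 ->
  (forall (k : K) a b, P a -> P b -> P (k *: a + b)) -> P 1 ->
  (forall a, P a -> P (x 0%N * a)) -> (forall a, P a -> P (h * a)) -> forall a, P a.

Local Notation E := (expo q.+1).
Local Notation at_q e := (expo_at e q).

(** The commuting letters come first and [h] has index [q]. The monomials [mon]
    are taken in the commuting letters only; the exponent of index [q] is left
    to the power of [h]. *)
Definition letter_at i := if (i < q)%N then x i else h.
Definition xvar i : A := if (i < q)%N then x i else 1.

Hypothesis order : forall i, (i < q.+1)%N -> I i -> letter_at i ^+ N i = (c i)%:A.

Lemma xvarC i j : xvar i * xvar j = xvar j * xvar i.
Proof. by rewrite /xvar; do 2!case: ifP => _; rewrite ?mulr1 ?mul1r. Qed.

Local Notation M := (mon xvar).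

Lemma x_mon k (e : E) : x k * M e = M e * x k.
Proof.
apply: commute_mon => i _; rewrite /xvar; case: ifP => _ //.
by rewrite mulr1 mul1r.
Qed.

Lemma mon_at_q b (e : E) : M (set_coord q b e) = M e.
Proof.
apply: eq_bigr => i _; rewrite ffunE; case: eqP => // ->.
by rewrite /xvar ltnn !expr1n.
Qed.

Definition uword (e : E) := M e * h ^+ at_q e.
Definition vword (e : E) := h ^+ at_q e * M e.

Lemma uword_set b (e : E) : M e * h ^+ b = uword (set_coord q b e).
Proof. by rewrite /uword mon_at_q expo_at_set // eqxx. Qed.
Lemma vword_set b (e : E) : h ^+ b * M e = vword (set_coord q b e).
Proof. by rewrite /vword mon_at_q expo_at_set // eqxx. Qed.

Lemma uword0 : uword expo0 = 1.
Proof. by rewrite /uword mon0 expo_at0 mul1r. Qed.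
Lemma vword0 : vword expo0 = 1.
Proof. by rewrite /vword mon0 expo_at0 mul1r. Qed.

Lemma mon_raise_lt i (e : E) : (i < q)%N -> M (raise i e) = x i * M e.
Proof. by move=> iq; rewrite (mon_raise xvarC _ (leqW iq)) /xvar iq. Qed.

Lemma uword_raise i (e : E) : (i < q)%N -> uword (raise i e) = x i * uword e.
Proof.
move=> iq; rewrite /uword mon_raise_lt // expo_at_raise ?gtn_eqF ?addn0 ?mulrA //.
exact: leqW.
Qed.

Lemma uword_raise_q (e : E) : uword (raise q e) = uword e * h.
Proof.
by rewrite /uword (mon_raise xvarC) // [xvar q]/xvar ltnn mul1r expo_at_raise // eqxx addn1 exprSr mulrA.
Qed.

Lemma vword_raise i (e : E) : (i < q)%N -> vword (raise i e) = vword e * x i.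
Proof.
move=> iq; rewrite /vword mon_raise_lt // x_mon expo_at_raise ?gtn_eqF ?addn0 ?mulrA //.
exact: leqW.
Qed.

Lemma vword_raise_q (e : E) : vword (raise q e) = h * vword e.
Proof.
by rewrite /vword (mon_raise xvarC) // [xvar q]/xvar ltnn mul1r expo_at_raise // eqxx addn1 exprS mulrA.
Qed.

(** ** Spanning *)

(** The filtration by the degree in [h]. *)
Inductive uspan (m : nat) : A -> Prop :=
| USpan0 : uspan m 0
| USpanL (k : K) a b : uspan m a -> uspan m b -> uspan m (k *: a + b)
| USpanU e : (at_q e < m)%N -> uspan m (uword e).

Lemma uspanD m a b : uspan m a -> uspan m b -> uspan m (a + b).
Proof. by move=> ma mb; rewrite -[a]scale1r; apply: USpanL. Qed.

Lemma uspanB m a b : uspan m a -> uspan m b -> uspan m (a - b).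
Proof. by move=> ma mb; rewrite addrC -scaleN1r; apply: USpanL. Qed.

Lemma uspan_le m n a : (m <= n)%N -> uspan m a -> uspan n a.
Proof.
move=> mn; elim=> [|k b b' _ IH _ IH'|e em]; first exact: USpan0.
  exact: USpanL.
exact/USpanU/(leq_trans em).
Qed.

Lemma uspan_x k m a : uspan m a -> uspan m (x k * a).
Proof.
have [kq|qk] := ltnP k q; last by rewrite x0 // mul0r => _; apply: USpan0.
elim=> [|r b b' _ IH _ IH'|e em].
- by rewrite mulr0; apply: USpan0.
- by rewrite mulrDr -scalerAr; apply: USpanL.
- rewrite -uword_raise //; apply: USpanU.
  by rewrite expo_at_raise ?gtn_eqF ?addn0 // leqW.
Qed.

Lemma uspan_mon (e : E) m a : uspan m a -> uspan m (M e * a).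
Proof.
move=> ma; elim/expo_ind: e => [|l e ld IH]; first by rewrite mon0 mul1r.
rewrite (mon_raise xvarC) // -mulrA [xvar l]/xvar; case: ifP => _; last by rewrite mul1r.
exact: uspan_x.
Qed.

(** Commutation with [h] is a derivation replacing one [x l] by [x l.+1]. *)
Lemma uspan_comm (e : E) b : uspan b.+1 ((M e * h - h * M e) * h ^+ b).
Proof.
elim/expo_ind: e => [|l e ld IH].
  by rewrite mon0 mulr1 mul1r subrr mul0r; apply: USpan0.
rewrite (mon_raise xvarC) // [xvar l]/xvar; case: ifP => lq; last by rewrite !mul1r.
have -> : x l * M e * h - h * (x l * M e) =
    x l * (M e * h - h * M e) + x l.+1 * M e.
  by rewrite -xh mulrBr mulrBl !mulrA [X in _ = X]addrA subrK.
rewrite mulrDl -!mulrA; apply: uspanD; first exact: uspan_x.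
by apply: uspan_x; rewrite uword_set; apply: USpanU; rewrite expo_at_set // eqxx.
Qed.

Lemma uspan_h m a : uspan m a -> uspan m.+1 (h * a).
Proof.
elim=> [|r b b' _ IH _ IH'|e em].
- by rewrite mulr0; apply: USpan0.
- by rewrite mulrDr -scalerAr; apply: USpanL.
- have -> : h * uword e = M e * h ^+ (at_q e).+1 - (M e * h - h * M e) * h ^+ at_q e.
    by rewrite /uword mulrBl exprS !mulrA opprB addrC subrK.
  apply: uspanB; last exact: uspan_le (leqW em) (uspan_comm _ _).
  by rewrite uword_set; apply: USpanU; rewrite expo_at_set // eqxx.
Qed.

Lemma uspan_all a : exists m, uspan m a.
Proof.
apply: (gen (P := fun a => exists m, uspan m a)) a => [|k a b [m ma] [n nb]||a [m ma]|a [m ma]].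
- by exists 0%N; apply: USpan0.
- exists (m + n)%N; apply: USpanL; [apply: uspan_le ma|apply: uspan_le nb].
    exact: leq_addr.
  exact: leq_addl.
- by exists 1%N; rewrite -uword0; apply: USpanU; rewrite expo_at0.
- by exists m; apply: uspan_x.
- by exists m.+1; apply: uspan_h.
Qed.

Lemma uword_span (P : A -> Prop) : P 0 ->
    (forall (k : K) a b, P a -> P b -> P (k *: a + b)) -> (forall e, P (uword e)) ->
  forall a, P a.
Proof.
move=> P0 PL PU a; have [m] := uspan_all a.
by elim=> [|k b b' _ Pb _ Pb'|e _] //; apply: PL.
Qed.

(** Each step of [h] past a letter [x l] creates a term with [x l.+1] in place of
    the two. *)
Lemma reorder m (e : E) : uspan m (h ^+ m * M e - M e * h ^+ m).
Proof.
elim: m => [|m IH]; first by rewrite expr0 mul1r mulr1 subrr; apply: USpan0.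
have -> : h ^+ m.+1 * M e - M e * h ^+ m.+1 =
    h * (h ^+ m * M e - M e * h ^+ m) - (M e * h - h * M e) * h ^+ m.
  by rewrite mulrBr mulrBl !exprS !mulrA opprB addrA subrK.
by apply: uspanB; [apply: uspan_h|apply: uspan_comm].
Qed.

Inductive vspan : A -> Prop :=
| VSpan0 : vspan 0
| VSpanL (k : K) a b : vspan a -> vspan b -> vspan (k *: a + b)
| VSpanV e : vspan (vword e).

Lemma vspan_h a : vspan a -> vspan (h * a).
Proof.
elim=> [|k b b' _ IH _ IH'|e].
- by rewrite mulr0; apply: VSpan0.
- by rewrite mulrDr -scalerAr; apply: VSpanL.
- by rewrite -vword_raise_q; apply: VSpanV.
Qed.

Lemma vspan_x_word k b (e : E) : vspan (x k * (h ^+ b * M e)).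
Proof.
elim: b k => [|b IH] k.
  have [kq|qk] := ltnP k q; last by rewrite x0 // mul0r; apply: VSpan0.
  rewrite expr0 mul1r x_mon -[M e]mul1r -(expr0 h) vword_set -vword_raise //.
  exact: VSpanV.
rewrite exprS !mulrA (commute_letter xh) !mulrDl -!mulrA -[X in X + _]scale1r.
by apply: VSpanL => //; apply: vspan_h.
Qed.

Lemma vspan_all a : vspan a.
Proof.
apply: (gen (P := vspan)) a => [|k a b||a va|a].
- exact: VSpan0.
- exact: VSpanL.
- by rewrite -vword0; apply: VSpanV.
- elim: va => [|k b b' _ IH _ IH'|e]; last exact: vspan_x_word.
    by rewrite mulr0; apply: VSpan0.
  by rewrite mulrDr -scalerAr; apply: VSpanL.
- exact: vspan_h.
Qed.

Lemma vword_span (P : A -> Prop) : P 0 ->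
    (forall (k : K) a b, P a -> P b -> P (k *: a + b)) -> (forall e, P (vword e)) ->
  forall a, P a.
Proof.
move=> P0 PL PV a.
by elim: (vspan_all a) => [|k b b' _ Pb _ Pb'|e] //; apply: PL.
Qed.

(** ** Central powers *)

Lemma p_prime : prime p. Proof. exact: pcharf_prime charKp. Qed.

Lemma mulrn_p (a : A) m : (p %| m)%N -> a *+ m = 0.
Proof.
move=> /dvdnP[t ->].
have ap : a *+ p = 0 by rewrite -[a *+ p]scaler_nat (pcharf0 charKp) scale0r.
by rewrite mulnC mulrnA ap mul0rn.
Qed.

Definition cpower i := letter_at i ^+ N i.

(** [[x_k, h^m] = x_(k+p) ... = 0] and [[x_k^m, h] = m x_k^(m-1) x_(k+1) = 0]
    when [p] divides [m]. *)
Lemma cpower_central i a : cpower i * a = a * cpower i.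
Proof.
have hN k : x k * h ^+ N i = h ^+ N i * x k.
  apply: (commute_expr_dvd xh _ p_prime _ _ (p_dvd_N i)) => [b|l].
    by rewrite mulrn_p.
  by rewrite x0 // pq -addSnnS leq_addl.
have xN k : x k ^+ N i * h = h * x k ^+ N i.
  by rewrite (expr_commute_letter xh) // mulrn_p // addr0.
apply: (@gen (fun a => cpower i * a = a * cpower i)).
- by rewrite mulr0 mul0r.
- by move=> k b b' bE b'E; rewrite mulrDr mulrDl -scalerAr -scalerAl bE b'E.
- by rewrite mulr1 mul1r.
- move=> b bE; rewrite -mulrA -bE !mulrA; congr (_ * _).
  rewrite /cpower /letter_at; case: ifP => _; last by rewrite hN.
  by apply/esym/commrX/xC.
- move=> b bE; rewrite -mulrA -bE !mulrA; congr (_ * _).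
  rewrite /cpower /letter_at; case: ifP => _; first exact: xN.
  by rewrite -exprS -exprSr.
Qed.

Lemma cpower_word i (e : E) (w : E -> A) : w = uword \/ w = vword ->
    (i < q.+1)%N -> (N i <= expo_at e i)%N ->
  w e = cpower i * w (set_coord i (expo_at e i - N i) e).
Proof.
move=> wE id Ne; set e' := set_coord _ _ _.
have eE : e = iter (N i) (raise i) e'.
  have it m : iter m (raise i) e' = set_coord i (expo_at e' i + m) e'.
    elim: m => [|m IH] /=; first by rewrite addn0 set_coordK.
    by rewrite IH /raise expo_at_set // eqxx set_set addnS.
  by rewrite it /e' expo_at_set // eqxx set_set subnK // set_coordK.
rewrite {1}eE /cpower /letter_at; case: wE => ->; case: ifP => iq.
- elim: (N i) => [|m IH]; first by rewrite expr0 mul1r.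
  by rewrite iterS uword_raise // IH mulrA -exprS.
- have iq' : i = q by apply/eqP; rewrite eqn_leq -ltnS id leqNgt iq.
  have -> : h ^+ N i * uword e' = uword e' * h ^+ N i.
    by have := cpower_central i (uword e'); rewrite /cpower /letter_at iq.
  elim: (N i) => [|m IH]; first by rewrite expr0 mulr1.
  by rewrite iterS {1}iq' uword_raise_q IH exprSr mulrA.
- have -> : x i ^+ N i * vword e' = vword e' * x i ^+ N i.
    by have := cpower_central i (vword e'); rewrite /cpower /letter_at iq.
  elim: (N i) => [|m IH]; first by rewrite expr0 mulr1.
  by rewrite iterS vword_raise // IH exprSr mulrA.
- have iq' : i = q by apply/eqP; rewrite eqn_leq -ltnS id leqNgt iq.
  elim: (N i) => [|m IH]; first by rewrite expr0 mul1r.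
  by rewrite iterS {1}iq' vword_raise_q IH exprS mulrA.
Qed.

(** ** The polynomial subalgebra *)

Variables (d : nat) (free : nat -> nat).
Hypothesis free_lt : forall l, (l < d)%N -> (free l < q.+1)%N.
Hypothesis freeP : forall i, (i < q.+1)%N -> ~~ I i -> exists2 l, (l < d)%N & free l = i.

Local Notation C := (polynomials K d).

(** The variables of the central polynomial ring. *)
Definition yvar l : A := if (l < d)%N then cpower (free l) else 1.

Lemma yvarC l a : yvar l * a = a * yvar l.
Proof.
by rewrite /yvar; case: ifP => _; [apply: cpower_central|rewrite mul1r mulr1].
Qed.

Definition phi : {linear C -> A} := malg_ext (mon yvar : expo d -> A).

Lemma phi_one : phi (ps_one C) = 1.
Proof. by apply: (etrans (malg_extU _ _)); rewrite mon0. Qed.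

Lemma phi_var_lt l (w : C) : (l < d)%N -> phi (ps_var C l w) = yvar l * phi w.
Proof.
move=> ld; elim/malg_ind: w => [|k a b aE bE|e].
- by rewrite !linear0 mulr0.
- by rewrite !linearP aE bE mulrDr scalerAr.
- have -> : ps_var C l << e >> = << raise l e >>.
    by apply: (etrans (copU _ _ ld)); apply: scale1r.
  have phiU e' : phi << e' >> = mon yvar e' by apply: malg_extU.
  by rewrite !phiU mon_raise // => i j; apply: yvarC.
Qed.

Lemma ps_var_out l (w : C) : (d <= l)%N -> ps_var C l w = w.
Proof.
move=> dl; apply: (etrans _ (wshift_id w)); apply: wshift_eq => e; left.
by rewrite /lift_coord ltnNge dl.
Qed.

Lemma phi_var l (w : C) : phi (ps_var C l w) = phi (ps_var C l (ps_one C)) * phi w.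
Proof.
have [ld|dl] := ltnP l d; last by rewrite !ps_var_out // phi_one mul1r.
by rewrite !phi_var_lt // phi_one mulr1.
Qed.

Lemma phi_central (w : C) a : phi w * a = a * phi w.
Proof.
elim/ps_ind: w => [|k b b' bE b'E||l b ld bE].
- by rewrite linear0 mul0r mulr0.
- by rewrite linearP mulrDl mulrDr -scalerAl -scalerAr bE b'E.
- by rewrite phi_one mul1r mulr1.
- by rewrite phi_var_lt // -mulrA bE mulrA yvarC mulrA.
Qed.

Local Notation residues := {dffun forall i : 'I_q.+1, 'I_(N i)}.
Definition residue_expo (r : residues) : E := [ffun i : 'I_q.+1 => r i : nat].
Definition dual_expo (r : residues) : E := [ffun i : 'I_q.+1 => ((N i).-1 - r i)%N].

Lemma residue_expo_onto (e : E) : (forall i, e i < N i)%N -> exists r, residue_expo r = e.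
Proof.
move=> eN; exists [ffun i : 'I_q.+1 => Ordinal (eN i)].
by apply/ffunP => i; rewrite !ffunE.
Qed.

Lemma dual_expo_onto (e : E) : (forall i, e i < N i)%N -> exists r, dual_expo r = e.
Proof.
move=> eN; have dN (i : 'I_q.+1) : ((N i).-1 - e i < N i)%N.
  by apply: leq_ltn_trans (leq_subr _ _) _; rewrite prednK.
exists [ffun i : 'I_q.+1 => Ordinal (dN i)].
by apply/ffunP => i; rewrite !ffunE subKn // -ltnS prednK.
Qed.

(** The powers [cpower i] reduce exponents, and are scalars or variables. *)
Lemma residue_span (w : E -> A) (wr : residues -> A) : w = uword \/ w = vword ->
    (forall P : A -> Prop, P 0 -> (forall (k : K) a b, P a -> P b -> P (k *: a + b)) ->
      (forall e, P (w e)) -> forall a, P a) ->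
    (forall e : E, (forall i, e i < N i)%N -> exists r, w e = wr r) ->
  forall a, exists f : residues -> C, a = \sum_r phi (f r) * wr r.
Proof.
move=> wE wspan wred.
pose P a := exists f : residues -> C, a = \sum_r phi (f r) * wr r.
have PL (k : K) a b : P a -> P b -> P (k *: a + b).
  move=> [f ->] [g ->]; exists (fun r => k *: f r + g r).
  rewrite scaler_sumr -big_split; apply: eq_bigr => r _ /=.
  by rewrite linearP mulrDl scalerAl.
have P0 : P 0 by exists (fun _ => 0); rewrite big1 // => r _; rewrite linear0 mul0r.
have PY l a : (l < d)%N -> P a -> P (yvar l * a).
  move=> ld [f ->]; exists (fun r => ps_var C l (f r)).
  by rewrite mulr_sumr; apply: eq_bigr => r _; rewrite phi_var_lt // mulrA.
apply: (wspan P) => // e; have [n] := ubnP (\sum_i e i)%N; elim: n e => // n IH e le.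
have [i iN|eN] := pickP (fun i : 'I_q.+1 => N i <= e i)%N; last first.
  have [i|r ->] := wred e; first by rewrite ltnNge eN.
  exists (fun r' => if r' == r then ps_one C else 0).
  rewrite (bigD1 r) //= eqxx phi_one mul1r big1 ?addr0 // => r' /negPf ->.
  by rewrite linear0 mul0r.
rewrite -expo_atE in iN; rewrite (cpower_word wE (ltn_ord i) iN).
set e' := set_coord _ _ _; have Pe' : P (w e').
  apply: IH; rewrite -ltnS; apply: leq_trans le; rewrite ltnS.
  rewrite (bigD1 i) //= [X in (_ < X)%N](bigD1 i) //= ffunE eqxx expo_atE.
  rewrite (eq_bigr e) => [|j ji]; last by rewrite ffunE (inj_eq val_inj) (negPf ji).
  rewrite expo_atE in iN.
  by rewrite ltn_add2r ltn_subrL N_gt0 (leq_trans _ iN).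
have [Ii|/(freeP (ltn_ord i))[l ld fl]] := boolP (I i).
  by rewrite /cpower order // mulr_algl -[_ *: _]addr0; apply: PL.
by have := PY l _ ld Pe'; rewrite /yvar ld fl.
Qed.

(** ** The Frobenius form *)

Variables (V : lmodType K) (one : V) (mop : nat -> {linear V -> V}) (hop : V -> V).
Variables (Phi : {linear A -> V}) (lamV : {linear V -> C}).
Hypothesis mopC : forall i j v, mop i (mop j v) = mop j (mop i v).
Hypothesis hop_mopq : forall v, hop (mop q v) = mop q (hop v).
Hypothesis hop_one : hop one = mop q one.
Hypothesis Phi_one : Phi 1 = one.
Hypothesis Phi_x : forall k a, (k < q)%N -> Phi (x k * a) = mop k (Phi a).
Hypothesis Phi_h : forall a, Phi (h * a) = hop (Phi a).
Hypothesis q_gt0 : (0 < q)%N.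
Hypothesis lamV_var : forall l v, (l < d)%N ->
  lamV (iter (N (free l)) (mop (free l)) v) = ps_var C l (lamV v).
Hypothesis lamV_zero : forall w : E -> V, w expo0 = one ->
  (forall i e, (i < q.+1)%N -> w (raise i e) = mop i (w e)) ->
  forall i e, (i < q.+1)%N -> ~~ (N i %| (expo_at e i).+1)%N -> lamV (w e) = 0.
Hypothesis lamV_top : forall w : E -> V, w expo0 = one ->
  (forall i e, (i < q.+1)%N -> w (raise i e) = mop i (w e)) ->
  forall e, (forall i, (i < q.+1)%N -> expo_at e i = (N i).-1) ->
  lamV (w e) = ps_one C.
Hypothesis aug_free : forall l, (l < d)%N -> aug A (letter_at (free l)) = 0.

(** Right multiplication by [h] has no derivation term: there is none at [one],
    and the operators of both letters commute with [mop q]. *)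
Lemma Phi_hr a : Phi (a * h) = mop q (Phi a).
Proof.
apply: (gen (P := fun a => Phi (a * h) = mop q (Phi a))) a => [|k a b aE bE||a aE|a aE].
- by rewrite mul0r !linear0.
- by rewrite mulrDl -scalerAl !linearP aE bE.
- by rewrite mul1r -[h]mulr1 Phi_h Phi_one hop_one.
- by rewrite -mulrA !Phi_x // aE mopC.
- by rewrite -mulrA !Phi_h aE hop_mopq.
Qed.

Lemma Phi_raise i (e : E) : (i < q.+1)%N ->
  Phi (uword (raise i e)) = mop i (Phi (uword e)).
Proof.
rewrite ltnS leq_eqVlt => /orP[/eqP->|iq]; first by rewrite uword_raise_q Phi_hr.
by rewrite uword_raise // Phi_x.
Qed.

Fact lam_linear : linear (fun a => lamV (Phi a)).
Proof. by move=> k a b; rewrite !linearP. Qed.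
Definition lam : {linear A -> C} := mklin lam_linear.

Let Phi_uword0 : Phi (uword expo0) = one.
Proof. by rewrite uword0. Qed.

Lemma lam_zero i (e : E) : (i < q.+1)%N -> ~~ (N i %| (expo_at e i).+1)%N ->
  lam (uword e) = 0.
Proof. exact: (lamV_zero (w := fun e => Phi (uword e)) Phi_uword0 Phi_raise). Qed.

Lemma lam_top (e : E) : (forall i, (i < q.+1)%N -> expo_at e i = (N i).-1) ->
  lam (uword e) = ps_one C.
Proof. exact: (lamV_top (w := fun e => Phi (uword e)) Phi_uword0 Phi_raise). Qed.

Lemma lam_var l a : (l < d)%N -> lam (yvar l * a) = ps_var C l (lam a).
Proof.
move=> ld; rewrite -[RHS]lamV_var //; congr (lamV _); rewrite /yvar ld.
have [fq|qf] := ltnP (free l) q.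
  rewrite /cpower /letter_at fq; elim: (N _) => [|m IH]; first by rewrite mul1r.
  by rewrite exprS -mulrA Phi_x // IH.
have fE : free l = q by apply/eqP; rewrite eqn_leq qf andbT -ltnS free_lt.
have Phi_hm m : Phi (a * h ^+ m) = iter m (mop q) (Phi a).
  by elim: m => [|m IH]; rewrite ?mulr1 // exprSr mulrA Phi_hr IH.
by rewrite cpower_central /cpower /letter_at ltnNge qf /= Phi_hm fE.
Qed.

(** The form only sees the words of degree [-1] modulo [N q] in [h]. *)
Lemma lam_uspan t m a : (m < N q)%N -> uspan m a -> lam (a * h ^+ (t * N q)) = 0.
Proof.
move=> mN; elim=> [|k b b' _ IH _ IH'|e em].
- by rewrite mul0r linear0.
- by rewrite mulrDl -scalerAl linearP IH IH' scaler0 addr0.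
have -> : uword e * h ^+ (t * N q) = uword (set_coord q (at_q e + t * N q) e).
  by rewrite -uword_set exprD mulrA.
apply: (@lam_zero q) => //; rewrite expo_at_set // eqxx -addSn.
rewrite dvdn_addl ?dvdn_mull // gtnNdvd //.
exact: leq_ltn_trans em mN.
Qed.

Definition add_expo (e e' : E) : E := [ffun i : 'I_q.+1 => (e i + e' i)%N].

Lemma mon_add (e e' : E) : M e * M e' = M (add_expo e e').
Proof.
elim/expo_ind: e => [|l e ld IH].
  by rewrite mon0 mul1r; congr (M _); apply/ffunP => i; rewrite !ffunE.
rewrite (mon_raise xvarC) // -mulrA IH -(mon_raise xvarC) //; congr (M _).
apply: expo_eq => k kd; have add_at (f g : E) :
    expo_at (add_expo f g) k = (expo_at f k + expo_at g k)%N.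
  by rewrite -[k]/(val (Ordinal kd)) !expo_atE ffunE.
by rewrite expo_at_raise // !add_at expo_at_raise // addnAC.
Qed.

(** Up to words of lower degree in [h], the product is the word with exponents
    [r_i + N_i - 1 - s_i], the one of [h] being [m]. The form kills the words
    of degree less than [N q - 1] in [h]: this settles [r_q < s_q], and also
    [r_q > s_q] after removing the central power [h^(N q)]. If [r_q = s_q] then
    [m = N q - 1], and the form compares the exponents of the other letters. *)
Lemma lam_dual (r s : residues) :
  lam (uword (residue_expo r) * vword (dual_expo s)) = if r == s then ps_one C else 0.
Proof.
set e := residue_expo r; set e' := dual_expo s.
have rq : at_q e = r ord_max by rewrite -[q]/(val (@ord_max q)) expo_atE ffunE.
have sq : at_q e' = ((N q).-1 - s ord_max)%N.
  by rewrite -[q in expo_at _ q]/(val (@ord_max q)) expo_atE ffunE.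
have rN : (r ord_max < N q)%N := ltn_ord (r ord_max).
have sN : (s ord_max < N q)%N := ltn_ord (s ord_max).
set m := (at_q e + at_q e')%N.
have wordE : uword e * vword e' = M e * (h ^+ m * M e').
  by rewrite /uword /vword -mulrA [h ^+ _ * (_ * _)]mulrA -exprD.
have split_word n : M e * (h ^+ n * M e') =
    M (add_expo e e') * h ^+ n + M e * (h ^+ n * M e' - M e' * h ^+ n).
  by rewrite -mon_add mulrBr !mulrA addrC subrK.
have low n : uspan n (M e * (h ^+ n * M e' - M e' * h ^+ n)).
  by apply: uspan_mon; apply: reorder.
have lowS n : uspan n.+1 (M e * (h ^+ n * M e')).
  rewrite split_word; apply: uspanD; last by apply: uspan_le (low n).
  by rewrite uword_set; apply: USpanU; rewrite expo_at_set // eqxx.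
have [lt|gt|eq] := ltngtP (r ord_max) (s ord_max).
- have /negPf -> : r != s by apply: contraTneq lt => ->; rewrite ltnn.
  have := @lam_uspan 0 m.+1 _ _ (lowS m); rewrite mul0n expr0 mulr1 -wordE; apply.
  by rewrite /m rq sq; lia.
- have /negPf -> : r != s by apply: contraTneq gt => ->; rewrite ltnn.
  pose m' := (m - N q)%N; have mE : m = (m' + N q)%N by rewrite /m' /m rq sq; lia.
  have hNc a : h ^+ N q * a = a * h ^+ N q.
    by have := cpower_central q a; rewrite /cpower /letter_at ltnn.
  have -> : uword e * vword e' = M e * (h ^+ m' * M e') * h ^+ (1 * N q).
    by rewrite wordE mE exprD -!mulrA hNc mul1n.
  by apply: (@lam_uspan 1 m'.+1 _ _ (lowS m')); rewrite /m' /m rq sq; lia.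
have mE : m = (N q).-1 by rewrite /m rq sq eq; lia.
rewrite wordE split_word linearD -[X in _ + lam X]mulr1 -(expr0 h) -(mul0n (N q)).
rewrite (@lam_uspan 0 m) // ?addr0; last by rewrite mE prednK.
rewrite uword_set; have [rs|rs] := eqVneq r s.
  apply: lam_top => i id; rewrite expo_at_set //; case: eqP => [->//|_].
  rewrite -[i]/(val (Ordinal id)) expo_atE !ffunE rs /= subnKC //.
  by rewrite -ltnS prednK //; apply: ltn_ord.
have [i ri] : exists i, r i != s i.
  by apply/existsP; rewrite -negb_forall; apply: contra rs => /forallP rs; apply/eqP/ffunP => i; apply/eqP.
apply: (@lam_zero i) => //; rewrite expo_at_set //; case: eqP => [iq|_].
  case/eqP: ri; apply/val_inj => /=.
  have -> : i = ord_max by apply: val_inj.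
  exact: eq.
rewrite expo_atE !ffunE; apply: contra ri => /dvdnP[t tE].
apply/eqP/val_inj => /=; move: tE; have := ltn_ord (r i); have := ltn_ord (s i).
by case: t => [|[|t]] /=; nia.
Qed.

Theorem normal_form_frobenius : frobenius_extension phi lam
  (fun r => uword (residue_expo r)) (fun r => vword (dual_expo r)).
Proof.
split.
- exact: phi_one.
- exact: phi_var.
- exact: phi_central.
- move=> l ld; rewrite phi_var_lt // phi_one mulr1 /yvar ld /cpower rmorphXn /=.
  by rewrite aug_free // expr0n gtn_eqF.
- move=> l a; have [ld|dl] := ltnP l d.
    by rewrite phi_var_lt // phi_one mulr1 lam_var.
  by rewrite !ps_var_out // phi_one mul1r.
- exact: lam_dual.
- apply: (residue_span (w := uword)); [by left|exact: uword_span|].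
  by move=> e /residue_expo_onto[r <-]; exists r.
- apply: (residue_span (w := vword)); [by right|exact: vword_span|].
  by move=> e /dual_expo_onto[r <-]; exists r.
Qed.

End NormalForms.

(** * The Frobenius form on monomials *)

Section TopCoefficient.
Variables (K : fieldType) (n : nat) (N : nat -> nat) (I : pred nat) (c : nat -> K).
Hypothesis N_gt1 : forall i, (1 < N i)%N.

Definition free_seq := [seq i <- iota 0 n | ~~ I i].
Definition free_index l := nth 0%N free_seq l.
Local Notation d := (size free_seq).

Lemma free_index_in l : (l < d)%N -> free_index l \in free_seq.
Proof. exact: mem_nth. Qed.

Lemma free_index_lt l : (l < d)%N -> (free_index l < n)%N.
Proof. by move=> /free_index_in; rewrite mem_filter mem_iota => /andP[_]. Qed.

Lemma free_index_free l : (l < d)%N -> ~~ I (free_index l).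
Proof. by move=> /free_index_in; rewrite mem_filter => /andP[]. Qed.

Lemma free_index_onto i : (i < n)%N -> ~~ I i -> exists2 l, (l < d)%N & free_index l = i.
Proof.
move=> ni nI; have : i \in free_seq by rewrite mem_filter nI mem_iota.
by move=> /(nthP 0%N)[l ld li]; exists l.
Qed.

Lemma free_index_inj l m : (l < d)%N -> (m < d)%N -> free_index l = free_index m -> l = m.
Proof.
move=> ld md /eqP; rewrite nth_uniq ?filter_uniq ?iota_uniq //.
by move/eqP.
Qed.

Local Notation V := ({malg K[expo n]} : lmodType K).
Local Notation C := (polynomials K d).
Local Notation X := (monX N I c).

Definition free_part (e : expo n) : expo d :=
  [ffun l : 'I_d => (expo_at e (free_index l) %/ N (free_index l))%N].
(** The top monomial times powers of the [N i]-th powers of the letters. *)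
Definition is_top (e : expo n) : bool := [forall i : 'I_n, N i %| (expo_at e i).+1]%N.

Definition top_coef : {linear V -> C} :=
  malg_ext (fun e => if is_top e then << free_part e >> : C else 0).

Lemma top_coefU (e : expo n) :
  top_coef << e >> = if is_top e then << free_part e >> : C else 0.
Proof. exact: malg_extU. Qed.

Lemma is_topP (e : expo n) :
  reflect (forall i, (i < n)%N -> (N i %| (expo_at e i).+1)%N) (is_top e).
Proof.
apply: (iffP forallP) => [et i ni|et i]; last exact: et.
exact: (et (Ordinal ni)).
Qed.

Lemma iter_monX_free i m (e : expo n) : (i < n)%N -> ~~ I i ->
  iter m (X i) << e >> = << set_coord i (expo_at e i + m) e >>.
Proof.
move=> ni nI; elim: m => [|m IH]; first by rewrite addn0 set_coordK.
rewrite iterS IH; apply: (etrans (copU _ _ ni)).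
by rewrite /redX (negPf nI) /= scale1r expo_at_set // eqxx set_set addnS.
Qed.

Lemma top_coef_var l (v : V) : (l < d)%N ->
  top_coef (iter (N (free_index l)) (X (free_index l)) v) = ps_var C l (top_coef v).
Proof.
move=> ld; have iter0 m i : iter m (X i) (0 : V) = 0.
  by elim: m => //= m ->; rewrite linear0.
elim/malg_ind: v => [|a g h gE hE|e].
- by rewrite iter0 !linear0.
- by rewrite iter_linear !linearP gE hE.
have fn := free_index_lt ld; have fI := free_index_free ld.
have N0 : (0 < N (free_index l))%N by apply: ltnW.
rewrite (iter_monX_free _ _ fn fI); set e' := set_coord _ _ _.
have -> : top_coef << e' >> = if is_top e' then << free_part e' >> : C else 0.
  exact: top_coefU.
have -> : top_coef << e >> = if is_top e then << free_part e >> : C else 0.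
  exact: top_coefU.
have -> : is_top e' = is_top e.
  apply/is_topP/is_topP => et i ni; have := et i ni; rewrite expo_at_set //.
    by case: eqP => // ->; rewrite -addSn dvdn_addl.
  by case: eqP => // ->; rewrite -addSn dvdn_addl.
case: ifP => _; last by rewrite linear0.
apply: esym; apply: (etrans (copU _ _ ld)); apply: (etrans (scale1r _)).
congr << _ >>; apply: expo_eq => m md.
rewrite expo_at_raise //.
have partE (f : expo n) : expo_at (free_part f) m =
    (expo_at f (free_index m) %/ N (free_index m))%N.
  by rewrite -[m in LHS]/(val (Ordinal md)) expo_atE ffunE.
rewrite !partE expo_at_set //; have [->|ml] := eqVneq m l.
  by rewrite eqxx divnDr // divnn N0.
rewrite addn0; case: eqP => // /free_index_inj ml'.
by case/eqP: ml; apply: ml'.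
Qed.

Section Words.
Variable w : expo n -> V.
Hypothesis w0 : w expo0 = << expo0 >>.
Hypothesis wS : forall i e, (i < n)%N -> w (raise i e) = X i (w e).

(** Reductions preserve the exponents modulo the [N i]. *)
Lemma word_residue (e : expo n) : exists (k : K) (e' : expo n),
  w e = k *: << e' >> /\ forall i, (i < n)%N -> expo_at e' i = expo_at e i %[mod N i].
Proof.
elim/expo_ind: e => [|l e ld [k [e' [wE e'E]]]].
  by exists 1, expo0; rewrite scale1r.
rewrite wS // wE linearZ_LR.
have -> : X l << e' >> = (redX N I c l (expo_at e' l)).1 *:
    << set_coord l (redX N I c l (expo_at e' l)).2 e' >> by apply: copU.
exists (k * (redX N I c l (expo_at e' l)).1).
exists (set_coord l (redX N I c l (expo_at e' l)).2 e'); split; first exact: scalerA.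
move=> i ni; rewrite expo_at_set // expo_at_raise //.
case: eqP => [->|/eqP il]; last by rewrite addn0 e'E.
rewrite -modnDml -e'E // modnDml addn1 /redX.
case: ifP => //= /andP[_ Ne].
by rewrite -[in RHS](subnK (dvdn_leq _ Ne)) // modnDr.
Qed.

Lemma top_coef_zero i e : (i < n)%N -> ~~ (N i %| (expo_at e i).+1)%N ->
  top_coef (w e) = 0.
Proof.
move=> ni nN; have [k [e' [-> e'E]]] := word_residue e.
rewrite linearZ_LR; have -> : top_coef << e' >> = 0; last by rewrite scaler0.
apply: (etrans (top_coefU e')); case: is_topP => // /(_ i ni).
have /eqP := e'E i ni; rewrite -(eqn_modDr 1) !addn1 => /eqP E.
by rewrite /dvdn E -/(dvdn _ _) (negPf nN).
Qed.

Lemma word_reduced (e : expo n) : (forall i, (i < n)%N -> (expo_at e i < N i)%N) ->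
  w e = << e >>.
Proof.
elim/expo_ind: e => [//|l e ld IH] eN.
have eN' i : (i < n)%N -> (expo_at e i < N i)%N.
  by move=> /eN; apply: leq_ltn_trans; rewrite expo_at_raise // leq_addr.
rewrite wS // IH //; apply: monX_mono => //.
by have := eN l ld; rewrite expo_at_raise // eqxx addn1.
Qed.

Lemma top_coef_top e : (forall i, (i < n)%N -> expo_at e i = (N i).-1) ->
  top_coef (w e) = ps_one C.
Proof.
move=> eN; rewrite word_reduced => [|i ni]; last by rewrite eN // prednK // ltnW.
apply: (etrans (top_coefU e)); have -> : is_top e.
  by apply/is_topP => i ni; rewrite eN // prednK // ltnW.
congr << _ >>; apply/ffunP => l; rewrite !ffunE eN; last exact: free_index_lt.
by rewrite divn_small // prednK // ltnW.
Qed.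

End Words.
End TopCoefficient.

(** * The free algebra *)

Section FreeAlgebra.
Variable K : fieldType.
Local Notation F := (free_augAlg K).
Local Notation g := (letter K lg).
Local Notation h := (letter K lh).

Lemma monomial_mul (m m' : {fmonom bool}) :
  (<< m >> * << m' >> : {malg K[{fmonom bool}]}) = << mmul m m' >>.
Proof.
rewrite malgME !msuppU1 !big_seq_fset1 !mcoeffU !eqxx.
by rewrite !mulr1n mulr1.
Qed.

Lemma letter_mul c (s : seq bool) :
  letter K c * (<< FMonom s >> : free_alg K) = << FMonom (c :: s) >> :> F.
Proof.
apply: (etrans (monomial_mul _ _)); congr << _ >>.
by apply/eqP; rewrite fmP fmM.
Qed.

Lemma monomial_nil : (<< FMonom [::] >> : F) = 1.
Proof.
suff -> : FMonom [::] = mone :> {fmonom bool} by [].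
by apply/eqP; rewrite fmP fm1.
Qed.

Lemma free_alg_ind (P : F -> Prop) : P 0 ->
    (forall (k : K) a b, P a -> P b -> P (k *: a + b)) -> P 1 ->
    (forall c a, P a -> P (letter K c * a)) ->
  forall a, P a.
Proof.
move=> P0 PL P1 PX; apply: malg_ind => // -[s]; elim: s => [|c s IH].
  by rewrite monomial_nil.
by rewrite -letter_mul; apply: PX.
Qed.

Section Action.
Variables (V : lmodType K) (op : bool -> {linear V -> V}).

Definition act_word (m : {fmonom bool}) (v : V) : V :=
  foldr (fun c w => op c w) v (m : seq bool).

Definition act (v : V) : {linear F -> V} :=
  malg_ext (fun m => act_word m v).

Lemma act_wordU v (s : seq bool) : act v << FMonom s >> = foldr (fun c w => op c w) v s.
Proof. exact: malg_extU. Qed.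

Lemma act_one v : act v 1 = v.
Proof. by rewrite -monomial_nil act_wordU. Qed.

Lemma act_letter v c a : act v (letter K c * a) = op c (act v a).
Proof.
have mulL : linear (fun a : F => letter K c * a).
  by move=> k b b'; rewrite mulrDr scalerAr.
apply: (@malg_linear_eq _ _ _ (act v \o mklin mulL) (op c \o act v)) => -[s].
apply: (etrans (congr1 (act v) (letter_mul c s))).
by apply: (etrans (act_wordU _ _)); congr (op c _); rewrite act_wordU.
Qed.

End Action.
End FreeAlgebra.

(** ** Actions of an algebra generated by two letters *)

Section WordAction.
Variables (K : fieldType) (F : algType K) (X : bool -> F).
Hypothesis F_ind : forall P : F -> Prop, P 0 ->
  (forall (k : K) a b, P a -> P b -> P (k *: a + b)) -> P 1 ->
  (forall c a, P a -> P (X c * a)) -> forall a, P a.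
Variables (V : lmodType K) (op : bool -> {linear V -> V}).
Variable act : V -> {linear F -> V}.
Hypothesis act_one : forall v, act v 1 = v.
Hypothesis act_letter : forall v c a, act v (X c * a) = op c (act v a).

Lemma act_mul v a b : act v (a * b) = act (act v b) a.
Proof.
elim/F_ind: a => [|k a a' aE aE'||c a aE].
- by rewrite mul0r !linear0.
- by rewrite mulrDl -scalerAl !linearP aE aE'.
- by rewrite mul1r act_one.
- by rewrite -mulrA !act_letter aE.
Qed.

Lemma act_linear a (k : K) v w : act (k *: v + w) a = k *: act v a + act w a.
Proof.
elim/F_ind: a => [|l a b aE bE||c a aE].
- by rewrite !linear0 addr0.
- by rewrite !linearP aE bE !scalerDr !scalerA mulrC addrACA.
- by rewrite !act_one.
- by rewrite !act_letter aE linearP.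
Qed.

Lemma act0 a : act 0 a = 0.
Proof. by have := act_linear a (-1) 0 0; rewrite scaler0 addr0 scaleN1r addNr. Qed.

Lemma act_letter1 v c : act v (X c) = op c v.
Proof. by rewrite -[X c]mulr1 act_letter act_one. Qed.

Lemma act_commutator v a b :
  act v (commutator a b) = act (act v b) a - act (act v a) b.
Proof. by rewrite linearB !act_mul. Qed.

Lemma act_expr v a m : act v (a ^+ m) = iter m (fun w => act w a) v.
Proof. by elim: m => [|m IH]; rewrite ?act_one // exprS act_mul IH. Qed.

(** The letter [h] acts by [hop], the iterated brackets of the two letters by
    the commuting operators [xop k]. *)
Variables (hop : {linear V -> V}) (xop : nat -> {linear V -> V}).
Hypothesis op_h : forall v, op lh v = hop v.
Hypothesis op_g : forall v, op lg v = xop 0 v.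
Hypothesis xop_hop : forall k v, xop k (hop v) - hop (xop k v) = xop k.+1 v.
Hypothesis xopC : forall k l v, xop k (xop l v) = xop l (xop k v).

(** Up to a scalar, the bracketing of a word acts as [hop], as some [xop k], or
    as zero according to the number of letters [g] it contains. *)
Definition acts_by_count (m : nat) (a : F) : Prop :=
  match m with
  | 0 => exists s : K, forall v, act v a = s *: hop v
  | 1 => exists (s : K) k, forall v, act v a = s *: xop k v
  | _ => forall v, act v a = 0
  end.

Lemma acts_by_count_commutator m n a b :
  acts_by_count m a -> acts_by_count n b -> acts_by_count (m + n) (commutator a b).
Proof.
have zero_l a' b' : (forall v, act v a' = 0) -> forall v, act v (commutator a' b') = 0.
  by move=> a0 v; rewrite act_commutator !a0 act0 subr0.
have zero_r a' b' : (forall v, act v b' = 0) -> forall v, act v (commutator a' b') = 0.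
  by move=> b0 v; rewrite act_commutator !b0 act0 subr0.
have hopZ k v : hop (k *: v) = k *: hop v by apply: linearZ_LR.
have xopZ l k v : xop l (k *: v) = k *: xop l v by apply: linearZ_LR.
case: m => [|[|m]]; case: n => [|[|n]] //=; rewrite ?addn0 ?addnS ?addSn /=.
- move=> [s aE] [t bE]; exists 0 => v; rewrite act_commutator !(aE, bE).
  by rewrite !(hopZ, xopZ) !scalerA mulrC subrr scale0r.
- move=> [s aE] [t [k bE]]; exists (- (s * t)), k.+1 => v.
  rewrite act_commutator !(aE, bE) !(hopZ, xopZ) !scalerA [t * s]mulrC -scalerBr.
  by rewrite -opprB xop_hop scalerN scaleNr.
- by move=> _ b0; apply: zero_r.
- move=> [s [k aE]] [t bE]; exists (s * t), k.+1 => v.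
  rewrite act_commutator !(aE, bE) !(hopZ, xopZ) !scalerA [t * s]mulrC -scalerBr.
  by rewrite xop_hop.
- move=> [s [k aE]] [t [l bE]] v.
  rewrite act_commutator !(aE, bE) !(hopZ, xopZ) !scalerA [t * s]mulrC xopC.
  by rewrite subrr.
- by move=> _ b0; apply: zero_r.
- by move=> a0 _; apply: zero_l.
- by move=> a0 _; apply: zero_l.
- by move=> a0 _; apply: zero_l.
Qed.

Lemma acts_by_count_bracket w : acts_by_count (count_mem lg w) (bracket X w).
Proof.
have [n] := ubnP (size w); elim: n w => // n IH [|c [|c' w]] len.
- by exists 0 => v; rewrite linear0 scale0r.
- rewrite bracket_letter; case: c len => _ /=.
    by exists 1 => v; rewrite act_letter1 op_h scale1r.
  by exists 1, 0%N => v; rewrite act_letter1 op_g scale1r.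
set u := [:: c, c' & w] in len *; have u2 : (1 < size u)%N by [].
have /andP[cut0 cutu] := std_cut_bounds u2.
rewrite bracket_standard // -{1}(cat_take_drop (std_cut u) u) count_cat.
apply: acts_by_count_commutator; apply: IH.
  by rewrite size_takel ?(ltnW cutu) //; apply: leq_trans cutu _.
rewrite size_drop; apply: leq_trans (_ : size u <= n)%N => //.
by rewrite ltn_subrL cut0.
Qed.

End WordAction.

(** * Lyndon words with at most two letters [g] *)

Lemma lyndonP (w : word) : w != [::] ->
  (forall r, (0 < r < size w)%N -> (w < rot r w :> seqlexi bool)%O) -> lyndon w.
Proof.
move=> w0 lt; rewrite /lyndon w0; apply/allP => r; rewrite mem_iota => /andP[r0 r1].
apply: lt; rewrite r0 /=; move: r1; rewrite add1n prednK //.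
by case: (w) w0.
Qed.

Lemma lyndon_rot (w : word) r : lyndon w -> (0 < r < size w)%N ->
  (w < rot r w :> seqlexi bool)%O.
Proof.
move=> /andP[w0 /allP lt] /andP[r0 rw]; apply: lt; rewrite mem_iota r0 add1n prednK //.
exact: leq_trans rw.
Qed.

Lemma rot_lh_gt (u : word) r : nth lg (lg :: u) r = lh -> (r < size (lg :: u))%N ->
  (lg :: u < rot r (lg :: u) :> seqlexi bool)%O.
Proof. by move=> nr rw; rewrite /rot (drop_nth lg) // nr. Qed.

(** A word larger than one beginning with [h] begins with [h]. If the first letter
    is [h], all the letters are thus [h], and all rotations are equal. *)
Lemma lyndon_lh (u : word) : lyndon (lh :: u) -> u = [::].
Proof.
case: u => // b u lw; exfalso; set w := [:: lh, b & u] in lw.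
have wN r : (0 < r < size w)%N -> nth lg w r = lh.
  move=> rw; have := lyndon_rot lw rw; case/andP: rw => _ rw.
  by rewrite /rot (drop_nth lg) //; case: (nth lg w r).
have wE : w = nseq (size w) lh.
  apply: (@eq_from_nth _ lg) => [|[|r] rw]; first by rewrite size_nseq.
    by rewrite nth_nseq rw.
  by rewrite wN // nth_nseq rw.
have := lyndon_rot lw (isT : (0 < 1 < size w)%N).
suff -> : rot 1 w = w by rewrite Order.POrderTheory.ltxx.
have rotn m : rot 1 (nseq m.+1 lh) = nseq m.+1 lh.
  by rewrite /= rot1_cons -[RHS]/(nseq m.+1 lh) -addn1 nseqD cats1.
by rewrite wE; apply: rotn.
Qed.

Lemma lyndon_omega k : lyndon (omega k).
Proof.
apply: lyndonP => // -[|r] //; rewrite /= size_nseq ltnS => rk.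
by apply: rot_lh_gt; rewrite /= ?nth_nseq ?size_nseq ?rk.
Qed.

Lemma nseq_lh_lt i j (s t : word) : (i < j)%N ->
  (nseq i lh ++ lg :: s < nseq j lh ++ t :> seqlexi bool)%O.
Proof.
elim: i j => [|i IH] [|j] //= ij.
by rewrite Order.SeqLexiOrder.eqhead_ltxiE; apply: IH.
Qed.

(** A rotation beginning with [h] is larger; the only other one begins with the
    longer block [g h^j]. *)
Lemma lyndon_omega2 i j : (i < j)%N -> lyndon (omega i ++ omega j).
Proof.
move=> ij; apply: lyndonP => // r; rewrite size_cat /= !size_nseq => /andP[r0 rw].
have [->|ri] := eqVneq r i.+1.
  have -> : i.+1 = size (omega i) by rewrite /= size_nseq.
  rewrite rot_size_cat /= Order.SeqLexiOrder.eqhead_ltxiE.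
  exact: nseq_lh_lt.
apply: rot_lh_gt; last by rewrite /= size_cat /= !size_nseq.
case: r r0 rw ri => // r _ /= rw ri.
rewrite nth_cat size_nseq nth_nseq; have [//|ir] := ltnP r i.
have -> : (r - i = (r - i.+1).+1)%N by lia.
by rewrite /= nth_nseq ifT //; lia.
Qed.

(** The right factors cut out before [m] begin with [h] and have length at least
    two, so that none of them is Lyndon. *)
Lemma std_cut_eq (w : word) m : (0 < m < size w)%N ->
    lyndon (take m w) -> lyndon (drop m w) ->
    (forall i, (0 < i < m)%N -> nth lg w i = lh) -> std_cut w = m.
Proof.
move=> /andP[m0 mw] lt ld below; rewrite /std_cut.
have -> : iota 1 (size w).-1 = iota 1 m.-1 ++ m :: iota m.+1 (size w - m.+1).
  have -> : ((size w).-1 = m.-1 + (size w - m.+1).+1)%N by lia.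
  by rewrite iotaD add1n prednK.
rewrite filter_cat (@eq_in_filter _ _ pred0) ?filter_pred0 /= ?lt ?ld //.
move=> i; rewrite mem_iota add1n prednK // => im; apply/negP => /andP[_].
have iw : (i < size w)%N by case/andP: im => _ /ltn_trans; apply.
rewrite (drop_nth lg) // below // => /lyndon_lh /(congr1 size).
rewrite size_drop /=; case/andP: im => _ im; apply/eqP.
by rewrite -lt0n subn_gt0; apply: leq_trans mw.
Qed.

Section Bracketing.
Variables (R : nzRingType) (x : bool -> R).

Lemma bracket_omega0 : bracket x (omega 0) = x lg.
Proof. by []. Qed.

Lemma bracket_omegaS k :
  bracket x (omega k.+1) = bracket x (omega k) * x lh - x lh * bracket x (omega k).
Proof.
have szk : size (omega k) = k.+1 by rewrite /= size_nseq.
have catE : omega k.+1 = omega k ++ [:: lh] by rewrite /omega -(addn1 k) nseqD.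
rewrite bracket_standard; last by rewrite /= size_nseq.
rewrite (@std_cut_eq _ k.+1).
- by rewrite catE take_size_cat ?drop_size_cat.
- by rewrite /= size_nseq !ltnS leqnn.
- by rewrite catE take_size_cat // lyndon_omega.
- by rewrite catE drop_size_cat.
- by move=> [|i] // /andP[_ ik]; rewrite -[LHS]/(nth lg (nseq k.+1 lh) i) nth_nseq ltnW.
Qed.

Lemma bracket_omega2 i j : (i < j)%N -> bracket x (omega i ++ omega j) =
  bracket x (omega i) * bracket x (omega j) - bracket x (omega j) * bracket x (omega i).
Proof.
move=> ij; have szi : size (omega i) = i.+1 by rewrite /= size_nseq.
rewrite bracket_standard; last by rewrite size_cat szi /= addnS ltnS.
rewrite (@std_cut_eq _ i.+1).
- by rewrite take_size_cat ?drop_size_cat.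
- by rewrite size_cat szi /= -[X in (X < _)%N]addn0 ltn_add2l.
- by rewrite take_size_cat // lyndon_omega.
- by rewrite drop_size_cat // lyndon_omega.
- move=> [|r] // /andP[_ ri]; rewrite nth_cat szi ri /= nth_nseq.
  by rewrite -ltnS ri.
Qed.

End Bracketing.

(** * Presented quotients of the free algebra *)

Section Presentation.
Variables (K : fieldType) (F : augAlg K) (kill : F -> Prop).
Hypothesis kill0 : kill 0.
Hypothesis killD : forall a b, kill a -> kill b -> kill (a + b).
Hypothesis killM : forall a s b, kill s -> kill (a * s * b).

(** [B] is a quotient of [F] by an ideal that is contained in [kill]. *)
Record presents (B : augAlg K) (pi : F -> B) : Prop := Presents {
  pres_linear : linear pi;
  pres_one : pi 1 = 1;
  pres_mul : forall a b, pi (a * b) = pi a * pi b;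
  pres_onto : forall y, exists a, pi a = y;
  pres_aug : forall a, aug B (pi a) = aug F a;
  pres_kill : forall a, pi a = 0 -> kill a }.

Lemma presents_id : presents (fun a => a).
Proof. by split=> // [y|a ->]; [exists y|]. Qed.

Section Linear.
Variables (B : augAlg K) (pi : F -> B).
Hypothesis piP : presents pi.

Lemma pres_add a b : pi (a + b) = pi a + pi b.
Proof. exact: (linearD (mklin (pres_linear piP))). Qed.

Lemma pres_sub a b : pi (a - b) = pi a - pi b.
Proof. exact: (linearB (mklin (pres_linear piP))). Qed.

Lemma pres_zero : pi 0 = 0.
Proof. exact: (linear0 (mklin (pres_linear piP))). Qed.

Lemma pres_scale k a : pi (k *: a) = k *: pi a.
Proof. exact: (linearZ_LR (mklin (pres_linear piP))). Qed.

Lemma pres_exp a m : pi (a ^+ m) = pi a ^+ m.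
Proof.
by elim: m => [|m IH]; rewrite ?(pres_one piP) // !exprS (pres_mul piP) IH.
Qed.

Variables (S : B -> Prop) (augS : forall x, S x -> aug B x = 0).

Lemma quotient_map0 : quotient_map augS 0 = 0.
Proof. exact: raddf0 (\pi_(quotient_sort augS)%qT : B -> quotient_sort augS). Qed.

Lemma quotient_map_rel x : S x -> quotient_map augS x = 0.
Proof.
move=> Sx; rewrite -quotient_map0; apply/quotient_eqP; rewrite subr0.
by rewrite -[x]mulr1 -[x in x * _]mul1r; apply: IdealGenM.
Qed.

(** Killing relations that are already in [kill] keeps the ideal inside. *)
Lemma presents_quotient : (forall y, S y -> exists2 a, kill a & y = pi a) ->
  presents (fun a => quotient_map augS (pi a)).
Proof.
move=> killS; split.
- move=> k a b; rewrite pres_add pres_scale.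
  by apply: (etrans (quotient_piD _ _ _)); congr (_ + _); apply: quotient_piZ.
- by rewrite (pres_one piP).
- by move=> a b; rewrite (pres_mul piP); apply: quotient_piM.
- by elim/quotient_ind => y; have [a <-] := pres_onto piP y; exists a.
- by move=> a; rewrite aug_quotient_map (pres_aug piP).
have lift y : ideal_gen S y -> exists2 a, pi a = y & kill a.
  elim=> [|u v _ [a <- ka] _ [b <- kb]|u s v Ss].
  - by exists 0; [exact: pres_zero|].
  - by exists (a + b); [exact: pres_add|exact: killD].
  - have [a aE] := pres_onto piP u; have [b kb ->] := killS _ Ss.
    have [c cE] := pres_onto piP v; exists (a * b * c); last exact: killM.
    by rewrite !(pres_mul piP) aE cE.
move=> a; rewrite -quotient_map0 => /quotient_eqP; rewrite subr0 => /lift[b bE kb].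
rewrite -[a](subrK b) addrC; apply: killD => //.
by apply: (pres_kill piP); rewrite pres_sub bE subrr.
Qed.

End Linear.
End Presentation.

(** * The ideal killed by the representation *)

Section Killing.
Variables (K : fieldType) (F : augAlg K) (X : bool -> F).
Hypothesis F_ind : forall P : F -> Prop, P 0 ->
  (forall (k : K) a b, P a -> P b -> P (k *: a + b)) -> P 1 ->
  (forall c a, P a -> P (X c * a)) -> forall a, P a.
Variables (V : lmodType K) (p q : nat) (one : V).
Hypothesis charKp : p \in [pchar K].
Hypothesis pq : p = q.+1.
Hypothesis q_gt0 : (0 < q)%N.
Variables mop dop : nat -> {linear V -> V}.
Hypothesis dop_mop : forall i v, (i < q.+1)%N -> dop i (mop i v) = mop i (dop i v) + v.
Hypothesis mopC : forall i j v, mop i (mop j v) = mop j (mop i v).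
Hypothesis dop_mopC : forall i j v, i != j -> dop i (mop j v) = mop j (dop i v).
Hypothesis dop_one : forall i, (i < q.+1)%N -> dop i one = 0.

Local Notation H := (hop q mop dop).
Local Notation R := (reach q one mop).
Local Notation x k := (bracket X (omega k)).
Local Notation h := (X lh).

Definition letter_op (c : bool) : {linear V -> V} := if c then H else mop 0.

Variable act : V -> {linear F -> V}.
Hypothesis act_one : forall v, act v 1 = v.
Hypothesis act_letter : forall v c a, act v (X c * a) = letter_op c (act v a).

Let actM := act_mul F_ind act_one act_letter.
Let act_0 := act0 F_ind act_one act_letter.
Let xop_comm := xop_hop dop_mop mopC dop_mopC.

Definition kill (a : F) : Prop := forall v, R v -> act v a = 0.

Lemma reach_act v a : R v -> R (act v a).
Proof.
move=> Rv; elim/F_ind: a => [|k a b Ra Rb||c a Ra].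
- by rewrite linear0; apply: Reach0.
- by rewrite linearP; apply: ReachL.
- by rewrite act_one.
- rewrite act_letter; case: c; first exact: reach_hop.
  exact: ReachX.
Qed.

Lemma kill_zero : kill 0.
Proof. by move=> v _; rewrite linear0. Qed.

Lemma kill_add a b : kill a -> kill b -> kill (a + b).
Proof. by move=> ka kb v Rv; rewrite linearD ka // kb // addr0. Qed.

Lemma kill_mul a s b : kill s -> kill (a * s * b).
Proof.
by move=> ks v Rv; rewrite !actM ks ?act_0 //; apply: reach_act.
Qed.

Lemma kill_scalar a (b : K) : (forall v, R v -> act v a = b *: v) -> kill (a - b%:A).
Proof.
move=> aE v Rv; have -> : act v (a - b%:A) = act v a - act v b%:A by exact: linearB.
by rewrite aE // linearZ_LR act_one subrr.
Qed.

(** The recursion [E_(g h^(k+1)) = [E_(g h^k), h]] is that of the operators. *)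
Lemma act_omega k v : act v (x k) = xop q mop k v.
Proof.
elim: k v => [|k IH] v.
  rewrite bracket_omega0 (act_letter1 act_one act_letter) /= xopE.
  by rewrite q_gt0.
rewrite bracket_omegaS -/(commutator _ _).
rewrite (act_commutator F_ind act_one act_letter) !IH -xop_comm.
by rewrite !(act_letter1 act_one act_letter).
Qed.

Lemma kill_bracket w : (2 <= count_mem lg w)%N -> kill (bracket X w).
Proof.
move=> w2 v _; have xopCq := xopC q mopC.
have op_g u : letter_op lg u = xop q mop 0 u by rewrite xopE q_gt0.
have := acts_by_count_bracket F_ind act_one act_letter (fun=> erefl) op_g
  xop_comm xopCq w.
by case: (count_mem lg w) w2 => [|[|m]] // _ /=; apply.
Qed.

Lemma kill_omega : kill (x q).
Proof. by move=> v _; rewrite act_omega xopE ltnn. Qed.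

Lemma iter_fun_eq (f g : V -> V) m : f =1 g -> iter m f =1 iter m g.
Proof. by move=> fg v; elim: m => //= m ->. Qed.

Lemma kill_order_omega i m (b : K) : (i < q)%N -> iter m (mop i) one = b *: one ->
  kill (x i ^+ m - b%:A).
Proof.
move=> iq mE; apply: kill_scalar => v Rv.
rewrite (act_expr F_ind act_one act_letter) (@iter_fun_eq _ (mop i)).
  exact: (reach_order mopC mE Rv).
by move=> u; rewrite act_omega xopE iq.
Qed.

(** In characteristic [p] the commutator of [x_i] with [h^p] is [x_(i+p)], which
    acts as zero. *)
Lemma iter_hop_mop i v : (i < q.+1)%N -> iter p H (mop i v) = mop i (iter p H v).
Proof.
rewrite ltnS leq_eqVlt => /orP[/eqP->|iq].
  by elim: p => //= m ->; apply: hop_mopq.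
have xh k : x k * h - h * x k = x k.+1 by rewrite bracket_omegaS.
have p0 (a : F) : a *+ p = 0 by rewrite -scaler_nat (pcharf0 charKp) scale0r.
have := congr1 (act v) (commute_expr_prime xh i (pcharf_prime charKp) p0).
rewrite linearD !actM !act_omega !xopE iq ifF ?addr0; last first.
  by rewrite pq addnS; apply/negbTE; rewrite -leqNgt leqW // leq_addl.
rewrite !(act_expr F_ind act_one act_letter) => E.
have hE u : act u h = H u by rewrite (act_letter1 act_one act_letter).
by rewrite -!(iter_fun_eq p hE).
Qed.

(** At [one] the derivation vanishes and [h] acts as [mop q]; both sides commute
    with the multiplication operators. *)
Lemma iter_hop_reach m v : (p %| m)%N -> R v -> iter m H v = iter m (mop q) v.
Proof.
move=> /dvdnP[t ->]; have comm i u : (i < q.+1)%N ->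
    iter (t * p) H (mop i u) = mop i (iter (t * p) H u).
  move=> iq; elim: t => //= t IH; rewrite mulSn !iterD IH.
  exact: iter_hop_mop.
elim=> [||a u w _ uE _ wE|i u iq _ uE].
- have iter0 (f : {linear V -> V}) n : iter n f 0 = 0 by elim: n => //= n ->; rewrite linear0.
  by rewrite !iter0.
- have hop_power n : H (iter n (mop q) one) = mop q (iter n (mop q) one).
    elim: n => [|n IH]; first by rewrite hopE (delta_one mop dop_one) subr0.
    by rewrite iterS (hop_mopq dop_mop mopC dop_mopC) IH.
  by elim: (t * p)%N => [//|n IH]; rewrite !iterS IH hop_power.
- by rewrite !iter_linear uE wE.
- by rewrite comm // uE iter_mop_mop.
Qed.

Lemma kill_order_h m (b : K) : (p %| m)%N -> iter m (mop q) one = b *: one ->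
  kill (h ^+ m - b%:A).
Proof.
move=> pm mE; apply: kill_scalar => v Rv.
rewrite (act_expr F_ind act_one act_letter) (@iter_fun_eq _ H).
  by rewrite iter_hop_reach //; apply: (reach_order mopC mE Rv).
by move=> u; rewrite (act_letter1 act_one act_letter).
Qed.

Section Functional.
Variables (B : augAlg K) (pi : F -> B).
Hypothesis piP : presents kill pi.

(** The representation evaluated at [one] descends to the quotient. *)
Lemma presented_functional :
  exists Phi : {linear B -> V}, forall a, Phi (pi a) = act one a.
Proof.
pose G b v := exists2 a, pi a = b & act one a = v.
have Gex b : exists v, G b v.
  by have [a aE] := pres_onto piP b; exists (act one a), a.
have Guniq b v w : G b v -> G b w -> v = w.
  move=> [a <- <-] [a' aa' <-]; apply/eqP; rewrite -subr_eq0.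
  have <- : act one (a - a') = act one a - act one a' by exact: linearB.
  apply/eqP; apply: (pres_kill piP); last exact: Reach1.
  by rewrite (pres_sub piP) aa' subrr.
have Glin (k : K) b b' v v' : G b v -> G b' v' -> G (k *: b + b') (k *: v + v').
  move=> [a <- <-] [a' <- <-]; exists (k *: a + a'); last exact: linearP.
  exact: (pres_linear piP).
have [Phi PhiG] := linear_choice Gex Guniq Glin.
by exists Phi => a; apply: Guniq (PhiG (pi a)) _; exists a.
Qed.

Variables (N : nat -> nat) (I : pred nat) (c : nat -> K).
Hypothesis N_gt0 : forall i, (0 < N i)%N.
Hypothesis p_dvd_N : forall i, (p %| N i)%N.
Hypothesis I0 : I 0%N.
Hypothesis aug_h : aug F h = 0.
Hypothesis rel_omega2 : forall i j, (i < j)%N -> pi (bracket X (omega i ++ omega j)) = 0.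
Hypothesis rel_omega : pi (x q) = 0.
Hypothesis rel_order_x : forall i, (i < q)%N -> I i -> pi (x i) ^+ N i = (c i)%:A.
Hypothesis rel_order_h : I q -> pi h ^+ N q = (c q)%:A.
Variables (d : nat) (free : nat -> nat) (lamV : {linear V -> polynomials K d}).
Hypothesis free_lt : forall l, (l < d)%N -> (free l < q.+1)%N.
Hypothesis free_nI : forall l, (l < d)%N -> ~~ I (free l).
Hypothesis freeP : forall i, (i < q.+1)%N -> ~~ I i -> exists2 l, (l < d)%N & free l = i.
Hypothesis lamV_var : forall l v, (l < d)%N ->
  lamV (iter (N (free l)) (mop (free l)) v) = ps_var (polynomials K d) l (lamV v).
Hypothesis lamV_zero : forall w : expo q.+1 -> V, w expo0 = one ->
  (forall i e, (i < q.+1)%N -> w (raise i e) = mop i (w e)) ->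
  forall i e, (i < q.+1)%N -> ~~ (N i %| (expo_at e i).+1)%N -> lamV (w e) = 0.
Hypothesis lamV_top : forall w : expo q.+1 -> V, w expo0 = one ->
  (forall i e, (i < q.+1)%N -> w (raise i e) = mop i (w e)) ->
  forall e, (forall i, (i < q.+1)%N -> expo_at e i = (N i).-1) ->
  lamV (w e) = ps_one (polynomials K d).

Theorem presented_AS_Gorenstein : AS_Gorenstein B.
Proof.
have [Phi PhiE] := presented_functional.
pose xB k := pi (x k).
have xh k : xB k * pi h - pi h * xB k = xB k.+1.
  by rewrite /xB bracket_omegaS (pres_sub piP) !(pres_mul piP).
have xC k l : xB k * xB l = xB l * xB k.
  wlog kl : k l / (k < l)%N.
    by move=> W; have [/W->|/W->|->] := ltngtP k l.
  apply/eqP; rewrite -subr_eq0; apply/eqP; rewrite -(rel_omega2 kl) bracket_omega2 //.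
  by rewrite (pres_sub piP) !(pres_mul piP).
have x0 k : (q <= k)%N -> xB k = 0.
  move=> /subnKC <-; elim: (k - q)%N => [|m IH]; first by rewrite addn0; apply: rel_omega.
  by rewrite addnS -xh IH mul0r mulr0 subr0.
have gen (P : B -> Prop) : P 0 ->
    (forall (k : K) a b, P a -> P b -> P (k *: a + b)) -> P 1 ->
    (forall a, P a -> P (xB 0%N * a)) -> (forall a, P a -> P (pi h * a)) ->
  forall a, P a.
  move=> P0 PL P1 Px Ph b; have [a <-] := pres_onto piP b.
  elim/F_ind: a => [|k a a' Pa Pa'||e a Pa].
  - by rewrite (pres_zero piP).
  - by rewrite (pres_linear piP); apply: PL.
  - by rewrite (pres_one piP).
  - by rewrite (pres_mul piP); case: e; [apply: Ph|apply: (Px)].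
have order i : (i < q.+1)%N -> I i -> letter_at q xB (pi h) i ^+ N i = (c i)%:A.
  rewrite ltnS leq_eqVlt /letter_at => /orP[/eqP->|iq]; first by rewrite ltnn.
  by rewrite iq; apply: rel_order_x.
have Phi_one : Phi 1 = one by rewrite -(pres_one piP) PhiE act_one.
have Phi_x k b : (k < q)%N -> Phi (xB k * b) = mop k (Phi b).
  move=> kq; have [a <-] := pres_onto piP b.
  by rewrite -(pres_mul piP) !PhiE actM act_omega xopE kq.
have Phi_h b : Phi (pi h * b) = H (Phi b).
  by have [a <-] := pres_onto piP b; rewrite -(pres_mul piP) !PhiE act_letter.
have hop_one : H one = mop q one by rewrite hopE (delta_one mop dop_one) subr0.
have aug_free l : (l < d)%N -> aug B (letter_at q xB (pi h) (free l)) = 0.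
  move=> ld; have := free_nI ld; rewrite /letter_at; case: ifP => _ fI.
    rewrite (pres_aug piP) aug_bracket //= size_nseq ltnS lt0n.
    by apply: contra fI => /eqP->.
  by rewrite (pres_aug piP).
exact: frobenius_AS_Gorenstein (normal_form_frobenius charKp pq N_gt0 p_dvd_N
  xC xh x0 gen order free_lt freeP mopC (hop_mopq dop_mop mopC dop_mopC) hop_one
  Phi_one Phi_x Phi_h q_gt0 lamV_var lamV_zero lamV_top aug_free).
Qed.

End Functional.
End Killing.

(** * The representation on reduced monomials *)

Section Family.
Variables (K : fieldType) (p q : nat) (N : nat -> nat) (I : pred nat) (c : nat -> K).
Hypothesis charKp : p \in [pchar K].
Hypothesis pq : p = q.+1.
Hypothesis q_gt0 : (0 < q)%N.
Hypothesis N_gt0 : forall i, (0 < N i)%N.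
Hypothesis p_dvd_N : forall i, (p %| N i)%N.

Local Notation F := (free_augAlg K).
Local Notation V := ({malg K[expo q.+1]} : lmodType K).
Local Notation one := (<< expo0 >> : V).
Local Notation X := (monX N I c : nat -> {linear V -> V}).
Local Notation D := (monD : nat -> {linear V -> V}).
Local Notation op := (letter_op q X D).

Let N_gt1 i : (1 < N i)%N.
Proof. by apply: leq_trans (dvdn_leq (N_gt0 i) (p_dvd_N i)); rewrite pq ltnS. Qed.

Let N_char i : (N i)%:R = 0 :> K.
Proof. by have /dvdnP[k ->] := p_dvd_N i; rewrite natrM (pcharf0 charKp) mulr0. Qed.

Let D_X i v : (i < q.+1)%N -> D i (X i v) = X i (D i v) + v.
Proof. exact: (monD_monX I c N_gt1 N_char). Qed.
Let X_C i j v : X i (X j v) = X j (X i v).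
Proof. exact: monXC. Qed.
Let D_XC i j v : i != j -> D i (X j v) = X j (D i v).
Proof. exact: monD_monXC. Qed.
Let D_one i : (i < q.+1)%N -> D i one = 0.
Proof. exact: monD_one. Qed.

Let F_ind := @free_alg_ind K.
Let acts_one v : act op v 1 = v.
Proof. exact: act_one. Qed.
Let acts_letter v e (a : F) : act op v (letter K e * a) = op e (act op v a).
Proof. exact: act_letter. Qed.

(** The representation, evaluated at [one], descends to the quotients of the free
    algebra by such elements. *)
Definition relation : F -> Prop := kill q one X (act op).

Lemma relation0 : relation 0.
Proof. exact: kill_zero. Qed.

Lemma relationD a b : relation a -> relation b -> relation (a + b).
Proof. exact: kill_add. Qed.

Lemma relationM a s b : relation s -> relation (a * s * b).
Proof. exact: (kill_mul F_ind D_X X_C D_XC D_one acts_one acts_letter). Qed.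

Lemma relation_word w : (2 <= count_mem lg w)%N -> relation (E K w).
Proof. exact: (kill_bracket F_ind q_gt0 D_X X_C D_XC acts_one acts_letter). Qed.

Lemma relation_omega : relation (E K (omega q)).
Proof. exact: (kill_omega F_ind q_gt0 D_X X_C D_XC acts_one acts_letter). Qed.

Lemma relation_order_omega i : (i < q)%N -> I i ->
  relation (E K (omega i) ^+ N i - (c i)%:A).
Proof.
move=> iq Ii.
apply: (kill_order_omega F_ind q_gt0 D_X X_C D_XC acts_one acts_letter iq).
exact: (monX_order c N_gt1 (leqW iq) Ii).
Qed.

Lemma relation_order_h : I q -> relation (letter K lh ^+ N q - (c q)%:A).
Proof.
move=> Iq.
apply: (kill_order_h F_ind charKp pq q_gt0 D_X X_C D_XC D_one acts_one acts_letter (p_dvd_N q)).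
exact: (monX_order c N_gt1 (ltnSn q) Iq).
Qed.

Theorem family_AS_Gorenstein (B : augAlg K) (pi : F -> B) :
  presents relation pi -> I 0%N ->
  (forall i j, (i < j)%N -> pi (E K (omega i ++ omega j)) = 0) ->
  pi (E K (omega q)) = 0 ->
  (forall i, (i < q)%N -> I i -> pi (E K (omega i) ^+ N i - (c i)%:A) = 0) ->
  (I q -> pi (letter K lh ^+ N q - (c q)%:A) = 0) ->
  AS_Gorenstein B.
Proof.
move=> piP I0 rel2 relq rel_x rel_h.
have order a m (b : K) : pi (a ^+ m - b%:A) = 0 -> pi a ^+ m = b%:A.
  rewrite (pres_sub piP) (pres_exp piP) (pres_scale piP) (pres_one piP).
  by move/eqP; rewrite subr_eq0 => /eqP.
have relx i (iq : (i < q)%N) (Ii : I i) := order _ _ _ (rel_x i iq Ii).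
have relh (Iq : I q) := order _ _ _ (rel_h Iq).
have aug_h : aug F (letter K lh) = 0 by rewrite counit_letter.
exact: (presented_AS_Gorenstein F_ind charKp pq q_gt0 D_X X_C D_XC D_one
  acts_one acts_letter piP N_gt0 p_dvd_N I0 aug_h rel2 relq relx relh
  (lamV := top_coef K q.+1 N I)
  (@free_index_lt q.+1 I) (@free_index_free q.+1 I) (@free_index_onto q.+1 I)
  (top_coef_var c N_gt1) (@top_coef_zero K q.+1 N I c)
  (@top_coef_top K q.+1 N I c N_gt1)).
Qed.

End Family.

(** * The quotients of the free algebra *)

Section Quotients.
Variables (K : fieldType) (n p q : nat) (charKp : p \in [pchar K]).
Variables (N : nat -> nat) (I : pred nat) (c : nat -> K).
Hypothesis pq : p = q.+1.
Hypothesis q_gt0 : (0 < q)%N.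
Hypothesis N_gt0 : forall i, (0 < N i)%N.
Hypothesis p_dvd_N : forall i, (p %| N i)%N.
Hypothesis I0 : I 0%N.
Hypothesis N0 : N 0%N = n.
Hypothesis c0 : c 0%N = 1.

Local Notation kills := (relation q N I c).
Local Notation g := (letter K lg).
Local Notation h := (letter K lh).

Let presentsQ (A : augAlg K) (pi : free_augAlg K -> A) (piP : presents kills pi) :=
  presents_quotient (@relation0 K q N I c) (@relationD K q N I c)
    (relationM charKp pq q_gt0 N_gt0 p_dvd_N) piP.

Let Tbar_presents : presents kills (@Tbar_map K).
Proof.
apply: (presentsQ (presents_id (@relation0 K q N I c))) => _ [w [_ w2 ->]].
by exists (E K w) => //; apply: (relation_word charKp pq q_gt0 N_gt0 p_dvd_N).
Qed.

Lemma Tbar_word i j : (i < j)%N -> Tbar_map (E K (omega i ++ omega j)) = 0.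
Proof.
move=> ij; apply: quotient_map_rel; exists (omega i ++ omega j); split=> //.
  exact: lyndon_omega2.
by rewrite count_cat /= !count_nseq.
Qed.

Let relation_g : kills (g ^+ n - 1).
Proof.
have := relation_order_omega (c := c) charKp pq q_gt0 N_gt0 p_dvd_N q_gt0 I0.
by rewrite N0 c0 scale1r.
Qed.

Let Tbar_g : Tbar_map g ^+ n - 1 = Tbar_map (g ^+ n - 1).
Proof.
by rewrite (pres_sub Tbar_presents) (pres_exp Tbar_presents) (pres_one Tbar_presents).
Qed.

Let Tn_presents : presents kills (Tn_map n).
Proof.
by apply: (presentsQ Tbar_presents) => _ ->; exists (g ^+ n - 1); rewrite ?Tbar_g.
Qed.

Lemma Tn_g : Tn_map n (g ^+ n - 1) = 0.
Proof. by apply: quotient_map_rel; rewrite /Tn_rel -Tbar_g. Qed.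

Let Tn'p_presents : presents kills (Tn'p_map n charKp).
Proof.
apply: (presentsQ Tn_presents) => _ ->; exists (E K (omega p.-1)) => //.
by rewrite pq; apply: relation_omega charKp pq q_gt0 N_gt0 p_dvd_N.
Qed.

Lemma Tn'p_omega : Tn'p_map n charKp (E K (omega q)) = 0.
Proof. by apply: quotient_map_rel; rewrite /Tn'p_rel pq. Qed.

Lemma Tn'p_word i k : (i < k)%N -> Tn'p_map n charKp (E K (omega i ++ omega k)) = 0.
Proof. by move=> ik; rewrite /Tn'p_map /Tn_map Tbar_word // !quotient_map0. Qed.

Lemma Tn'p_g : Tn'p_map n charKp (g ^+ n - 1) = 0.
Proof. by rewrite /Tn'p_map Tn_g quotient_map0. Qed.

Lemma Tn'p_AS_Gorenstein : (forall i, I i -> i = 0%N) -> AS_Gorenstein (Tn'p n charKp).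
Proof.
move=> onlyI; apply: (family_AS_Gorenstein charKp pq q_gt0 N_gt0 p_dvd_N Tn'p_presents I0).
- exact: Tn'p_word.
- exact: Tn'p_omega.
- by move=> i _ /onlyI ->; rewrite N0 c0 scale1r Tn'p_g.
- by move=> /onlyI q0; move: q_gt0; rewrite q0.
Qed.

Section PowerOfH.
Hypothesis Iq : I q.
Hypothesis Nq : N q = p.
Hypothesis cq : c q = 0.

Let relation_h : kills (h ^+ p).
Proof.
have := relation_order_h (c := c) charKp pq q_gt0 N_gt0 p_dvd_N Iq.
by rewrite Nq cq scale0r subr0.
Qed.

Let Tnp_presents : presents kills (Tnp_map n charKp).
Proof.
apply: (presentsQ Tn'p_presents) => _ ->; exists (h ^+ p) => //.
exact/esym/(pres_exp Tn'p_presents).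
Qed.

Lemma Tnp_h : Tnp_map n charKp (h ^+ p) = 0.
Proof. by apply: quotient_map_rel; apply: (pres_exp Tn'p_presents). Qed.

Lemma Tnp_AS_Gorenstein : (forall i, I i -> i = 0%N \/ i = q) ->
  AS_Gorenstein (Tnp n charKp).
Proof.
move=> onlyI; apply: (family_AS_Gorenstein charKp pq q_gt0 N_gt0 p_dvd_N Tnp_presents I0).
- by move=> i k ik; rewrite /Tnp_map Tn'p_word // quotient_map0.
- by rewrite /Tnp_map Tn'p_omega quotient_map0.
- move=> i iq /onlyI[->|iE]; last by rewrite iE ltnn in iq.
  by rewrite N0 c0 scale1r /Tnp_map Tn'p_g quotient_map0.
- by move=> _; rewrite Nq cq scale0r subr0 Tnp_h.
Qed.

Variables (j : nat) (d : nat -> nat).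
Hypothesis jq : (j < q)%N.
Hypothesis Ij : forall k, (1 <= k <= j)%N -> I k.
Hypothesis Nj : forall k, (1 <= k <= j)%N -> N k = (p ^ d k)%N.
Hypothesis cj : forall k, (1 <= k <= j)%N -> c k = 0.

Let Tnpd_map (a : free_augAlg K) : Tnpd n charKp j d :=
  quotient_map (Tnpd_rel_aug (d := d)) (Tnp_map n charKp a).

Let Tnpd_presents : presents kills Tnpd_map.
Proof.
apply: (presentsQ Tnp_presents) => _ [k [kj ->]].
exists (E K (omega k) ^+ (p ^ d k)); last exact/esym/(pres_exp Tnp_presents).
have kq : (k < q)%N by case/andP: kj => _ /leq_ltn_trans; apply.
have := relation_order_omega (c := c) charKp pq q_gt0 N_gt0 p_dvd_N kq (Ij kj).
by rewrite Nj // cj // scale0r subr0.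
Qed.

Lemma Tnpd_AS_Gorenstein : (forall i, I i -> i = 0%N \/ i = q \/ (1 <= i <= j)%N) ->
  AS_Gorenstein (Tnpd n charKp j d).
Proof.
move=> onlyI; apply: (family_AS_Gorenstein charKp pq q_gt0 N_gt0 p_dvd_N Tnpd_presents I0).
- by move=> i k ik; rewrite /Tnpd_map /Tnp_map Tn'p_word // !quotient_map0.
- by rewrite /Tnpd_map /Tnp_map Tn'p_omega !quotient_map0.
- move=> i iq /onlyI[->|[iE|ij]]; last 2 first.
  + by rewrite iE ltnn in iq.
  + rewrite Nj // cj // scale0r subr0; apply: quotient_map_rel; exists i; split=> //.
    exact: (pres_exp Tnp_presents).
  by rewrite N0 c0 scale1r /Tnpd_map /Tnp_map Tn'p_g !quotient_map0.
- by move=> _; rewrite Nq cq scale0r subr0 /Tnpd_map Tnp_h quotient_map0.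
Qed.

End PowerOfH.
End Quotients.

Theorem corollary4p7 (K : fieldType) (p n : nat) (charKp : p \in [pchar K])
  (n_ge2 : (2 <= n)%N) (p_dvd_n : (p %| n)%N)
  (Egh_neq0 : Tn_map n (E K (omega 1)) != 0) :
  [/\ AS_Gorenstein (Tn'p n charKp),
      AS_Gorenstein (Tnp n charKp)
    & forall (j : nat) (d : nat -> nat),
        (1 <= j <= p - 2)%N ->
        (1 <= d 1)%N ->
        (forall k, (1 <= k < j)%N -> (d k <= d k.+1)%N) ->
        AS_Gorenstein (Tnpd n charKp j d)].
Proof.
have p_gt1 := char_gt1 charKp; pose q := p.-1.
have pq : p = q.+1 by rewrite prednK // ltnW.
have q_gt0 : (0 < q)%N by rewrite -ltnS -pq.
have n_gt0 : (0 < n)%N := ltnW n_ge2.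
pose c k : K := (k == 0%N)%:R.
have cq : c q = 0 by rewrite /c gtn_eqF.
(* The [p]-th powers of the unbounded letters are central. *)
pose N1 k := if k is 0 then n else p.
have N1_gt0 k : (0 < N1 k)%N by case: k => [|k] //=; apply: ltnW.
have p_dvd_N1 k : (p %| N1 k)%N by case: k => [|k] /=.
have N1q : N1 q = p by rewrite /N1; case: (q) q_gt0.
split.
- apply: (@Tn'p_AS_Gorenstein K n p q charKp N1 (pred1 0%N) c) => //.
  by move=> i /eqP.
- apply: (@Tnp_AS_Gorenstein K n p q charKp N1 (pred2 0%N q) c) => //.
    by rewrite /= eqxx orbT.
  by move=> i /pred2P.
move=> j d /andP[j_ge1 jp] d1 dS.
have d_gt0 k : (1 <= k <= j)%N -> (0 < d k)%N.
  elim: k => // -[|k] IH // /andP[_ kj].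
  exact: leq_trans (IH (ltnW kj)) (dS k.+1 kj).
have jq : (j < q)%N by rewrite /q; lia.
pose N k := if (1 <= k <= j)%N then (p ^ d k)%N else N1 k.
pose I k := [|| k == 0%N, k == q | (1 <= k <= j)%N].
apply: (@Tnpd_AS_Gorenstein K n p q charKp N I c) => //.
- by move=> k; rewrite /N; case: ifP => // _; rewrite expn_gt0 ltnW.
- move=> k; rewrite /N; case: ifP => [/d_gt0 dk|//].
  by rewrite -[X in (X %| _)%N]expn1 dvdn_exp2l.
- by rewrite /I eqxx orbT.
- by rewrite /N ifF //; apply/negbTE; rewrite negb_and -!ltnNge jq orbT.
- by move=> k kj; rewrite /I kj !orbT.
- by move=> k kj; rewrite /N kj.
- by case.
- by move=> k /or3P[/eqP|/eqP|]; [left|right; left|right; right].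
Qed.
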